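(* For every $K>0$ there exists a constant $C>0$ depending only on $K$ (in particular not on $d$) such that the following holds. Let $d\ge1$ and let $a$ be a bounded, differentiable function on $\mathbb{R}^d$ such that for almost every $\xi\in\mathbb{R}^d$ $$|a(\xi)|\le K\frac{|\xi|}{\sqrt d},\qquad |a(\xi)|\le K\frac{\sqrt d}{|\xi|},\qquad |\langle\xi,\nabla a(\xi)\rangle|\le K.$$ Consider the family of Fourier multiplier operators $\{\mathcal{A}_t\}_{t>0}$ given by $\widehat{\mathcal{A}_tf}(\xi)=a(t\xi)\widehat f(\xi)$. Then $$\|\mathcal{A}_*\|_{L^2(\mathbb{R}^d)}\le C\,\|a\|_{L^\infty(\mathbb{R}^d)}^{1/4}.$$
   Context: The Fourier transform is $\widehat f(\xi)=\int_{\mathbb{R}^d}f(x)e^{-2\pi ix\cdot\xi}\,dx$. The maximal operator is $\mathcal{A}_*f(x)=\sup_{t>0}|\mathcal{A}_tf(x)|$, and $\|\mathcal{A}_*\|_{L^2(\mathbb{R}^d)}$ is its operator norm on $L^2(\mathbb{R}^d)$, i.e. the best constant in $\|\sup_{t>0}|\mathcal{A}_tf|\|_{L^2(\mathbb{R}^d)}\le\|\mathcal{A}_*\|_{L^2(\mathbb{R}^d)}\|f\|_{L^2(\mathbb{R}^d)}$; here $f$ may be taken to range over Schwartz functions, for which $\mathcal{A}_tf(x)=\int_{\mathbb{R}^d}a(t\xi)\widehat f(\xi)e^{2\pi ix\cdot\xi}\,d\xi$ is defined at every point $x$, so that the supremum over $t>0$ is meaningful pointwise. *)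

(* Defs.v *)
From HB Require Import structures.
From mathcomp Require Import all_boot all_order all_algebra.
From mathcomp Require Import complex.
From mathcomp Require Import all_classical all_reals all_analysis.

Set Implicit Arguments.
Unset Strict Implicit.
Unset Printing Implicit Defensive.

Import Order.TTheory GRing.Theory Num.Theory.
Import numFieldNormedType.Exports.

Local Open Scope classical_set_scope.
Local Open Scope ring_scope.

(* ['rV[T]_n] carries the product sigma-algebra (generated by the coordinate
   functions), exactly as the library does for [n.-tuple T]. *)
Section measurable_rV.
Context {d} {T : sigmaRingType d} (n : nat).

Let coord : 'I_n -> 'rV[T]_n -> T := fun i v => v ord0 i.

Let rV_set0 : g_sigma_preimage coord set0.
Proof. exact: sigma_algebra0. Qed.

Let rV_setC A : g_sigma_preimage coord A -> g_sigma_preimage coord (~` A).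
Proof. exact: sigma_algebraC. Qed.

Let rV_bigcup (F : (set 'rV[T]_n)^nat) :
  (forall i, g_sigma_preimage coord (F i)) ->
  g_sigma_preimage coord (\bigcup_i (F i)).
Proof. exact: sigma_algebra_bigcup. Qed.

HB.instance Definition _ := @isMeasurable.Build (measure_tuple_display d)
  'rV[T]_n (g_sigma_preimage coord) rV_set0 rV_setC rV_bigcup.

End measurable_rV.

Lemma measurable_rV_coord d (T : measurableType d) n (i : 'I_n) :
  measurable_fun [set: 'rV[T]_n] (fun v => v ord0 i).
Proof.
move=> _ Y mY; rewrite setTI; apply: sub_sigma_algebra => /=.
rewrite -bigcup_seq/=; exists i => /=; first by rewrite mem_index_enum.
by exists Y => //; rewrite setTI.
Qed.

Lemma measurable_fun_rV d1 d2 (T1 : measurableType d1)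
    (T2 : measurableType d2) n (f : T1 -> 'rV[T2]_n) :
  (forall i, measurable_fun [set: T1] (fun x => f x ord0 i)) ->
  measurable_fun [set: T1] f.
Proof.
move=> mf _ A mA; pose F := image_set_system setT f measurable.
suff: (@measurable _ 'rV[T2]_n) `<=` F by apply.
apply: smallest_sub; first exact/sigma_algebra_image/sigma_algebra_measurable.
move=> B; rewrite -bigcup_seq => -[i _ [C mC <-]].
by rewrite /F /image_set_system /= setTI; exact: mf.
Qed.

Section lebesgue_rV.
Context {R : realType}.

Definition rV_cons n (p : R * 'rV[R]_n) : 'rV[R]_n.+1 :=
  row_mx (\row_(_ < 1) p.1) p.2.

Definition rV_uncons n (v : 'rV[R]_n.+1) : R * 'rV[R]_n :=
  (v ord0 ord0, \row_(j < n) v ord0 (lift ord0 j)).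

Lemma rV_cons0 n (p : R * 'rV[R]_n) : rV_cons p ord0 ord0 = p.1.
Proof.
rewrite /rV_cons mxE; case: fintype.splitP => [j _|j //]; exact: mxE.
Qed.

Lemma rV_consS n (p : R * 'rV[R]_n) j :
  rV_cons p ord0 (lift ord0 j) = p.2 ord0 j.
Proof.
rewrite /rV_cons mxE; case: fintype.splitP => [[[]]//|k /= [jk]].
by congr (p.2 _ _); exact: val_inj.
Qed.

Lemma rV_consK n : cancel (@rV_cons n) (@rV_uncons n).
Proof.
move=> [x v]; rewrite /rV_uncons rV_cons0; congr pair.
by apply/rowP => j; rewrite mxE rV_consS.
Qed.

Lemma rV_unconsK n : cancel (@rV_uncons n) (@rV_cons n).
Proof.
move=> v; apply/rowP => i.
by case: (unliftP ord0 i) => [j|] ->; rewrite ?rV_cons0 ?rV_consS ?mxE.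
Qed.

Lemma measurable_rV_cons n : measurable_fun [set: R * 'rV[R]_n] (@rV_cons n).
Proof.
apply: measurable_fun_rV => i; case: (unliftP ord0 i) => [j|] ->.
- under eq_fun do rewrite rV_consS.
  exact: (measurableT_comp (measurable_rV_coord j) measurable_snd).
- under eq_fun do rewrite rV_cons0.
  exact: measurable_fst.
Qed.

Lemma measurable_rV_uncons n :
  measurable_fun [set: 'rV[R]_n.+1] (@rV_uncons n).
Proof.
apply/measurable_fun_pairP; split; first exact: measurable_rV_coord.
apply: measurable_fun_rV => i; under eq_fun do rewrite mxE.
exact: measurable_rV_coord.
Qed.

Section step.
Context (n : nat) (mu : {sigma_finite_measure set 'rV[R]_n -> \bar R}).

Definition rV_cons_measure : set 'rV[R]_n.+1 -> \bar R :=
  pushforward (@lebesgue_measure R \x mu)%E (@rV_cons n).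

Let measure0_ : rV_cons_measure set0 = 0%E.
Proof. by rewrite /rV_cons_measure /pushforward preimage_set0 measure0. Qed.

Let measure_ge0_ A : (0 <= rV_cons_measure A)%E.
Proof. by rewrite /rV_cons_measure /pushforward measure_ge0. Qed.

Let measure_sigma_additive : semi_sigma_additive rV_cons_measure.
Proof.
move=> F mF tF mUF; rewrite /rV_cons_measure /pushforward preimage_bigcup.
have mp A : measurable A -> measurable (@rV_cons n @^-1` A).
  by move=> mA; rewrite -[X in measurable X]setTI; exact: measurable_rV_cons.
apply: measure_semi_sigma_additive.
- by move=> k; exact: mp.
- apply/trivIsetP => /= i j _ _ ij; rewrite -preimage_setI.
  by move/trivIsetP : tF => /(_ _ _ _ _ ij) ->//; rewrite preimage_set0.
- by rewrite -preimage_bigcup; exact: mp.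
Qed.

HB.instance Definition _ := isMeasure.Build _ _ _ rV_cons_measure
  measure0_ measure_ge0_ measure_sigma_additive.

Let measure_sigma_finite : sigma_finite setT rV_cons_measure.
Proof.
have /sigma_finiteP[F [TF ndF Foo]] := sigma_finiteT (@lebesgue_measure R).
have /sigma_finiteP[G [TG ndG Goo]] := sigma_finiteT mu.
exists (fun k => @rV_uncons n @^-1` (F k `*` G k)).
  rewrite -preimage_bigcup (_ : \bigcup_k _ = setT) ?preimage_setT//.
  apply/seteqP; split => // -[x v] _.
  have [k _ Fkx] : (\bigcup_i F i) x by rewrite -TF.
  have [l _ Glv] : (\bigcup_i G i) v by rewrite -TG.
  exists (maxn k l) => //; split => /=.
  - by move: x Fkx; exact/subsetPset/ndF/leq_maxl.
  - by move: v Glv; exact/subsetPset/ndG/leq_maxr.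
move=> k; have [mF Fk] := Foo k; have [mG Gk] := Goo k; split.
  rewrite -[X in measurable X]setTI.
  by apply: measurable_rV_uncons => //; exact: measurableX.
rewrite /rV_cons_measure /pushforward -comp_preimage.
rewrite (_ : _ \o _ = id); last by apply/funext => p; exact: rV_consK.
by rewrite preimage_id product_measure1E// lte_mul_pinfty// ge0_fin_numE.
Qed.

HB.instance Definition _ := Measure_isSigmaFinite.Build _ _ _ rV_cons_measure
  measure_sigma_finite.

End step.

(* Lebesgue measure on R^n, through the identification R^(n+1) = R x R^n. *)
Fixpoint lebesgue_rV n : {sigma_finite_measure set 'rV[R]_n -> \bar R} :=
  if n is m.+1 then rV_cons_measure (lebesgue_rV m) else \d_(0 : 'rV[R]_0).

End lebesgue_rV.

Section fourier_multipliers.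
Context {R : realType} (d : nat).
Local Notation Rd := 'rV[R]_d.
Local Notation mu := (@lebesgue_rV R d).

Implicit Types (x xi : Rd) (a f g : Rd -> R[i]).

Definition dotp x xi : R := \sum_(j < d) x ord0 j * xi ord0 j.

(* The library's norm on ['rV_d] is the sup norm. *)
Definition enorm x : R := Num.sqrt (dotp x x).

Definition cmod (z : R[i]) : R := ComplexField.Normc.normc z.

Definition cis (t : R) : R[i] := Complex (cos t) (sin t).

Definition cintegral g : R[i] :=
  Complex (\int[mu]_x complex.Re (g x)) (\int[mu]_x complex.Im (g x)).

(* [R[i]] is not a normed module over [R] in the library, so that real
   differentiability of a complex-valued function is stated on its real and
   imaginary parts. *)
Definition cdifferentiable g x : Prop :=
  differentiable (fun y => complex.Re (g y)) x /\
  differentiable (fun y => complex.Im (g y)) x.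

Definition cpartial (j : 'I_d) g x : R[i] :=
  Complex ('D_(delta_mx ord0 j) (fun y => complex.Re (g y)) x)
          ('D_(delta_mx ord0 j) (fun y => complex.Im (g y)) x).

(* Since mixed partial derivatives of smooth functions commute, finite sequences
   of directions play the role of multi-indices in [schwartz]. *)
Definition iter_cpartial (s : seq 'I_d) g : Rd -> R[i] := foldr cpartial g s.

(* <xi, grad g(xi)> *)
Definition euler_derivative g xi : R[i] :=
  \sum_(j < d) (xi ord0 j)%:C%C * cpartial j g xi.

Definition schwartz f : Prop :=
  forall s : seq 'I_d,
    (forall x, cdifferentiable (iter_cpartial s f) x) /\
    (forall alpha : 'I_d -> nat, exists M : R, forall x,
       `|\prod_(j < d) x ord0 j ^+ alpha j| * cmod (iter_cpartial s f x) <= M).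

Definition fourier f xi : R[i] :=
  cintegral (fun x => f x * cis (- (2 * pi * dotp x xi))).

Definition multiplier_op a (t : R) f x : R[i] :=
  cintegral (fun xi => a (t *: xi) * fourier f xi * cis (2 * pi * dotp x xi)).

Definition maximal_op a f x : \bar R :=
  ereal_sup [set (cmod (multiplier_op a t f x))%:E | t in [set t : R | 0 < t]].

(* The best constant in the L^2 inequality; it is +oo if there is none. *)
Definition maximal_opnorm a : \bar R :=
  ereal_inf [set c%:E | c in [set c : R | 0 <= c /\
    forall f, schwartz f ->
      ('N[mu]_2%:E[maximal_op a f] <=
       c%:E * 'N[mu]_2%:E[EFin \o cmod \o f])%E]].

Definition Linfty_norm a : \bar R := 'N[mu]_+oo[EFin \o cmod \o a]%E.

End fourier_multipliers.

(* Main.v *)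
Require Import Defs.
From HB Require Import structures.
From mathcomp Require Import all_boot all_order all_algebra.
From mathcomp Require Import complex.
From mathcomp Require Import all_classical all_reals all_analysis.
From mathcomp Require Import ess_sup_inf measurable_realfun.
From mathcomp Require Import ring lra.

(** Put t = e^u with u in R. For fixed x, the function h(u) = A_(e^u) f(x) is
    continuous, so it suffices to bound its supremum over u >= 0, and likewise
    that of u |-> h(-u). This is done by chaining over the dyadic meshes of
    [0, +oo[: from an integer, a dyadic point is reached by at most one increment
    of h per level l, and a weighted Cauchy-Schwarz inequality gives
      |h(u)|^2 <= (1 - r)^-1 sum_l r^-l sum_p |D_(l,p) h|^2,
    where D_(l,p) h = h((p+1) 2^-l) - h(p 2^-l) for l >= 1, D_(0,p) h = h(p), and
    r = 2^(-1/8) is [chain_ratio]. The right-hand side no longer depends on u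
    ([chaining], [chaining_complex]).

    Each D_(l,p) h is the value at x of a Fourier multiplier operator, whose
    multiplier is the same increment of b(u) = a(e^u xi). After integration in x
    the L^2 bound for the Fourier transform therefore leaves
      sum_l r^-l sum_p |D_(l,p) b|^2
    to be bounded for almost every xi ([integral_chain_sum_ifourier]). Along
    almost every ray, with y = |xi| / sqrt d and A the essential supremum of |a|,
    b is bounded by A, by K e^u y and by K e^-u / y, and it is 2K-Lipschitz
    ([ray_bounds]). Every increment over a step delta is thus at most 2A, at most
    a multiple of min (e^u y, e^-u / y), and at most 2 K delta. Multiplying the
    powers 1/2, 1/4 and 5/4 of these three bounds, and summing over p the fourth
    root of the second one at the cost of 1 / delta, bounds the sum over p by a
    multiple of A^(1/2) delta^(1/4) ([sum_increments]). At delta = 2^-l this gain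
    is r^(2l); half of it pays for the weight r^-l, the other half for the sum
    over l. So the square of the operator norm is at most a multiple of A^(1/2),
    with no dependence on d.

    Three analytic facts carry this. The L^2 bound is Bessel's inequality
    [bessel] for the cosine and sine transforms: damping by the Laplace kernel
    exp (-2 pi e sum_j |xi_j|), whose transform is a product of Poisson kernels
    of total mass 1, reduces it to Schur's test, and e tends to 0. The transform
    of a Schwartz function is integrable because each derivative yields a factor
    xi_j ([rschwartz_transform_decay]). Finally, the hypotheses on [a] hold off a
    null set only: by Fubini it meets almost every ray in a null set, and an
    everywhere differentiable function of one variable whose derivative is
    bounded by K off a null set is K-Lipschitz ([lipschitz_of_ae_derivative]). *)

Set Implicit Arguments.
Unset Strict Implicit.
Unset Printing Implicit Defensive.

Import Order.TTheory GRing.Theory Num.Theory.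
Import numFieldNormedType.Exports.

Local Open Scope classical_set_scope.
Local Open Scope ring_scope.

(** * Borel sets of R^d *)

Section measurability_rV.
Context {R : realType}.

(** An open set is a countable union of boxes with rational centres, and boxes are
    generated by the coordinates. *)
Lemma open_measurable_rV d (U : set 'rV[R]_d) : open U -> measurable U.
Proof.
move=> oU.
pose box (p : 'rV[rat]_d * nat) : set 'rV[R]_d :=
  [set x | forall j, `|x ord0 j - ratr (p.1 ord0 j)| < p.2.+1%:R^-1].
have mbox p : measurable (box p).
  rewrite (_ : box p = ~` \bigcup_j
      ~` [set x | `|x ord0 j - ratr (p.1 ord0 j)| < p.2.+1%:R^-1]).
    apply/measurableC/countable_bigcupT_measurable; first exact: countableP.
    move=> j; apply: measurableC; rewrite -[X in measurable X]setTI.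
    have mf : measurable_fun setT
        (fun x : 'rV[R]_d => `|x ord0 j - ratr (p.1 ord0 j)|).
      apply: measurableT_comp => //; apply: measurable_funB => //.
      exact: measurable_rV_coord.
    have mc : measurable_fun setT (fun _ : 'rV[R]_d => p.2.+1%:R^-1 : R) by [].
    by have := measurable_fun_ltr mf mc measurableT (Y := [set true]) I.
  apply/seteqP; split => [x xb [j _]|x xb j]; first by apply; exact: xb.
  by apply: contrapT => xj; apply: xb; exists j.
rewrite (_ : U = \bigcup_p (if pselect (box p `<=` U) then box p else set0)).
  apply: countable_bigcupT_measurable; first exact: countableP.
  by move=> p; case: pselect => pU //=; exact: measurable0.
apply/seteqP; split => [x Ux|x [p _ xp]]; last first.
  by move: xp; case: pselect => //= pU; exact: pU.
have /nbhs_ballP[e /= e0 eU] : nbhs x U by exact: open_nbhs_nbhs.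
have e20 : 0 < e / 2 by rewrite divr_gt0.
have [n ne] : exists n, n.+1%:R^-1 < e / 2 :> R.
  have [n _ h] := near_infty_natSinv_lt (PosNum e20).
  by exists n; exact: (h n (leqnn n)).
have qP j : exists q : rat, `|x ord0 j - ratr q| < n.+1%:R^-1.
  have n0 : 0 < n.+1%:R^-1 :> R by rewrite invr_gt0.
  have xx : x ord0 j < x ord0 j + n.+1%:R^-1 by rewrite ltrDl.
  have [q] := rat_in_itvoo xx.
  rewrite in_itv/= => /andP[q1 q2]; exists q.
  by rewrite distrC ger0_norm ?subr_ge0 ?ltW// ltrBlDl.
have [q hq] := choice qP.
exists (\row_j q j, n) => //.
case: pselect => [pU j|nU] /=; first by rewrite mxE.
exfalso; apply: nU => y yq; apply: eU; split => // i j; rewrite (ord1 i).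
have := yq j; rewrite /= mxE => yqj.
rewrite /ball/= -(subrKA (ratr (q j))) (le_lt_trans (ler_normD _ _))//.
by rewrite [e]splitr ltrD ?(lt_trans (hq j))// distrC (lt_trans yqj).
Qed.

Lemma continuous_measurable_rV d (f : 'rV[R]_d -> R) :
  continuous f -> measurable_fun setT f.
Proof.
move=> /continuousP cf; apply: (measurability _ (RGenOpens.measurableE R)) => //.
move=> _ [_ [a [b ->]] <-]; rewrite setTI.
by apply: open_measurable_rV; apply: cf; exact: interval_open.
Qed.

End measurability_rV.

(** * Lebesgue measure on R^d under slicing and affine maps *)

Section lebesgue_rV_theory.
Context {R : realType}.
Local Notation leb := (@lebesgue_measure R).
Local Open Scope ereal_scope.

Lemma ge0_integral_rVS n (f : 'rV[R]_n.+1 -> \bar R) :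
  measurable_fun setT f -> (forall v, 0 <= f v) ->
  \int[lebesgue_rV n.+1]_v f v =
  \int[leb]_x \int[lebesgue_rV n]_v f (rV_cons (x, v)).
Proof.
move=> mf f0 /=.
rewrite /rV_cons_measure ge0_integral_pushforward//=; last first.
  exact: measurable_rV_cons.
rewrite preimage_setT fubini_tonelli1//.
by apply: measurableT_comp => //; exact: measurable_rV_cons.
Qed.

Lemma ge0_integral_affine1 (s b : R) (f : R -> \bar R) :
  (0 < s)%R -> measurable_fun setT f -> (forall x, 0 <= f x) ->
  \int[leb]_x f (s * x + b)%R = s^-1%:E * \int[leb]_x f x.
Proof.
move=> s0 mf f0.
pose aff := (fun x : measurableTypeR R => s * x + b : measurableTypeR R)%R.
have maff : measurable_fun setT aff.
  by apply: measurable_funD => //; exact: mulrl_measurable.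
pose phi : {mfun (measurableTypeR R) >-> (measurableTypeR R)} :=
  HB.pack aff (isMeasurableFun.Build _ _ _ _ aff maff).
pose k : {nonneg R} := NngNum (ltW s0).
have E A : measurable A -> leb A = mscale k (pushforward leb phi) A.
  move: A; apply: lebesgue_measure_unique => X [[x y] /= _ <-].
  rewrite /mscale/= /pushforward.
  rewrite (_ : _ @^-1` _ = [set` `](x - b)%R / s, (y - b)%R / s]%R]); last first.
    apply/seteqP; split => z /=; rewrite !in_itv/= /aff
      ltr_pdivrMr// ler_pdivlMr// ltrBlDr lerBrDr mulrC; exact.
  rewrite !lebesgue_measure_itv/= !lte_fin ltr_pM2r ?invr_gt0// ltrD2r.
  case: ifP => _; last by rewrite mule0.
  by rewrite -!EFinB -EFinM; congr EFin; field; rewrite gt_eqF.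
rewrite [X in _ = _ * X](eq_measure_integral
    (mscale k (pushforward leb phi))); last by move=> A mA _; exact: E.
rewrite ge0_integral_mscale//= ge0_integral_pushforward//= preimage_setT.
by rewrite muleA -EFinM mulVf ?gt_eqF// mul1e.
Qed.

Lemma rV_cons_affine n (s : R) (b : 'rV[R]_n.+1) x (v : 'rV[R]_n) :
  (s *: rV_cons (x, v) + b)%R =
  rV_cons (s * x + (rV_uncons b).1, s *: v + (rV_uncons b).2)%R.
Proof.
apply/rowP => i; case: (unliftP ord0 i) => [j|] ->.
- by rewrite [LHS]mxE [X in (X + _)%R]mxE !rV_consS !mxE.
- by rewrite [LHS]mxE [X in (X + _)%R]mxE !rV_cons0.
Qed.

Lemma measurable_affine_rV d (s : R) (b : 'rV[R]_d) :
  measurable_fun setT (fun v : 'rV[R]_d => s *: v + b)%R.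
Proof.
apply: measurable_fun_rV => i; under eq_fun do rewrite !mxE.
apply: measurable_funD => //; apply: measurable_funM => //.
exact: measurable_rV_coord.
Qed.

(** One coordinate at a time, by Tonelli, from the one-dimensional change of
    variables. *)
Lemma ge0_integral_affine d (s : R) (b : 'rV[R]_d) (f : 'rV[R]_d -> \bar R) :
  (0 < s)%R -> measurable_fun setT f -> (forall x, 0 <= f x) ->
  \int[lebesgue_rV d]_x f (s *: x + b)%R =
  (s ^- d)%:E * \int[lebesgue_rV d]_x f x.
Proof.
move=> s0; elim: d b f => [|d IH] b f mf f0.
  rewrite expr0 invr1 mul1e; apply: eq_integral => x _.
  by congr f; apply/rowP => -[].
rewrite ge0_integral_rVS//; last first.
  by apply: measurableT_comp => //; exact: measurable_affine_rV.
rewrite ge0_integral_rVS//.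
have mfc : measurable_fun setT (fun p => f (rV_cons p)).
  by apply: measurableT_comp => //; exact: measurable_rV_cons.
under eq_integral => x _.
  under eq_integral do rewrite rV_cons_affine.
  rewrite (IH _ (fun v => f (rV_cons (s * x + _, v)%R)))//; last first.
    exact: (measurableT_comp mfc (measurable_pair1 _)).
  over.
rewrite ge0_integralZl//=.
- rewrite (@ge0_integral_affine1 s _ (fun x =>
    \int[lebesgue_rV d]_v f (rV_cons (x, v))))//.
  + by rewrite muleA -EFinM exprS invfM mulrC.
  + exact: (measurable_fun_fubini_tonelli_F (f \o @rV_cons R d) mfc (fun=> f0 _)).
  + by move=> x; exact: integral_ge0.
- apply: (measurableT_comp (f := fun x =>
    \int[lebesgue_rV d]_v f (rV_cons (x, v)))).
    exact: (measurable_fun_fubini_tonelli_F (f \o @rV_cons R d) mfc (fun=> f0 _)).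
  by apply: measurable_funD => //; exact: mulrl_measurable.
- by move=> x _; exact: integral_ge0.
- by rewrite lee_fin invr_ge0 exprn_ge0// ltW.
Qed.

Lemma lebesgue_rV_scale_null d (s : R) (N : set 'rV[R]_d) : (0 < s)%R ->
  measurable N -> lebesgue_rV d N = 0 ->
  lebesgue_rV d [set x | N (s *: x)%R] = 0.
Proof.
move=> s0 mN N0.
have mN' : measurable [set x | N (s *: x)%R].
  rewrite -[X in measurable X]setTI.
  rewrite (_ : [set x | N (s *: x)%R] = (fun x : 'rV[R]_d => s *: x + 0)%R @^-1` N).
    exact: measurable_affine_rV.
  by apply/seteqP; split => x /=; rewrite addr0.
rewrite -[X in lebesgue_rV d X]setIT -integral_indic//.
rewrite -[RHS](mule0 (s ^- d)%:E) -N0 -[X in lebesgue_rV d X]setIT.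
rewrite -integral_indic// -(ge0_integral_affine 0)//.
- by apply: eq_integral => x _; rewrite addr0.
- exact/measurable_EFinP/measurable_indic.
Qed.

Lemma integral_shift d (b : 'rV[R]_d) (f : 'rV[R]_d -> \bar R) :
  measurable_fun setT f ->
  \int[lebesgue_rV d]_x f (x + b)%R = \int[lebesgue_rV d]_x f x.
Proof.
move=> mf.
have E g : measurable_fun setT g -> (forall x, 0 <= g x) ->
    \int[lebesgue_rV d]_x g (x + b)%R = \int[lebesgue_rV d]_x g x.
  move=> mg g0; have := ge0_integral_affine b ltr01 mg g0.
  rewrite expr1n invr1 mul1e => <-.
  by apply: eq_integral => x _; rewrite scale1r.
rewrite integralE [RHS]integralE.
rewrite -(E f^\+ (measurable_funepos mf) (fun=> funepos_ge0 _ _)).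
rewrite -(E f^\- (measurable_funeneg mf) (fun=> funeneg_ge0 _ _)).
congr (_ - _); apply: eq_integral => x _; first by rewrite !funeposE.
by rewrite !funenegE.
Qed.

End lebesgue_rV_theory.

(** * Real-valued integrals and dominated Fubini *)

Section integrable_real.
Context d (T : measurableType d) {R : realType} (mu : {measure set T -> \bar R}).
Implicit Types (f g : T -> R).

Lemma integrableRZ (k : R) f : mu.-integrable setT (EFin \o f) ->
  mu.-integrable setT (EFin \o (fun x => k * f x)).
Proof. by move=> /(integrableZl measurableT k). Qed.

Lemma integrableRD f g : mu.-integrable setT (EFin \o f) ->
  mu.-integrable setT (EFin \o g) ->
  mu.-integrable setT (EFin \o (fun x => f x + g x)).
Proof. by move=> i1 /(integrableD measurableT i1). Qed.

Lemma integrableRB f g : mu.-integrable setT (EFin \o f) ->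
  mu.-integrable setT (EFin \o g) ->
  mu.-integrable setT (EFin \o (fun x => f x - g x)).
Proof. by move=> i1 /(integrableB measurableT i1). Qed.

Lemma integrableR_measurable f : mu.-integrable setT (EFin \o f) ->
  measurable_fun setT f.
Proof. by move=> /measurable_int/measurable_EFinP. Qed.

Lemma le_integrableR f g : measurable_fun setT f ->
  (forall x, `|f x| <= g x) -> mu.-integrable setT (EFin \o g) ->
  mu.-integrable setT (EFin \o f).
Proof.
move=> mf fg; apply: le_integrable => //; first exact/measurable_EFinP.
by move=> x _ /=; rewrite lee_fin (le_trans (fg x))// ler_norm.
Qed.

Lemma EFin_Rintegral f : mu.-integrable setT (EFin \o f) ->
  (\int[mu]_x f x)%:E = (\int[mu]_x (f x)%:E)%E.
Proof. by move=> /integrable_fin_num fi; rewrite /Rintegral fineK//; exact: fi. Qed.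

End integrable_real.

Section dominated_fubini.
Context {d1 d2} {T1 : measurableType d1} {T2 : measurableType d2} {R : realType}.
Variables (m1 : {sigma_finite_measure set T1 -> \bar R}).
Variables (m2 : {sigma_finite_measure set T2 -> \bar R}).
Variables (F : T1 * T2 -> R) (u : T1 -> R) (w : T2 -> R).
Hypothesis mF : measurable_fun setT F.
Hypothesis iu : m1.-integrable setT (EFin \o u).
Hypothesis iw : m2.-integrable setT (EFin \o w).
Hypothesis Fuw : forall x y, `|F (x, y)| <= u x * w y.

Let mEF : measurable_fun setT (EFin \o F).
Proof. exact/measurable_EFinP. Qed.

Lemma integrable_dominated_prod :
  (m1 \x m2)%E.-integrable setT (EFin \o F).
Proof.
apply/integrable12ltyP => //.
have mu' : measurable_fun setT (EFin \o u) by exact: measurable_int iu.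
have mw' : measurable_fun setT (EFin \o w) by exact: measurable_int iw.
have W0 : (0 <= \int[m2]_y `|(w y)%:E|)%E by exact: integral_ge0.
apply: (@le_lt_trans _ _
    (\int[m1]_x (`|(u x)%:E| * \int[m2]_y `|(w y)%:E|))%E).
- apply: ge0_le_integral => //.
  + by move=> x _; exact: integral_ge0.
  + apply: (measurable_fun_fubini_tonelli_F (abse \o (EFin \o F))).
      exact: measurableT_comp.
    by move=> p; exact: abse_ge0.
  + apply: emeasurable_funM; first exact: measurableT_comp mu'.
    exact: measurable_cst.
  + move=> x _; rewrite -ge0_integralZl//; last exact: measurableT_comp mw'.
    apply: ge0_le_integral => //.
    * apply: measurableT_comp => //.
      exact: (measurableT_comp mEF (measurable_pair1 _)).
    * apply: emeasurable_funM; first exact: measurable_cst.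
      exact: measurableT_comp mw'.
    * move=> y _; rewrite /= lee_fin -normrM.
      by rewrite (le_trans (Fuw _ _))// ler_norm.
- rewrite ge0_integralZr//; last exact: measurableT_comp mu'.
  move/integrableP : iu => [_ iu'].
  move/integrableP : iw => [_ iw'].
  by rewrite lte_mul_pinfty// ?integral_ge0// ge0_fin_numE// integral_ge0.
Qed.

Lemma integrable_dominated_pair1 x : m2.-integrable setT (fun y => (F (x, y))%:E).
Proof.
apply: (@le_integrable _ _ _ _ _ _ _ (EFin \o (fun y => u x * w y))) => //.
- exact: (measurableT_comp mEF (measurable_pair1 _)).
- by move=> y _ /=; rewrite lee_fin (le_trans (Fuw _ _))// ler_norm.
- exact: (integrableRZ _ iw).
Qed.

Lemma integrable_dominated_pair2 y : m1.-integrable setT (fun x => (F (x, y))%:E).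
Proof.
apply: (@le_integrable _ _ _ _ _ _ _ (EFin \o (fun x => w y * u x))) => //.
- exact: (measurableT_comp mEF (measurable_pair2 _)).
- by move=> x _ /=; rewrite lee_fin (le_trans (Fuw _ _))// mulrC ler_norm.
- exact: (integrableRZ _ iu).
Qed.

Lemma integrable_dominated_Rintegral :
  m1.-integrable setT (EFin \o (fun x => \int[m2]_y F (x, y))).
Proof.
have := integrable_fubini_F integrable_dominated_prod.
apply: eq_integrable => // x _; rewrite /fubini_F/= /Rintegral fineK//.
exact: integrable_fin_num (integrable_dominated_pair1 x).
Qed.

Lemma dominated_Fubini :
  \int[m1]_x (\int[m2]_y F (x, y)) = \int[m2]_y (\int[m1]_x F (x, y)).
Proof.
transitivity (fine (\int[m1]_x \int[m2]_y (F (x, y))%:E)).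
  congr fine; apply: eq_integral => x _; rewrite /Rintegral fineK//.
  exact: integrable_fin_num (integrable_dominated_pair1 x).
rewrite (Fubini integrable_dominated_prod).
congr fine; apply: eq_integral => y _; rewrite /Rintegral fineK//.
exact: integrable_fin_num (integrable_dominated_pair2 y).
Qed.

End dominated_fubini.

Section split_rV.
Context {R : realType} (n : nat).
Local Notation leb := (@lebesgue_measure R).

(** The form in which the induction on the dimension in [laplaceD_poissonD] uses
    Fubini. *)
Lemma Rintegral_split_rV (u : R -> R) (w : 'rV[R]_n -> R) :
  leb.-integrable setT (EFin \o u) ->
  (lebesgue_rV n).-integrable setT (EFin \o w) ->
  (lebesgue_rV n.+1).-integrable setT
    (EFin \o (fun v => u (rV_uncons v).1 * w (rV_uncons v).2)) /\
  \int[lebesgue_rV n.+1]_v (u (rV_uncons v).1 * w (rV_uncons v).2) =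
  \int[leb]_x u x * \int[lebesgue_rV n]_v w v.
Proof.
move=> iu iw.
have mu' : measurable_fun setT u by apply/measurable_EFinP; exact: measurable_int iu.
have mw' : measurable_fun setT w by apply/measurable_EFinP; exact: measurable_int iw.
pose F (p : measurableTypeR R * 'rV[R]_n) : R := u p.1 * w p.2.
have mF : measurable_fun setT F.
  apply: measurable_funM.
    exact: (measurableT_comp mu' measurable_fst).
  exact: (measurableT_comp mw' measurable_snd).
have iu' : leb.-integrable setT (EFin \o (fun x => `|u x|)).
  exact: (integrable_abse iu).
have iw' : (lebesgue_rV n).-integrable setT (EFin \o (fun x => `|w x|)).
  exact: (integrable_abse iw).
have Fuw x y : `|F (x, y)| <= `|u x| * `|w y| by rewrite normrM.
have iF := integrable_dominated_prod mF iu' iw' Fuw.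
pose G v := u (@rV_uncons R n v).1 * w (rV_uncons v).2.
have mG : measurable_fun setT (EFin \o G).
  apply/measurable_EFinP/(measurableT_comp mF).
  exact: measurable_rV_uncons.
have mc : measurable_fun [set: measurableTypeR R * 'rV[R]_n] (@rV_cons R n).
  exact: measurable_rV_cons.
have EG : (EFin \o G) \o @rV_cons R n = EFin \o F.
  by apply/funext => p /=; rewrite /G rV_consK.
have iG : (leb \x lebesgue_rV n)%E.-integrable
    (@rV_cons R n @^-1` setT) ((EFin \o G) \o @rV_cons R n).
  by rewrite preimage_setT EG.
split; first exact: (integrable_pushforward mc mG iG).
have E1 : (\int[lebesgue_rV n.+1]_v (G v)%:E =
    \int[leb \x lebesgue_rV n]_p (F p)%:E)%E.
  apply: etrans (integral_pushforward mc mG iG measurableT) _.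
  by rewrite EG preimage_setT.
rewrite /Rintegral E1 -(integral12_prod_meas1 iF) -/(Rintegral _ _ _).
transitivity (\int[leb]_x (u x * \int[lebesgue_rV n]_v w v)).
  congr fine; apply: eq_integral => x _.
  rewrite /fubini_F /= -RintegralZl// /Rintegral fineK//.
  exact: integrable_fin_num (integrable_dominated_pair1 mF iw' Fuw x).
by rewrite RintegralZr.
Qed.

End split_rV.

(** * The Laplace and Poisson kernels on the line *)

Section poisson_kernel.
Context {R : realType}.
Local Notation leb := (@lebesgue_measure R).
Implicit Types c x s : R.

(** The nonnegative 1 + cos replaces cos so that the fundamental theorem of
    calculus on a half-line applies before integrability is known. *)
Lemma is_derive_expR_cos_primitive c x s : 0 < c ->
  is_derive s 1 (fun s => expR (- c * s) *
      (x * (sin (x * s)) - c * cos (x * s)) / (c ^+ 2 + x ^+ 2)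
        - c^-1 * expR (- c * s))
    (expR (- c * s) * (1 + cos (x * s))).
Proof.
move=> c0.
have dl k : is_derive s 1 (fun s : R => k * s) k.
  by apply: (is_derive_eq (is_deriveZ k (is_derive_id s 1))); exact: mulr1.
have de := is_derive1_comp (is_derive_expR (- c * s)) (dl (- c)).
have ds := is_derive1_comp (is_derive_sin (x * s)) (dl x).
have dc := is_derive1_comp (is_derive_cos (x * s)) (dl x).
have dn := is_deriveM de (is_deriveB (is_deriveZ x ds) (is_deriveZ c dc)).
have := is_deriveB (is_deriveZ (c ^+ 2 + x ^+ 2)^-1 dn) (is_deriveZ c^-1 de).
move=> dF; have := is_derive_eq dF; move/(_ (expR (- c * s) * (1 + cos (x * s)))).
have -> : (fun s => expR (- c * s) *
      (x * (sin (x * s)) - c * cos (x * s)) / (c ^+ 2 + x ^+ 2)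
        - c^-1 * expR (- c * s)) = (c ^+ 2 + x ^+ 2)^-1 \*:
        ((expR \o *%R (- c)) * (x \*: (sin \o *%R x) - c \*: (cos \o *%R x))) -
        c^-1 \*: (expR \o *%R (- c)).
  apply/funext => z; by rewrite !fctE /GRing.scale/= [in LHS]mulrC.
apply.
rewrite /= !fctE/= /GRing.scale/=.
have c2 : c ^+ 2 + x ^+ 2 != 0 by rewrite gt_eqF// ltr_wpDr ?sqr_ge0// exprn_gt0.
by field; rewrite c2 gt_eqF.
Qed.

Lemma cvg_expR_mul_bounded c (u : R -> R) (M : R) : 0 < c ->
  (forall s, `|u s| <= M) -> expR (- c * s) * u s @[s --> +oo] --> 0.
Proof.
move=> c0 uM.
have E : expR (- c * s) @[s --> +oo] --> (0 : R).
  under eq_fun do rewrite mulNr.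
  apply: (@cvg_comp _ _ _ (fun s => c * s) (fun s => expR (- s))); last exact: cvgr_expR.
  by apply: gt0_cvgMry => //; exact: cvg_id.
apply: norm_cvg0; apply: (squeeze_cvgr (f := cst 0) (h := fun s => expR (- c * s) * M)).
- near=> s; rewrite normr_ge0/= normrM ger0_norm ?expR_ge0//.
  by rewrite ler_wpM2l ?expR_ge0.
- exact: cvg_cst.
- by rewrite -[X in _ --> X](mul0r M); apply: cvgMl.
Unshelve. all: by end_near. Qed.

Lemma integral_expR_cos_half c x : 0 < c ->
  (\int[leb]_(s in `[0%R, +oo[) (expR (- c * s) * (1 + cos (x * s)))%:E =
   (c^-1 + c / (c ^+ 2 + x ^+ 2))%:E)%E.
Proof.
move=> c0.
have c2 : c ^+ 2 + x ^+ 2 != 0 by rewrite gt_eqF// ltr_wpDr ?sqr_ge0// exprn_gt0.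
have dF s := is_derive_expR_cos_primitive x s c0.
set F := (fun s : R => _) in dF.
have cf : continuous (fun s => expR (- c * s) * (1 + cos (x * s))).
  move=> s; apply: cvgM.
    apply: continuous_comp; first exact: mulrl_continuous.
    exact: continuous_expR.
  apply: cvgD; first exact: cvg_cst.
  apply: continuous_comp; first exact: mulrl_continuous.
  exact: continuous_cos.
have cF : continuous F.
  by move=> s; apply/differentiable_continuous/derivable1_diffP; case: (dF s).
rewrite (@ge0_continuous_FTC2y _ _ F 0 0).
- rewrite /F !mulr0 expR0 sin0 cos0 -EFinB; congr EFin.
  by field; rewrite c2 gt_eqF.
- by move=> s _; rewrite mulr_ge0 ?expR_ge0// -lerBlDl sub0r cos_geN1.
- exact: continuous_subspaceT.
- have h s : F s = expR (- c * s) * ((x * (sin (x * s)) - c * cos (x * s)) /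
      (c ^+ 2 + x ^+ 2) - c^-1).
    by rewrite /F; field; rewrite c2 gt_eqF.
  under eq_fun do rewrite h.
  apply: (@cvg_expR_mul_bounded _ _
    ((`|x| + c) / (c ^+ 2 + x ^+ 2) + c^-1)) => // s.
  have c2_gt0 : 0 < c ^+ 2 + x ^+ 2 by rewrite ltr_wpDr ?sqr_ge0// exprn_gt0.
  rewrite (le_trans (ler_normB _ _))// lerD//; last first.
    by rewrite gtr0_norm ?invr_gt0.
  rewrite normrM [`|_^-1|]gtr0_norm ?invr_gt0// ler_pM2r ?invr_gt0//.
  rewrite (le_trans (ler_normB _ _))// !normrM (gtr0_norm c0).
  rewrite lerD// ler_piMr// ?(ltW c0)// ler_norml.
  + by rewrite sin_geN1 sin_le1.
  + by rewrite cos_geN1 cos_le1.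
- by move=> s _; case: (dF s).
- exact/cvg_at_right_filter/cF.
- by move=> s _; rewrite derive1E; case: (dF s).
Qed.

Lemma continuous_expR_abs c : continuous (fun s : R => expR (- c * `|s|)).
Proof.
move=> s; apply: (@continuous_comp _ _ _ (fun s : R => `|s|) (fun r => expR (- c * r))).
  exact: norm_continuous.
apply: continuous_comp; first exact: mulrl_continuous.
exact: continuous_expR.
Qed.

Lemma continuous_cos_mul x : continuous (fun s : R => cos (x * s)).
Proof.
move=> s; apply: continuous_comp; first exact: mulrl_continuous.
exact: continuous_cos.
Qed.

Lemma continuous_sin_mul x : continuous (fun s : R => sin (x * s)).
Proof.
move=> s; apply: continuous_comp; first exact: mulrl_continuous.
exact: continuous_sin.
Qed.

Lemma measurable_expR_abs c : measurable_fun setT (fun s : R => expR (- c * `|s|)).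
Proof. by apply: continuous_measurable_fun; exact: continuous_expR_abs. Qed.

Lemma measurable_cos_mul x : measurable_fun setT (fun s : R => cos (x * s)).
Proof. by apply: continuous_measurable_fun; exact: continuous_cos_mul. Qed.

Lemma measurable_sin_mul x : measurable_fun setT (fun s : R => sin (x * s)).
Proof. by apply: continuous_measurable_fun; exact: continuous_sin_mul. Qed.

Lemma integral_expR_abs_cos c x : 0 < c ->
  (\int[leb]_s (expR (- c * `|s|) * (1 + cos (x * s)))%:E =
   (2 * (c^-1 + c / (c ^+ 2 + x ^+ 2)))%:E)%E.
Proof.
move=> c0; rewrite ge0_symfun_integralT.
- rewrite EFinM -integral_expR_cos_half// -set_itvcy; congr (_ * _)%E.
  apply: eq_integral => s; rewrite inE/= in_itv/= andbT => s0.
  by rewrite ger0_norm.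
- by move=> s; rewrite mulr_ge0 ?expR_ge0// -lerBlDl sub0r cos_geN1.
- move=> s; apply: cvgM; first exact: continuous_expR_abs.
  by apply: cvgD; [exact: cvg_cst|exact: continuous_cos_mul].
- by move=> s /=; rewrite normrN mulrN cosN.
Qed.

Lemma integrable_expR_abs c : 0 < c ->
  leb.-integrable setT (EFin \o (fun s => expR (- c * `|s|))).
Proof.
move=> c0; apply/integrableP; split.
  by apply/measurable_EFinP; exact: measurable_expR_abs.
apply: (@le_lt_trans _ _ (\int[leb]_s (expR (- c * `|s|) * (1 + cos (0 * s)))%:E)%E).
  apply: ge0_le_integral => //=.
  - apply/measurable_EFinP/measurableT_comp => //.
    exact: measurable_expR_abs.
  - apply/measurable_EFinP/measurable_funM.
      exact: measurable_expR_abs.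
    apply: measurable_funD => //.
    exact: measurable_cos_mul.
  - move=> s _; rewrite lee_fin ger0_norm ?expR_ge0// mul0r cos0.
    by rewrite ler_peMr ?expR_ge0// lerDl.
by rewrite integral_expR_abs_cos// ltry.
Qed.

Lemma integrable_expR_abs_bounded c (u : R -> R) : 0 < c ->
  measurable_fun setT u -> (forall s, `|u s| <= 1) ->
  leb.-integrable setT (EFin \o (fun s => expR (- c * `|s|) * u s)).
Proof.
move=> c0 mu u1; apply: (le_integrableR _ _ (integrable_expR_abs c0)).
  apply: measurable_funM => //.
  exact: measurable_expR_abs.
by move=> s; rewrite normrM (ger0_norm (expR_ge0 _)) ler_piMr ?expR_ge0.
Qed.

Lemma integrable_expR_abs_cos c x : 0 < c ->
  leb.-integrable setT (EFin \o (fun s => expR (- c * `|s|) * cos (x * s))).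
Proof.
move=> c0; apply: integrable_expR_abs_bounded => //.
  exact: measurable_cos_mul.
by move=> s; rewrite ler_norml cos_geN1 cos_le1.
Qed.

Lemma integrable_expR_abs_sin c x : 0 < c ->
  leb.-integrable setT (EFin \o (fun s => expR (- c * `|s|) * sin (x * s))).
Proof.
move=> c0; apply: integrable_expR_abs_bounded => //.
  exact: measurable_sin_mul.
by move=> s; rewrite ler_norml sin_geN1 sin_le1.
Qed.

Lemma Rintegral_expR_abs c : 0 < c ->
  \int[leb]_s expR (- c * `|s|) = 2 / c.
Proof.
move=> c0; have := integral_expR_abs_cos 0 c0.
under eq_integral.
  move=> s _.
  rewrite mul0r cos0 mulrC EFinM.
  over.
rewrite integralZl//; last exact: integrable_expR_abs.
rewrite -EFin_Rintegral; last exact: integrable_expR_abs.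
rewrite -EFinM => /(congr1 fine) /=.
rewrite expr0n addr0 => h; apply: (@mulfI _ 2) => //.
by rewrite -[LHS]/((1 + 1) * _) h; field; rewrite gt_eqF.
Qed.

Lemma Rintegral_expR_abs_cos c x : 0 < c ->
  \int[leb]_s (expR (- c * `|s|) * cos (x * s)) = 2 * c / (c ^+ 2 + x ^+ 2).
Proof.
move=> c0.
have E : \int[leb]_s (expR (- c * `|s|) * (1 + cos (x * s))) =
    2 * (c^-1 + c / (c ^+ 2 + x ^+ 2)) by rewrite /Rintegral integral_expR_abs_cos.
have : \int[leb]_s (expR (- c * `|s|) * (1 + cos (x * s))) =
    \int[leb]_s (expR (- c * `|s|) + expR (- c * `|s|) * cos (x * s)).
  by apply: eq_Rintegral => s _; rewrite mulrDr mulr1.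
rewrite RintegralD//; [|exact: integrable_expR_abs|exact: integrable_expR_abs_cos].
rewrite E Rintegral_expR_abs// => h.
by apply: (@addrI _ (2 / c)); apply: (etrans (esym h)); rewrite mulrDr mulrA.
Qed.

Lemma integral_reflect (f : R -> \bar R) : measurable_fun setT f ->
  (forall x, 0 <= f x)%E -> (\int[leb]_x f (- x)%R = \int[leb]_x f x)%E.
Proof.
move=> mf f0.
pose opp := (fun x : measurableTypeR R => - x : measurableTypeR R)%R.
have mopp : measurable_fun setT opp by exact: oppr_measurable.
pose phi : {mfun (measurableTypeR R) >-> (measurableTypeR R)} :=
  HB.pack opp (isMeasurableFun.Build _ _ _ _ opp mopp).
have E A : measurable A -> leb A = pushforward leb phi A.
  move: A; apply: lebesgue_measure_unique => X [[x y] /= _ <-].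
  rewrite /pushforward.
  rewrite (_ : _ @^-1` _ = [set` `[- y, - x[%R]); last first.
    by apply/seteqP; split => z /=; rewrite !in_itv/= /opp ltrNr lerNl andbC.
  rewrite !lebesgue_measure_itv/= !lte_fin ltrN2.
  by case: ifP => _ //; rewrite -!EFinB; congr EFin; rewrite opprK addrC.
rewrite [RHS](eq_measure_integral (pushforward leb phi)); last first.
  by move=> A mA _; exact: E.
by rewrite ge0_integral_pushforward.
Qed.

Lemma Rintegral_expR_abs_sin c x : 0 < c ->
  \int[leb]_s (expR (- c * `|s|) * sin (x * s)) = 0.
Proof.
move=> c0.
(* The reflection s -> -s is applied to the nonnegative 1 + sin. *)
pose f s := expR (- c * `|s|) * (1 + sin (x * s)).
have mf : measurable_fun setT (EFin \o f).
  apply/measurable_EFinP/measurable_funM.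
    exact: measurable_expR_abs.
  apply: measurable_funD => //.
  exact: measurable_sin_mul.
have f0 s : (0 <= (EFin \o f) s)%E.
  by rewrite lee_fin mulr_ge0 ?expR_ge0// -lerBlDl sub0r sin_geN1.
have := integral_reflect mf f0.
move=> /(congr1 fine).
rewrite -/(Rintegral leb setT (f \o -%R)) -/(Rintegral leb setT f).
have -> : Rintegral leb setT f = \int[leb]_s (expR (- c * `|s|) +
    expR (- c * `|s|) * sin (x * s)).
  by apply: eq_Rintegral => s _; rewrite /f mulrDr mulr1.
have -> : Rintegral leb setT (f \o -%R) = \int[leb]_s (expR (- c * `|s|) -
    expR (- c * `|s|) * sin (x * s)).
  by apply: eq_Rintegral => s _; rewrite /f/= normrN mulrN sinN mulrDr mulr1 mulrN.
rewrite RintegralB//; [|exact: integrable_expR_abs|exact: integrable_expR_abs_sin].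
rewrite RintegralD//; [|exact: integrable_expR_abs|exact: integrable_expR_abs_sin].
by move/addrI/eqP; rewrite -subr_eq0 -opprD oppr_eq0 -mulr2n mulrn_eq0/= => /eqP.
Qed.

Definition laplace (e s : R) : R := expR (- (2 * pi * e) * `|s|).

Definition poisson (e x : R) : R := e / (pi * (e ^+ 2 + x ^+ 2)).

Lemma laplace_poisson e x : 0 < e ->
  \int[leb]_s (laplace e s * cos (2 * pi * x * s)) = poisson e x.
Proof.
move=> e0; have pi0 : 0 < pi :> R := pi_gt0 R.
rewrite /laplace Rintegral_expR_abs_cos; last by rewrite !mulr_gt0.
rewrite /poisson; move: (@pi R) pi0 => p p0.
have : 0 < e ^+ 2 + x ^+ 2 by rewrite ltr_wpDr ?sqr_ge0// exprn_gt0.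
rewrite (_ : (2 * p * e) ^+ 2 + _ = 4 * p ^+ 2 * (e ^+ 2 + x ^+ 2)); last by ring.
move: (e ^+ 2 + x ^+ 2) => D D0.
by field; rewrite !gt_eqF.
Qed.

Lemma poisson_ge0 e x : 0 < e -> 0 <= poisson e x.
Proof.
move=> e0; rewrite /poisson divr_ge0// ?(ltW e0)// mulr_ge0 ?pi_ge0//.
by rewrite addr_ge0 ?sqr_ge0.
Qed.

Lemma continuous_poisson e : 0 < e -> continuous (poisson e).
Proof.
move=> e0 x; apply: cvgM; first exact: cvg_cst.
apply: cvgV.
  by rewrite mulf_neq0 ?gt_eqF ?pi_gt0// ltr_wpDr ?sqr_ge0// exprn_gt0.
apply: cvgM; first exact: cvg_cst.
by apply: cvgD; [exact: cvg_cst|exact: exprn_continuous].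
Qed.

Lemma integral_oneDsqrV :
  (\int[leb]_x ((oneDsqr x)^-1)%:E = pi%:E)%E.
Proof.
rewrite ge0_symfun_integralT.
- rewrite -set_itvcy integral0y_oneDsqr -EFinM; congr EFin.
  by rewrite mulrC divfK.
- by move=> x; rewrite invr_ge0 (le_trans ler01 (oneDsqr_ge1 x)).
- exact: continuous_oneDsqrV.
- by move=> x /=; rewrite /oneDsqr sqrrN.
Qed.

Lemma integral_poisson e y : 0 < e ->
  (\int[leb]_x (poisson e (x - y))%:E = 1)%E.
Proof.
move=> e0; have pi0 : 0 < pi :> R := pi_gt0 R.
have moV : measurable_fun setT (fun x : R => ((oneDsqr x)^-1)%:E).
  by apply/measurable_EFinP; exact: (continuous_measurable_fun (@continuous_oneDsqrV R)).
have oV0 (x : R) : (0 <= ((oneDsqr x)^-1)%:E)%E.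
  by rewrite lee_fin invr_ge0 (le_trans ler01 (oneDsqr_ge1 x)).
have ei0 : 0 < e^-1 by rewrite invr_gt0.
have := ge0_integral_affine1 (- (y / e)) ei0 moV oV0.
rewrite integral_oneDsqrV invrK => h.
transitivity (\int[leb]_x ((pi * e)^-1%:E * ((oneDsqr (e^-1 * x - y / e))^-1)%:E))%E.
  apply: eq_integral => x _; rewrite -EFinM; congr EFin.
  rewrite /poisson /oneDsqr.
  have ex : e ^+ 2 + (x - y) ^+ 2 != 0 by rewrite gt_eqF// ltr_wpDr ?sqr_ge0// exprn_gt0.
  have -> : 1 + (e^-1 * x - y / e) ^+ 2 = (e ^+ 2 + (x - y) ^+ 2) / e ^+ 2.
    by field; rewrite gt_eqF.
  move: (@pi R) pi0 => p p0; by field; rewrite ex !gt_eqF.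
rewrite ge0_integralZl//; last 2 first.
  apply: (measurableT_comp (f := fun x => ((oneDsqr x)^-1)%:E)) => //.
  by apply: measurable_funD => //; exact: mulrl_measurable.
  by rewrite lee_fin invr_ge0 mulr_ge0 ?ltW.
rewrite h -!EFinM; congr EFin; move: (@pi R) pi0 => p p0.
by field; rewrite !gt_eqF.
Qed.

End poisson_kernel.

(** * Product kernels on R^d *)

Section fourier_kernel.
Context {R : realType}.
Local Notation leb := (@lebesgue_measure R).

Definition theta d (x xi : 'rV[R]_d) : R := 2 * pi * dotp x xi.

Lemma dotp_rVS n (x y : 'rV[R]_n.+1) :
  dotp x y = (rV_uncons x).1 * (rV_uncons y).1 +
             dotp (rV_uncons x).2 (rV_uncons y).2.
Proof.
rewrite /dotp big_ord_recl; congr (_ + _).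
by apply: eq_bigr => j _; rewrite !mxE.
Qed.

Lemma dotpC d (x y : 'rV[R]_d) : dotp x y = dotp y x.
Proof. by apply: eq_bigr => j _; rewrite mulrC. Qed.

Lemma dotpBl d (x y z : 'rV[R]_d) : dotp (x - y) z = dotp x z - dotp y z.
Proof.
rewrite /dotp -sumrB; apply: eq_bigr => j _.
by rewrite !mxE mulrBl.
Qed.

Lemma measurable_dotp d : measurable_fun setT
  (fun p : 'rV[R]_d * 'rV[R]_d => dotp p.1 p.2).
Proof.
apply: measurable_sum => j; apply: measurable_funM.
  exact: (measurableT_comp (measurable_rV_coord j) measurable_fst).
exact: (measurableT_comp (measurable_rV_coord j) measurable_snd).
Qed.

Lemma measurable_cos : measurable_fun setT (@cos R).
Proof. by apply: continuous_measurable_fun; exact: continuous_cos. Qed.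

Lemma measurable_sin : measurable_fun setT (@sin R).
Proof. by apply: continuous_measurable_fun; exact: continuous_sin. Qed.

Lemma measurable_theta d : measurable_fun setT
  (fun p : 'rV[R]_d * 'rV[R]_d => theta p.1 p.2).
Proof.
by apply: measurable_funM; [exact: measurable_cst|exact: measurable_dotp].
Qed.

(** Computes the total masses of [poissonD] and of [decay_weight]. *)
Lemma ge0_integral_prod_rV d (phi : 'I_d -> R -> R) (c : 'I_d -> R) :
  (forall j, measurable_fun setT (phi j)) -> (forall j x, 0 <= phi j x) ->
  (forall j, (\int[leb]_x (phi j x)%:E = (c j)%:E)%E) ->
  (\int[lebesgue_rV d]_x (\prod_(j < d) phi j (x ord0 j))%:E =
   (\prod_(j < d) c j)%:E)%E.
Proof.
elim: d phi c => [|d IH] phi c mphi phi0 phic.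
  rewrite big_ord0 /= integral_dirac//=; last first.
    by under eq_fun do rewrite big_ord0; exact: measurable_cst.
  by rewrite diracT mul1e big_ord0.
have mprod k (psi : 'I_k -> R -> R) : (forall j, measurable_fun setT (psi j)) ->
    measurable_fun setT (fun x : 'rV[R]_k => \prod_(j < k) psi j (x ord0 j)).
  move=> mpsi; apply: measurable_prod => j _.
  exact: (measurableT_comp (mpsi j) (measurable_rV_coord j)).
have prod0 k (psi : 'I_k -> R -> R) (x : 'rV[R]_k) : (forall j s, 0 <= psi j s) ->
    0 <= \prod_(j < k) psi j (x ord0 j) by move=> psi0; exact: prodr_ge0.
rewrite ge0_integral_rVS; last 2 first.
- by apply/measurable_EFinP; exact: mprod.
- by move=> v; rewrite lee_fin; exact: prod0.
pose psi j := phi (lift ord0 j).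
have IHpsi := IH psi (fun j => c (lift ord0 j)) (fun j => mphi _)
  (fun j => phi0 _) (fun j => phic _).
have mpsi : measurable_fun setT
    (fun x : 'rV[R]_d => \prod_(j < d) psi j (x ord0 j)).
  by apply: mprod => j; exact: mphi.
have psi0 (x : 'rV[R]_d) : 0 <= \prod_(j < d) psi j (x ord0 j).
  by apply: prod0 => j s; exact: phi0.
rewrite big_ord_recl EFinM -phic -ge0_integralZr//; last 3 first.
- by apply/measurable_EFinP; exact: mphi.
- by move=> x _; rewrite lee_fin.
- rewrite -IHpsi.
  by apply: integral_ge0 => v _; rewrite lee_fin; exact: psi0.
apply: eq_integral => x _.
rewrite -IHpsi -ge0_integralZl//.
- apply: eq_integral => v _; rewrite big_ord_recl rV_cons0 -EFinM.
  by congr (_ * _)%:E; apply: eq_bigr => j _; rewrite rV_consS.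
- by apply/measurable_EFinP; exact: mpsi.
- by move=> v _; rewrite lee_fin; exact: psi0.
- by rewrite lee_fin.
Qed.

Definition laplaceD d (e : R) (xi : 'rV[R]_d) : R :=
  \prod_(j < d) laplace e (xi ord0 j).

Definition poissonD d (e : R) (x : 'rV[R]_d) : R :=
  \prod_(j < d) poisson e (x ord0 j).

Lemma laplaceD_gt0 d (e : R) (xi : 'rV[R]_d) : 0 < laplaceD e xi.
Proof. by apply: prodr_gt0 => j _; exact: expR_gt0. Qed.

Lemma laplaceDS n e (v : 'rV[R]_n.+1) :
  laplaceD e v = laplace e (rV_uncons v).1 * laplaceD e (rV_uncons v).2.
Proof.
rewrite /laplaceD big_ord_recl; congr (_ * _).
by apply: eq_bigr => j _; rewrite mxE.
Qed.

Lemma poissonDS n e (v : 'rV[R]_n.+1) :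
  poissonD e v = poisson e (rV_uncons v).1 * poissonD e (rV_uncons v).2.
Proof.
rewrite /poissonD big_ord_recl; congr (_ * _).
by apply: eq_bigr => j _; rewrite mxE.
Qed.

Lemma integrable_laplaceD_trig d e (u : R -> R) (x : 'rV[R]_d) :
  (lebesgue_rV d).-integrable setT (EFin \o laplaceD e) ->
  measurable_fun setT u -> (forall t, `|u t| <= 1) ->
  (lebesgue_rV d).-integrable setT
    (EFin \o (fun xi => laplaceD e xi * u (theta x xi))).
Proof.
move=> iL mu u1; apply: (le_integrableR _ _ iL).
  apply: measurable_funM; first exact: (integrableR_measurable iL).
  apply: measurableT_comp => //.
  exact: (measurableT_comp (@measurable_theta d) (measurable_pair1 x)).
by move=> xi; rewrite normrM (gtr0_norm (laplaceD_gt0 _ _))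
  ler_piMr// ltW// laplaceD_gt0.
Qed.

(** Induction on the dimension: the addition formulas split the cosine and the sine
    of [theta] into products, and the odd integrals vanish. *)
Lemma laplaceD_poissonD d (e : R) (x : 'rV[R]_d) : 0 < e ->
  [/\ (lebesgue_rV d).-integrable setT (EFin \o laplaceD e),
      \int[lebesgue_rV d]_xi (laplaceD e xi * cos (theta x xi)) = poissonD e x &
      \int[lebesgue_rV d]_xi (laplaceD e xi * sin (theta x xi)) = 0].
Proof.
move=> e0; have c0 : 0 < 2 * pi * e by rewrite !mulr_gt0// pi_gt0.
elim: d x => [|d IH] x.
  have L1 (xi : 'rV[R]_0) : laplaceD e xi = 1 by rewrite /laplaceD big_ord0.
  have th0 (xi : 'rV[R]_0) : theta x xi = 0 by rewrite /theta /dotp big_ord0 mulr0.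
  split.
  - apply: (@eq_integrable _ _ _ _ _ measurableT (cst 1%E)) => //.
      by move=> xi _ /=; rewrite L1.
    apply/integrableP; split=> //.
    by rewrite /= integral_dirac//= diracT mul1e normr1 ltry.
  - under eq_Rintegral do rewrite L1 th0 cos0 mulr1.
    by rewrite Rintegral_cst// mul1r /= indicT /poissonD big_ord0.
  - under eq_Rintegral do rewrite th0 sin0 mulr0.
    by rewrite /Rintegral integral0.
have [iL Ic Is] := IH (rV_uncons x).2.
have x0E : forall s, (2 * pi * (rV_uncons x).1) * s = 2 * pi * ((rV_uncons x).1 * s).
  by move=> s; rewrite mulrA.
have thE v : theta x v = 2 * pi * (rV_uncons x).1 * (rV_uncons v).1 +
    theta (rV_uncons x).2 (rV_uncons v).2.
  by rewrite /theta dotp_rVS mulrDr mulrA.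
have bc t : `|cos t| <= 1 :> R by rewrite ler_norml cos_geN1 cos_le1.
have bs t : `|sin t| <= 1 :> R by rewrite ler_norml sin_geN1 sin_le1.
have ic := integrable_laplaceD_trig (rV_uncons x).2 iL measurable_cos bc.
have isn := integrable_laplaceD_trig (rV_uncons x).2 iL measurable_sin bs.
have jc := integrable_expR_abs_cos (2 * pi * (rV_uncons x).1) c0.
have js := integrable_expR_abs_sin (2 * pi * (rV_uncons x).1) c0.
have [icc Icc] := Rintegral_split_rV jc ic.
have [iss Iss] := Rintegral_split_rV js isn.
have [isc Isc] := Rintegral_split_rV js ic.
have [ics Ics] := Rintegral_split_rV jc isn.
split.
- apply: eq_integrable (Rintegral_split_rV (integrable_expR_abs c0) iL).1 => //.
  by move=> v _ /=; rewrite laplaceDS.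
- under eq_Rintegral do rewrite laplaceDS thE cosD /laplace mulrBr mulrACA
    [X in _ - X]mulrACA.
  rewrite RintegralB// Icc Iss Is Ic mulr0 subr0 poissonDS.
  by rewrite -laplace_poisson.
- under eq_Rintegral do rewrite laplaceDS thE sinD /laplace mulrDr mulrACA
    [X in _ + X]mulrACA.
  by rewrite RintegralD// Isc Ics Is mulr0 addr0 Rintegral_expR_abs_sin// mul0r.
Qed.

End fourier_kernel.

(** * Cosine and sine transforms *)

Section bessel.
Context {R : realType} (d : nat).
Local Notation mu := (@lebesgue_rV R d).
Implicit Types (g : 'rV[R]_d -> R) (x y xi : 'rV[R]_d).

Definition cosT g xi : R := \int[mu]_x (g x * cos (theta x xi)).

Definition sinT g xi : R := \int[mu]_x (g x * sin (theta x xi)).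

Lemma thetaC x y : theta x y = theta y x.
Proof. by rewrite /theta dotpC. Qed.

Lemma measurable_cos_theta :
  measurable_fun setT (fun p : 'rV[R]_d * 'rV[R]_d => cos (theta p.1 p.2)).
Proof. by apply: measurableT_comp; [exact: measurable_cos|exact: measurable_theta]. Qed.

Lemma measurable_sin_theta :
  measurable_fun setT (fun p : 'rV[R]_d * 'rV[R]_d => sin (theta p.1 p.2)).
Proof. by apply: measurableT_comp; [exact: measurable_sin|exact: measurable_theta]. Qed.

Lemma integrable_mul_bounded g (u : 'rV[R]_d -> R) (M : R) :
  mu.-integrable setT (EFin \o g) -> measurable_fun setT u ->
  (forall x, `|u x| <= M) ->
  mu.-integrable setT (EFin \o (fun x => g x * u x)).
Proof.
move=> ig mu' uM.
apply: (le_integrableR _ _ (integrableRZ M (integrable_norm ig))).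
  by apply: measurable_funM => //; exact: integrableR_measurable ig.
by move=> x; rewrite normrM mulrC ler_wpM2r//= uM.
Qed.

Lemma normr_cos_le1 (t : R) : `|cos t| <= 1.
Proof. by rewrite ler_norml cos_geN1 cos_le1. Qed.

Lemma normr_sin_le1 (t : R) : `|sin t| <= 1.
Proof. by rewrite ler_norml sin_geN1 sin_le1. Qed.

Lemma integrable_mul_cos g xi : mu.-integrable setT (EFin \o g) ->
  mu.-integrable setT (EFin \o (fun x => g x * cos (theta x xi))).
Proof.
move=> ig; apply: (integrable_mul_bounded (M := 1)) => //.
  exact: (measurableT_comp measurable_cos_theta (measurable_pair2 xi)).
by move=> x; exact: normr_cos_le1.
Qed.

Lemma integrable_mul_sin g xi : mu.-integrable setT (EFin \o g) ->
  mu.-integrable setT (EFin \o (fun x => g x * sin (theta x xi))).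
Proof.
move=> ig; apply: (integrable_mul_bounded (M := 1)) => //.
  exact: (measurableT_comp measurable_sin_theta (measurable_pair2 xi)).
by move=> x; exact: normr_sin_le1.
Qed.

Lemma normr_cosT g xi : mu.-integrable setT (EFin \o g) ->
  `|cosT g xi| <= \int[mu]_x `|g x|.
Proof.
move=> ig; have igc := integrable_mul_cos xi ig.
rewrite /cosT (le_trans (le_normr_Rintegral measurableT igc))//.
apply: le_Rintegral => //; [exact: integrable_norm|exact: integrable_norm|].
by move=> x _; rewrite normrM ler_piMr// normr_cos_le1.
Qed.

Lemma normr_sinT g xi : mu.-integrable setT (EFin \o g) ->
  `|sinT g xi| <= \int[mu]_x `|g x|.
Proof.
move=> ig; have igc := integrable_mul_sin xi ig.
rewrite /sinT (le_trans (le_normr_Rintegral measurableT igc))//.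
apply: le_Rintegral => //; [exact: integrable_norm|exact: integrable_norm|].
by move=> x _; rewrite normrM ler_piMr// normr_sin_le1.
Qed.

(** Integrating against the positive integrable weight [laplaceD 1] puts the
    transform within reach of Fubini's theorem, which gives measurability. *)
Lemma measurable_trigT g (u : R -> R) : mu.-integrable setT (EFin \o g) ->
  measurable_fun setT u -> (forall t, `|u t| <= 1) ->
  measurable_fun setT (fun xi => \int[mu]_x (g x * u (theta x xi))).
Proof.
move=> ig mu' u1; have [iL _ _] := laplaceD_poissonD (0 : 'rV[R]_d) (@ltr01 R).
have mut : measurable_fun setT (fun p : 'rV[R]_d * 'rV[R]_d => u (theta p.1 p.2)).
  exact: (measurableT_comp mu' (@measurable_theta R d)).
pose F (p : 'rV[R]_d * 'rV[R]_d) := laplaceD 1 p.1 * (g p.2 * u (theta p.1 p.2)).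
have mL := integrableR_measurable iL.
have mF : measurable_fun setT F.
  apply: measurable_funM; first exact: (measurableT_comp mL measurable_fst).
  apply: measurable_funM.
    exact: (measurableT_comp (integrableR_measurable ig) measurable_snd).
  exact: mut.
have Fd xi x : `|F (xi, x)| <= laplaceD 1 xi * `|g x|.
  rewrite /F/= normrM (gtr0_norm (laplaceD_gt0 _ _)) ler_wpM2l//.
    exact: ltW (laplaceD_gt0 _ _).
  by rewrite normrM ler_piMr.
have := integrableR_measurable (integrable_dominated_Rintegral mF iL (integrable_norm ig) Fd).
move=> h.
have -> : (fun xi => \int[mu]_x (g x * u (theta x xi))) =
    (fun xi => (\int[mu]_x F (xi, x)) * (laplaceD 1 xi)^-1).
  apply/funext => xi; rewrite /F /= RintegralZl//; last first.
    apply: (integrable_mul_bounded (M := 1)) => //.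
    exact: (measurableT_comp mut (measurable_pair1 xi)).
  under [in RHS]eq_Rintegral do rewrite thetaC.
  by rewrite mulrC mulKf// gt_eqF// laplaceD_gt0.
apply: measurable_funM => //.
rewrite (_ : (fun xi => _) =
    (fun xi => \prod_(j < d) expR (2 * pi * 1 * `|xi ord0 j|))); last first.
  apply/funext => xi; rewrite /laplaceD -prodfV; apply: eq_bigr => j _.
  by rewrite /laplace mulNr expRN invrK.
apply: measurable_prod => j _; apply: measurableT_comp => //.
apply: measurable_funM => //; apply: measurableT_comp => //.
exact: measurable_rV_coord.
Qed.

Lemma measurable_cosT g : mu.-integrable setT (EFin \o g) ->
  measurable_fun setT (cosT g).
Proof.
by move=> ig; apply: measurable_trigT => //; [exact: measurable_cos|exact: normr_cos_le1].
Qed.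

Lemma measurable_sinT g : mu.-integrable setT (EFin \o g) ->
  measurable_fun setT (sinT g).
Proof.
by move=> ig; apply: measurable_trigT => //; [exact: measurable_sin|exact: normr_sin_le1].
Qed.

End bessel.

(** * Bessel's inequality *)

Section bessel_inequality.
Context {R : realType} (d : nat).
Local Notation mu := (@lebesgue_rV R d).
Implicit Types (g : 'rV[R]_d -> R) (x y xi : 'rV[R]_d).

Lemma le_EFin_normr_Rintegral g : measurable_fun setT g ->
  (`|\int[mu]_x g x|%:E <= \int[mu]_x `|g x|%:E)%E.
Proof.
move=> mg; have mEg : measurable_fun setT (EFin \o g) by exact/measurable_EFinP.
apply: le_trans (le_abse_integral mu measurableT mEg).
rewrite -/(Rintegral mu setT g) /Rintegral.
by case: (\int[mu]_x (EFin \o g) x)%E => [r| |] //=; rewrite normr0 leey.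
Qed.

Lemma measurable_dotp_r x : measurable_fun setT (fun y => dotp x y).
Proof. exact: (measurableT_comp (@measurable_dotp R d) (measurable_pair1 x)). Qed.

Lemma measurable_dotp_swap :
  measurable_fun setT (fun p : 'rV[R]_d * 'rV[R]_d => dotp p.2 p.1).
Proof. by under eq_fun do rewrite dotpC; exact: measurable_dotp. Qed.

Lemma measurable_cos_theta_r z : measurable_fun setT (fun xi => cos (theta z xi)).
Proof.
apply: (measurableT_comp measurable_cos).
exact: (measurableT_comp (@measurable_theta R d) (measurable_pair1 z)).
Qed.

Lemma measurable_sin_theta_r z : measurable_fun setT (fun xi => sin (theta z xi)).
Proof.
apply: (measurableT_comp measurable_sin).
exact: (measurableT_comp (@measurable_theta R d) (measurable_pair1 z)).
Qed.

Lemma measurable_poissonD_sub (e : R) : 0 < e -> measurable_fun setT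
  (fun p : 'rV[R]_d * 'rV[R]_d => poissonD e (p.1 - p.2)).
Proof.
move=> e0; apply: measurable_prod => j _.
apply: (measurableT_comp (f := poisson e)).
  by apply: continuous_measurable_fun; exact: continuous_poisson.
under eq_fun do rewrite !mxE.
apply: measurable_funB.
  exact: (measurableT_comp (measurable_rV_coord j) measurable_fst).
exact: (measurableT_comp (measurable_rV_coord j) measurable_snd).
Qed.

Lemma integral_poissonD (e : R) y : 0 < e ->
  (\int[mu]_x (poissonD e (x - y))%:E = 1)%E.
Proof.
move=> e0.
have := @ge0_integral_prod_rV R d (fun j s => poisson e (s - y ord0 j)) (fun=> 1).
rewrite big1// => <-.
- apply: eq_integral => x _; congr EFin; apply: eq_bigr => j _.
  by rewrite !mxE.
- move=> j; apply: (measurableT_comp (f := poisson e)).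
    by apply: continuous_measurable_fun; exact: continuous_poisson.
  exact: measurable_funB.
- by move=> j s; exact: poisson_ge0.
- by move=> j; exact: integral_poisson.
Qed.

Lemma poissonDN (e : R) x : poissonD e (- x) = poissonD e x.
Proof. by apply: eq_bigr => j _; rewrite mxE /poisson sqrrN. Qed.

Lemma poissonD_ge0 (e : R) x : 0 < e -> 0 <= poissonD e x.
Proof. by move=> e0; apply: prodr_ge0 => j _; exact: poisson_ge0. Qed.

(** Schur's test: [2 * (`|g x| * `|g y|) <= g x ^+ 2 + g y ^+ 2], and the kernel
    has total mass 1 in each of its two variables. *)
Lemma schur_poissonD (e : R) g : 0 < e -> measurable_fun setT g ->
  (\int[mu]_x \int[mu]_y (`|g x| * `|g y| * poissonD e (x - y))%:E <=
   \int[mu]_x (g x ^+ 2)%:E)%E.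
Proof.
move=> e0 mg.
have P0 x := poissonD_ge0 x e0.
have mP := measurable_poissonD_sub e0.
have mP1 x : measurable_fun setT (fun y => poissonD e (x - y)).
  exact: (measurableT_comp mP (measurable_pair1 x)).
have mg2 : measurable_fun setT (fun x => (2^-1 * g x ^+ 2)%:E).
  by apply/measurable_EFinP/measurable_funM => //; exact: measurable_funX.
have g20 x : 0 <= 2^-1 * g x ^+ 2 by rewrite mulr_ge0 ?sqr_ge0// invr_ge0.
pose A (p : 'rV[R]_d * 'rV[R]_d) := (2^-1 * g p.1 ^+ 2 * poissonD e (p.1 - p.2))%:E.
pose B (p : 'rV[R]_d * 'rV[R]_d) := (2^-1 * g p.2 ^+ 2 * poissonD e (p.1 - p.2))%:E.
have A0 p : (0 <= A p)%E by rewrite lee_fin mulr_ge0.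
have B0 p : (0 <= B p)%E by rewrite lee_fin mulr_ge0.
have mA : measurable_fun setT A.
  apply/measurable_EFinP/measurable_funM => //.
  apply: measurable_funM => //; apply: measurable_funX.
  exact: (measurableT_comp mg measurable_fst).
have mB : measurable_fun setT B.
  apply/measurable_EFinP/measurable_funM => //.
  apply: measurable_funM => //; apply: measurable_funX.
  exact: (measurableT_comp mg measurable_snd).
have mA1 x : measurable_fun setT (fun y => A (x, y)).
  exact: (measurableT_comp mA (measurable_pair1 x)).
have mB1 x : measurable_fun setT (fun y => B (x, y)).
  exact: (measurableT_comp mB (measurable_pair1 x)).
have IA : (\int[mu]_x \int[mu]_y A (x, y) = \int[mu]_x (2^-1 * g x ^+ 2)%:E)%E.
  apply: eq_integral => x _; rewrite /A /=.
  under eq_integral do rewrite EFinM -opprB poissonDN.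
  rewrite ge0_integralZl//; last 3 first.
  - apply/measurable_EFinP.
    exact: (measurableT_comp mP (measurable_pair2 x)).
  - by move=> y _; rewrite lee_fin.
  - by rewrite lee_fin.
  by rewrite integral_poissonD// mule1.
have IB : (\int[mu]_x \int[mu]_y B (x, y) = \int[mu]_x (2^-1 * g x ^+ 2)%:E)%E.
  apply: (etrans (fubini_tonelli B mB B0)).
  apply: eq_integral => y _; rewrite /B /=.
  under eq_integral do rewrite EFinM.
  rewrite ge0_integralZl//; last 3 first.
  - apply/measurable_EFinP.
    exact: (measurableT_comp mP (measurable_pair2 y)).
  - by move=> x _; rewrite lee_fin.
  - by rewrite lee_fin.
  by rewrite integral_poissonD// mule1.
apply: (@le_trans _ _ (\int[mu]_x (\int[mu]_y A (x, y) + \int[mu]_y B (x, y)))%E).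
  have mF : measurable_fun setT (fun p : 'rV[R]_d * 'rV[R]_d =>
      (`|g p.1| * `|g p.2| * poissonD e (p.1 - p.2))%:E).
    apply/measurable_EFinP/measurable_funM => //.
    apply: measurable_funM; apply: measurableT_comp => //.
      exact: (measurableT_comp mg measurable_fst).
    exact: (measurableT_comp mg measurable_snd).
  apply: ge0_le_integral => //.
  - by move=> x _; apply: integral_ge0 => y _; rewrite lee_fin !mulr_ge0.
  - apply: (measurable_fun_fubini_tonelli_F _ mF) => p.
    by rewrite lee_fin !mulr_ge0.
  - apply: emeasurable_funD.
      exact: (measurable_fun_fubini_tonelli_F _ mA).
    exact: (measurable_fun_fubini_tonelli_F _ mB).
  - move=> x _; rewrite -ge0_integralD//.
    apply: ge0_le_integral => //.
    + by move=> y _; rewrite lee_fin !mulr_ge0.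
    + exact: (measurableT_comp mF (measurable_pair1 x)).
    + exact: emeasurable_funD.
    + move=> y _; rewrite /A /B /= -EFinD lee_fin -mulrDl ler_wpM2r//.
      rewrite -mulrDr -[g x ^+ 2]real_normK ?num_real// -[g y ^+ 2]real_normK ?num_real//.
      have := sqr_ge0 (`|g x| - `|g y|); lra.
rewrite ge0_integralD//; last 4 first.
- by move=> x _; apply: integral_ge0.
- exact: (measurable_fun_fubini_tonelli_F _ mA).
- by move=> x _; apply: integral_ge0.
- exact: (measurable_fun_fubini_tonelli_F _ mB).
rewrite IA IB -ge0_integralD//; last 2 first.
- by move=> x _; rewrite lee_fin.
- by move=> x _; rewrite lee_fin.
rewrite le_eqVlt; apply/orP; left; apply/eqP; apply: eq_integral => x _.
by rewrite -EFinD; congr EFin; move: (g x) => a; field.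
Qed.

(** The damped form of the inequality: the left-hand side is the integral of
    [g x * g y] against the Poisson kernel at [x - y]. *)
Lemma damped_bessel (e : R) g : 0 < e -> mu.-integrable setT (EFin \o g) ->
  (\int[mu]_xi (laplaceD e xi * (cosT g xi ^+ 2 + sinT g xi ^+ 2))%:E <=
   \int[mu]_x (g x ^+ 2)%:E)%E.
Proof.
move=> e0 ig; have [iL _ _] := laplaceD_poissonD (0 : 'rV[R]_d) e0.
have mL := integrableR_measurable iL; have mg := integrableR_measurable ig.
have inorm := integrable_norm ig.
have L0 xi := ltW (laplaceD_gt0 e xi).
set M := \int[mu]_x `|g x|.
have M0 : 0 <= M by exact: Rintegral_ge0.
have mC := measurable_cosT ig; have mS := measurable_sinT ig.
have mCf : measurable_fun setT (fun p : 'rV[R]_d * 'rV[R]_d => cosT g p.1).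
  exact: (measurableT_comp mC measurable_fst).
have mSf : measurable_fun setT (fun p : 'rV[R]_d * 'rV[R]_d => sinT g p.1).
  exact: (measurableT_comp mS measurable_fst).
have mLf : measurable_fun setT (fun p : 'rV[R]_d * 'rV[R]_d => laplaceD e p.1).
  exact: (measurableT_comp mL measurable_fst).
have mgs : measurable_fun setT (fun p : 'rV[R]_d * 'rV[R]_d => g p.2).
  exact: (measurableT_comp mg measurable_snd).
pose K x xi := cos (theta x xi) * cosT g xi + sin (theta x xi) * sinT g xi.
have KM x xi : `|K x xi| <= 2 * M.
  rewrite (le_trans (ler_normD _ _))// mulr2n mulrDl mul1r lerD// normrM.
    by apply: le_trans (normr_cosT xi ig); rewrite ler_piMl// normr_cos_le1.
  by apply: le_trans (normr_sinT xi ig); rewrite ler_piMl// normr_sin_le1.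
pose F1 (p : 'rV[R]_d * 'rV[R]_d) := laplaceD e p.1 * (g p.2 * K p.2 p.1).
have mF1 : measurable_fun setT F1.
  apply: measurable_funM => //; apply: measurable_funM => //.
  rewrite /K; under eq_fun do rewrite thetaC.
  apply: measurable_funD; apply: measurable_funM => //.
    exact: measurable_cos_theta.
  exact: measurable_sin_theta.
have iL2 := integrableRZ (2 * M) iL.
have dF1 xi x : `|F1 (xi, x)| <= 2 * M * laplaceD e xi * `|g x|.
  rewrite /F1/= normrM (gtr0_norm (laplaceD_gt0 _ _)) [2 * M * _]mulrC -mulrA.
  by rewrite ler_wpM2l// normrM mulrC ler_wpM2r.
pose F2 x (p : 'rV[R]_d * 'rV[R]_d) := laplaceD e p.1 * (g p.2 * cos (theta (x - p.2) p.1)).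
have mF2 x : measurable_fun setT (F2 x).
  apply: measurable_funM => //; apply: measurable_funM => //.
  apply: (measurableT_comp measurable_cos).
  rewrite /theta; under eq_fun do rewrite dotpBl.
  apply: measurable_funM => //; apply: measurable_funB.
    exact: (measurableT_comp (measurable_dotp_r x) measurable_fst).
  exact: measurable_dotp_swap.
have dF2 x xi y : `|F2 x (xi, y)| <= laplaceD e xi * `|g y|.
  rewrite /F2/= normrM (gtr0_norm (laplaceD_gt0 _ _)) ler_wpM2l//.
  by rewrite normrM ler_piMr// normr_cos_le1.
have E2 x xi : \int[mu]_y F2 x (xi, y) = laplaceD e xi * K x xi.
  rewrite /F2 /= /K.
  transitivity (\int[mu]_y (laplaceD e xi * (cos (theta x xi) * (g y * cos (theta y xi))
      + sin (theta x xi) * (g y * sin (theta y xi))))).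
    apply: eq_Rintegral => y _; congr (_ * _).
    rewrite /theta dotpBl mulrBr cosB; ring.
  have ic := integrable_mul_cos xi ig; have is_ := integrable_mul_sin xi ig.
  rewrite RintegralZl//; last first.
    by apply: integrableRD; exact: integrableRZ.
  rewrite RintegralD//; [|exact: integrableRZ|exact: integrableRZ].
  by rewrite !RintegralZl.
have E1 xi : \int[mu]_x F1 (xi, x) =
    laplaceD e xi * (cosT g xi ^+ 2 + sinT g xi ^+ 2).
  rewrite /F1 /= /K.
  transitivity (\int[mu]_x (laplaceD e xi * (cosT g xi * (g x * cos (theta x xi))
      + sinT g xi * (g x * sin (theta x xi))))).
    by apply: eq_Rintegral => x _; congr (_ * _); ring.
  have ic := integrable_mul_cos xi ig; have is_ := integrable_mul_sin xi ig.
  rewrite RintegralZl//; last first.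
    by apply: integrableRD; exact: integrableRZ.
  rewrite RintegralD//; [|exact: integrableRZ|exact: integrableRZ].
  by rewrite !RintegralZl// !expr2.
have EQ x : \int[mu]_xi (laplaceD e xi * K x xi) =
    \int[mu]_y (g y * poissonD e (x - y)).
  under eq_Rintegral do rewrite -E2.
  rewrite (dominated_Fubini (mF2 x) iL inorm (dF2 x)).
  apply: eq_Rintegral => y _; rewrite /F2 /=.
  have [_ <- _] := laplaceD_poissonD (x - y) e0.
  rewrite -RintegralZl//; last first.
    apply: integrable_mul_bounded iL _ _ => //.
      exact: measurable_cos_theta_r.
    by move=> xi; exact: normr_cos_le1.
  by apply: eq_Rintegral => xi _; rewrite mulrCA.
have iE := integrable_dominated_Rintegral mF1 iL2 inorm dF1.
have := EFin_Rintegral iE; rewrite (dominated_Fubini mF1 iL2 inorm dF1).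
under [X in _ = X]eq_integral do rewrite E1.
move=> <-.
have EQ1 x : \int[mu]_xi F1 (xi, x) = g x * \int[mu]_y (g y * poissonD e (x - y)).
  rewrite -EQ /F1 /= -RintegralZl//; last first.
    apply: integrable_mul_bounded iL _ (KM x) => //.
    rewrite /K; apply: measurable_funD; apply: measurable_funM => //.
      exact: measurable_cos_theta_r.
    exact: measurable_sin_theta_r.
  by apply: eq_Rintegral => xi _; rewrite mulrCA.
pose F1s (p : 'rV[R]_d * 'rV[R]_d) := F1 (p.2, p.1).
have mF1s : measurable_fun setT F1s.
  apply: (measurableT_comp mF1); apply: measurable_fun_pair.
    exact: measurable_snd.
  exact: measurable_fst.
have dF1s x xi : `|F1s (x, xi)| <= `|g x| * (2 * M * laplaceD e xi).
  by rewrite mulrC; exact: dF1.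
have mJ := integrableR_measurable (integrable_dominated_Rintegral mF1s inorm iL2 dF1s).
apply: le_trans (schur_poissonD e0 mg).
apply: le_trans (_ : _ <= `|\int[mu]_x (\int[mu]_xi F1 (xi, x))|%:E)%E _.
  by rewrite lee_fin ler_norm.
apply: le_trans (le_EFin_normr_Rintegral mJ) _.
have mP := measurable_poissonD_sub e0.
have mGP x : measurable_fun setT (fun y => g y * poissonD e (x - y)).
  apply: measurable_funM => //.
  exact: (measurableT_comp mP (measurable_pair1 x)).
have mF : measurable_fun setT (fun p : 'rV[R]_d * 'rV[R]_d =>
    (`|g p.1| * `|g p.2| * poissonD e (p.1 - p.2))%:E).
  apply/measurable_EFinP/measurable_funM => //.
  apply: measurable_funM; apply: measurableT_comp => //.
  exact: (measurableT_comp mg measurable_fst).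
apply: ge0_le_integral => //.
- by apply/measurable_EFinP; apply: measurableT_comp.
- apply: (measurable_fun_fubini_tonelli_F _ mF) => p.
  by rewrite lee_fin !mulr_ge0 ?poissonD_ge0.
- move=> x _; rewrite /= EQ1 normrM EFinM.
  apply: (@le_trans _ _ (`|g x|%:E * \int[mu]_y `|g y * poissonD e (x - y)|%:E)%E).
    by rewrite lee_wpmul2l ?lee_fin// le_EFin_normr_Rintegral.
  rewrite -ge0_integralZl//; last by apply/measurable_EFinP/measurableT_comp.
  rewrite le_eqVlt; apply/orP; left; apply/eqP; apply: eq_integral => y _.
  by rewrite -EFinM normrM mulrA (ger0_norm (poissonD_ge0 _ e0)).
Qed.

End bessel_inequality.

Section plancherel_bounds.
Context {R : realType} (d : nat).
Local Notation mu := (@lebesgue_rV R d).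
Implicit Types (g : 'rV[R]_d -> R) (f m : 'rV[R]_d -> R[i]) (x xi : 'rV[R]_d).

Lemma laplaceD_expR (e : R) xi :
  laplaceD e xi = expR (- (2 * pi * \sum_(j < d) `|xi ord0 j|) * e).
Proof.
rewrite (_ : _ * e = \sum_(j < d) (- (2 * pi * e) * `|xi ord0 j|)).
  by rewrite expR_sum.
by rewrite -mulr_sumr; ring.
Qed.

Lemma laplaceD_cvg1 xi : laplaceD (n.+1%:R^-1 : R) xi @[n --> \oo] --> (1 : R).
Proof.
under eq_fun do rewrite laplaceD_expR.
set A := - _.
suff : expR (A * n.+1%:R^-1) @[n --> \oo] --> expR (A * 0) by rewrite mulr0 expR0.
apply: (@cvg_comp _ _ _ _ expR); last exact: continuous_expR.
by apply: cvgMr; exact: cvg_harmonic.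
Qed.

(** Letting the damping parameter tend to 0 in [damped_bessel]. *)
Theorem bessel g : mu.-integrable setT (EFin \o g) ->
  (\int[mu]_xi (cosT g xi ^+ 2 + sinT g xi ^+ 2)%:E <=
   \int[mu]_x (g x ^+ 2)%:E)%E.
Proof.
move=> ig.
pose u n xi := (laplaceD (n.+1%:R^-1 : R) xi * (cosT g xi ^+ 2 + sinT g xi ^+ 2))%:E.
have e0 n : 0 < n.+1%:R^-1 :> R by rewrite invr_gt0.
have mT : measurable_fun setT (fun xi => cosT g xi ^+ 2 + sinT g xi ^+ 2).
  apply: measurable_funD; apply: measurable_funX.
    exact: measurable_cosT.
  exact: measurable_sinT.
have mu_ n : measurable_fun setT (u n).
  apply/measurable_EFinP/measurable_funM => //.
  by have [/integrableR_measurable] := laplaceD_poissonD (0 : 'rV[R]_d) (e0 n).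
have u0 n xi : (0 <= u n xi)%E.
  by rewrite lee_fin mulr_ge0 ?addr_ge0 ?sqr_ge0// ltW// laplaceD_gt0.
have ucvg xi : u n xi @[n --> \oo] --> (cosT g xi ^+ 2 + sinT g xi ^+ 2)%:E.
  apply: cvg_EFin; first exact: nearW.
  rewrite -[X in _ --> X]mul1r; apply: cvgMl; exact: laplaceD_cvg1.
under eq_integral do rewrite -(cvg_limn_einf_sup (ucvg _)).1.
apply: le_trans (fatou mu measurableT mu_ (fun n xi _ => u0 n xi)) _.
rewrite limn_einf_lim; apply: lime_le; first exact: is_cvg_einfs.
apply: nearW => n; apply: ereal_inf_le => /=.
exists (\int[mu]_xi u n xi)%E; first by exists n => /=.
exact: damped_bessel.
Qed.

Definition ifourier m x : R[i] :=
  cintegral (fun xi => m xi * cis (2 * pi * dotp x xi)).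

Lemma cmod_sqr (z : R[i]) : cmod z ^+ 2 = complex.Re z ^+ 2 + complex.Im z ^+ 2.
Proof. by case: z => a b; rewrite /cmod/= sqr_sqrtr// addr_ge0 ?sqr_ge0. Qed.

Lemma fourierE f xi :
  mu.-integrable setT (EFin \o (fun x => complex.Re (f x))) ->
  mu.-integrable setT (EFin \o (fun x => complex.Im (f x))) ->
  fourier f xi =
  Complex (cosT (fun x => complex.Re (f x)) xi + sinT (fun x => complex.Im (f x)) xi)
          (cosT (fun x => complex.Im (f x)) xi - sinT (fun x => complex.Re (f x)) xi).
Proof.
move=> i1 i2; rewrite /fourier /cintegral; congr Complex.
- rewrite -RintegralD//; [|exact: integrable_mul_cos|exact: integrable_mul_sin].
  apply: eq_Rintegral => x _; rewrite /cis cosN sinN -/(theta x xi).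
  by case: (f x) => a b /=; rewrite mulrN opprK.
- rewrite -RintegralB//; [|exact: integrable_mul_cos|exact: integrable_mul_sin].
  apply: eq_Rintegral => x _; rewrite /cis cosN sinN -/(theta x xi).
  by case: (f x) => a b /=; rewrite mulrN addrC.
Qed.

Lemma ifourierE m x :
  mu.-integrable setT (EFin \o (fun x => complex.Re (m x))) ->
  mu.-integrable setT (EFin \o (fun x => complex.Im (m x))) ->
  ifourier m x =
  Complex (cosT (fun x => complex.Re (m x)) x - sinT (fun x => complex.Im (m x)) x)
          (cosT (fun x => complex.Im (m x)) x + sinT (fun x => complex.Re (m x)) x).
Proof.
move=> i1 i2; rewrite /ifourier /cintegral; congr Complex.
- rewrite -RintegralB//; [|exact: integrable_mul_cos|exact: integrable_mul_sin].
  apply: eq_Rintegral => xi _; rewrite /cis -/(theta x xi) thetaC.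
  by case: (m xi).
- rewrite -RintegralD//; [|exact: integrable_mul_cos|exact: integrable_mul_sin].
  apply: eq_Rintegral => xi _; rewrite /cis -/(theta x xi) thetaC.
  by case: (m xi) => a b /=; rewrite addrC.
Qed.

Lemma bessel2 g1 g2 :
  mu.-integrable setT (EFin \o g1) -> mu.-integrable setT (EFin \o g2) ->
  (\int[mu]_xi (2 * (cosT g1 xi ^+ 2 + sinT g1 xi ^+ 2) +
                2 * (cosT g2 xi ^+ 2 + sinT g2 xi ^+ 2))%:E <=
   2%:E * \int[mu]_x (g1 x ^+ 2 + g2 x ^+ 2)%:E)%E.
Proof.
move=> i1 i2.
have mT g : mu.-integrable setT (EFin \o g) ->
    measurable_fun setT (fun xi => (cosT g xi ^+ 2 + sinT g xi ^+ 2)%:E).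
  move=> ig; apply/measurable_EFinP; apply: measurable_funD; apply: measurable_funX.
    exact: measurable_cosT.
  exact: measurable_sinT.
have T0 g xi : (0 <= (cosT g xi ^+ 2 + sinT g xi ^+ 2)%:E)%E.
  by rewrite lee_fin addr_ge0 ?sqr_ge0.
have m2 g : mu.-integrable setT (EFin \o g) -> measurable_fun setT (fun x => (g x ^+ 2)%:E).
  by move=> /integrableR_measurable mg; apply/measurable_EFinP; exact: measurable_funX.
under eq_integral do rewrite EFinD 2!EFinM.
rewrite ge0_integralD//; last 4 first.
- by move=> xi _; rewrite mule_ge0// lee_fin.
- by apply: measurable_funeM; exact: mT.
- by move=> xi _; rewrite mule_ge0// lee_fin.
- by apply: measurable_funeM; exact: mT.
rewrite !ge0_integralZl//; [|exact: mT|exact: mT].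
under [X in (_ <= _ * X)%E]eq_integral do rewrite EFinD.
rewrite ge0_integralD//; last 4 first.
- by move=> x _; rewrite lee_fin sqr_ge0.
- exact: m2.
- by move=> x _; rewrite lee_fin sqr_ge0.
- exact: m2.
rewrite [leRHS]ge0_muleDr; last 2 first.
- by apply: integral_ge0 => x _; rewrite lee_fin sqr_ge0.
- by apply: integral_ge0 => x _; rewrite lee_fin sqr_ge0.
by apply: leeD; rewrite lee_wpmul2l ?lee_fin//; exact: bessel.
Qed.

End plancherel_bounds.

(** * Schwartz functions *)

Section schwartz_transform.
Context {R : realType} (d : nat).
Local Notation mu := (@lebesgue_rV R d).
Implicit Types (h F : 'rV[R]_d -> R) (x xi v : 'rV[R]_d).

Definition decay_weight x : R := \prod_(j < d) (oneDsqr (x ord0 j))^-1.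

Lemma oneDsqr_gt0 (s : R) : 0 < oneDsqr s.
Proof. exact: lt_le_trans ltr01 (oneDsqr_ge1 s). Qed.

Lemma decay_weight_gt0 x : 0 < decay_weight x.
Proof. by apply: prodr_gt0 => j _; rewrite invr_gt0 oneDsqr_gt0. Qed.

Lemma integrable_decay_weight : mu.-integrable setT (EFin \o decay_weight).
Proof.
have mo : measurable_fun setT (fun s : R => (oneDsqr s)^-1).
  by apply: continuous_measurable_fun; exact: continuous_oneDsqrV.
apply/integrableP; split.
  apply/measurable_EFinP; apply: measurable_prod => j _.
  exact: (measurableT_comp mo (measurable_rV_coord j)).
under eq_integral do rewrite gee0_abs ?lee_fin ?ltW ?decay_weight_gt0//.
rewrite (@ge0_integral_prod_rV R d (fun _ s => (oneDsqr s)^-1) (fun=> pi)) ?ltry//.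
by move=> j; exact: integral_oneDsqrV.
Qed.

(** Expanding the product of the 1 + x_j^2 into monomials. These are indexed by
    lists of coordinates, in the form in which iterated derivatives produce them
    on the transform side. *)
Lemma decay_of_monomial_bounds F : (forall x, 0 <= F x) ->
  (forall t : seq 'I_d, exists M : R, forall x,
     \prod_(j <- t) `|x ord0 j| * F x <= M) ->
  exists M : R, forall x, F x <= M * decay_weight x.
Proof.
move=> F0 HF.
have H (s t : seq 'I_d) : exists M : R, forall x,
    \prod_(j <- t) `|x ord0 j| * (\prod_(j <- s) oneDsqr (x ord0 j)) * F x <= M.
  elim: s t => [|j s IH] t.
    by have [M HM] := HF t; exists M => x; rewrite big_nil mulr1.
  have [M1 H1] := IH t; have [M2 H2] := IH [:: j, j & t].
  exists (M1 + M2) => x; apply: le_trans (lerD (H1 x) (H2 x)).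
  rewrite !big_cons /oneDsqr -[x ord0 j ^+ 2]real_normK ?num_real//.
  by rewrite le_eqVlt; apply/orP; left; apply/eqP; ring.
have [M HM] := H (index_enum 'I_d) [::]; exists M => x.
rewrite /decay_weight prodfV ler_pdivlMr; last first.
  by apply: prodr_gt0 => j _; exact: oneDsqr_gt0.
by have := HM x; rewrite big_nil mul1r mulrC.
Qed.

Lemma prod_count_mem (t : seq 'I_d) x :
  \prod_(j < d) x ord0 j ^+ count_mem j t = \prod_(j <- t) x ord0 j.
Proof.
elim: t => [|i t IH]; first by rewrite big_nil big1.
rewrite big_cons -IH /=; under eq_bigr do rewrite exprD.
rewrite big_split/=; congr (_ * _).
rewrite (bigD1 i)//= eqxx expr1 big1 ?mulr1// => j ji.
by rewrite eq_sym (negbTE ji).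
Qed.

Definition rpartial (j : 'I_d) h x : R := 'D_(delta_mx ord0 j) h x.

Definition iter_rpartial (s : seq 'I_d) h := foldr rpartial h s.

Definition rschwartz h : Prop := forall s : seq 'I_d,
  (forall x, differentiable (iter_rpartial s h) x) /\
  (forall t : seq 'I_d, exists M : R, forall x,
     \prod_(j <- t) `|x ord0 j| * `|iter_rpartial s h x| <= M).

Lemma rschwartz_partial j h : rschwartz h -> rschwartz (rpartial j h).
Proof.
move=> hh s; have := hh (rcons s j).
by rewrite /iter_rpartial foldr_rcons.
Qed.

Lemma rschwartz_iter s h : rschwartz h -> rschwartz (iter_rpartial s h).
Proof. by move=> hh; elim: s => //= j s; exact: rschwartz_partial. Qed.

Lemma iter_cpartialE (s : seq 'I_d) (f : 'rV[R]_d -> R[i]) x :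
  iter_cpartial s f x =
  Complex (iter_rpartial s (fun y => complex.Re (f y)) x)
          (iter_rpartial s (fun y => complex.Im (f y)) x).
Proof.
elim: s x => [|j s IH] x /=; first by case: (f x).
rewrite /cpartial /rpartial.
have -> : iter_cpartial s f = fun x => Complex
   (iter_rpartial s (fun y => complex.Re (f y)) x)
   (iter_rpartial s (fun y => complex.Im (f y)) x) by apply/funext.
by [].
Qed.

Lemma normr_Re_cmod (z : R[i]) : `|complex.Re z| <= cmod z.
Proof.
rewrite -ler_sqr ?nnegrE// ?sqrtr_ge0//; last by case: z => a b; exact: sqrtr_ge0.
by rewrite cmod_sqr real_normK ?num_real// lerDl sqr_ge0.
Qed.

Lemma normr_Im_cmod (z : R[i]) : `|complex.Im z| <= cmod z.
Proof.
rewrite -ler_sqr ?nnegrE// ?sqrtr_ge0//; last by case: z => a b; exact: sqrtr_ge0.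
by rewrite cmod_sqr real_normK ?num_real// lerDr sqr_ge0.
Qed.

Lemma schwartz_rschwartz (f : 'rV[R]_d -> R[i]) : schwartz f ->
  rschwartz (fun y => complex.Re (f y)) /\ rschwartz (fun y => complex.Im (f y)).
Proof.
move=> sf.
have E s : iter_cpartial s f = fun x => Complex
    (iter_rpartial s (fun y => complex.Re (f y)) x)
    (iter_rpartial s (fun y => complex.Im (f y)) x).
  by apply/funext => x; exact: iter_cpartialE.
split=> s; have [df bf] := sf s; split.
- by move=> x; have [+ _] := df x; rewrite E.
- move=> t; have [M HM] := bf (fun j => count_mem j t); exists M => x.
  apply: le_trans (HM x); rewrite prod_count_mem normr_prod ler_wpM2l//.
    by apply: prodr_ge0.
  by apply: le_trans (normr_Re_cmod _); rewrite E.
- by move=> x; have [_ +] := df x; rewrite E.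
- move=> t; have [M HM] := bf (fun j => count_mem j t); exists M => x.
  apply: le_trans (HM x); rewrite prod_count_mem normr_prod ler_wpM2l//.
    by apply: prodr_ge0.
  by apply: le_trans (normr_Im_cmod _); rewrite E.
Qed.

Lemma rschwartz_decay h : rschwartz h ->
  exists M : R, forall x, `|h x| <= M * decay_weight x.
Proof.
move=> hh; apply: decay_of_monomial_bounds => // t.
by have [_ /(_ t)] := hh [::].
Qed.

Lemma rschwartz_measurable h : rschwartz h -> measurable_fun setT h.
Proof.
move=> hh; apply: continuous_measurable_rV => x.
by apply: differentiable_continuous; have [+ _] := hh [::]; exact.
Qed.

Lemma rschwartz_integrable h : rschwartz h -> mu.-integrable setT (EFin \o h).
Proof.
move=> hh; have [M HM] := rschwartz_decay hh.
apply: le_integrableR (HM) (integrableRZ M integrable_decay_weight).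
exact: rschwartz_measurable.
Qed.

End schwartz_transform.

(** * Integrability of the transform of a Schwartz function *)

Section real_dominated_convergence.
Context d (T : measurableType d) {R : realType} (mu : {measure set T -> \bar R}).

Lemma Rintegral_dominated_cvg (fn : nat -> T -> R) (f g : T -> R) :
  (forall n, measurable_fun setT (fn n)) ->
  (forall x, fn n x @[n --> \oo] --> f x) ->
  mu.-integrable setT (EFin \o g) -> (forall n x, `|fn n x| <= g x) ->
  \int[mu]_x fn n x @[n --> \oo] --> \int[mu]_x f x.
Proof.
move=> mfn fnf ig fng.
have mf : measurable_fun setT f.
  by apply: measurable_fun_cvg mfn _ => x _; exact: fnf.
have ifn n : mu.-integrable setT (EFin \o fn n).
  exact: le_integrableR (mfn n) (fng n) ig.
have mEfn n : measurable_fun setT (EFin \o fn n) by exact/measurable_EFinP.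
have mEf : measurable_fun setT (EFin \o f) by exact/measurable_EFinP.
have cE : {ae mu, forall x, setT x -> (EFin \o fn n) x @[n --> \oo] --> (EFin \o f) x}.
  apply: aeW => x _; apply: cvg_EFin; first exact: nearW.
  exact: fnf.
have bE : {ae mu, forall x n, setT x -> (`|(EFin \o fn n) x| <= (EFin \o g) x)%E}.
  by apply: aeW => x n _; rewrite lee_fin.
have [if_ _ h] := dominated_convergence measurableT mEfn mEf cE ig bE.
apply: fine_cvg; rewrite (_ : _%:E = \int[mu]_x (EFin \o f) x)%E; first exact: h.
exact: EFin_Rintegral.
Qed.

End real_dominated_convergence.

Section transform_of_derivative.
Context {R : realType}.

Lemma derive_harmonic (V : normedModType R) (f : V -> R) (x v : V) :
  derivable f x v ->
  n.+1%:R * (f (x + (n.+1%:R^-1 : R) *: v) - f x) @[n --> \oo] --> 'D_v f x.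
Proof.
move=> dfx.
have := dfx; rewrite /derivable => /cvgP/= cd.
have H : (n.+1%:R^-1 : R) @[n --> \oo] --> (0 : R)^'.
  move=> A A0; suff : \forall n \near \oo, A (n.+1%:R^-1 : R) by [].
  have K : \forall n \near \oo, (n.+1%:R^-1 : R) != 0 -> A (n.+1%:R^-1 : R).
    exact: cvg_harmonic A0.
  by apply: filterS K => n; apply; rewrite invr_neq0.
have -> : (fun n : nat => n.+1%:R * (f (x + (n.+1%:R^-1 : R) *: v) - f x)) =
    (fun h : R => h^-1 *: (f (h *: v + x) - f x)) \o (fun n => n.+1%:R^-1).
  by apply/funext => n /=; rewrite invrK [in LHS](addrC x).
exact: (cvg_comp _ _ H cd).
Qed.

Lemma is_derive_line (V : normedModType R) (f : V -> R) (x v : V) (s : R) :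
  derivable f (x + s *: v) v ->
  is_derive s 1 (fun r : R => f (x + r *: v)) ('D_v f (x + s *: v)).
Proof.
move=> df.
have E : (fun h : R => h^-1 *: (f (x + (h *: (1 : R) + s) *: v) - f (x + s *: v))) =
    (fun h : R => h^-1 *: (f (h *: v + (x + s *: v)) - f (x + s *: v))).
  apply/funext => h; congr (_ *: (f _ - _)).
  by rewrite [h *: 1]mulr1 scalerDl addrCA.
split; first by rewrite /derivable E.
by rewrite /derive E.
Qed.

Lemma MVT_line (V : normedModType R) (f : V -> R) (x v : V) (r : R) : 0 < r ->
  (forall y, derivable f y v) ->
  exists2 s, 0 < s < r & f (x + r *: v) - f x = r * 'D_v f (x + s *: v).
Proof.
move=> r0 df.
have dl s := is_derive_line (df (x + s *: v)).
have cl : {within `[0, r], continuous (fun s : R => f (x + s *: v))}.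
  apply: continuous_subspaceT => s.
  by apply/differentiable_continuous/derivable1_diffP; case: (dl s).
have [s] := MVT r0 (fun s _ => dl s) cl.
rewrite in_itv/= => sr; rewrite scale0r addr0 subr0 => E.
by exists s => //; rewrite E mulrC.
Qed.

Variable d : nat.
Local Notation mu := (@lebesgue_rV R d).
Implicit Types (h : 'rV[R]_d -> R) (x xi : 'rV[R]_d).

Lemma decay_weight_shift x (j : 'I_d) (s : R) : 0 <= s <= 1 ->
  decay_weight (x + s *: delta_mx ord0 j) <= 3 * decay_weight x.
Proof.
move=> /andP[s0 s1]; rewrite /decay_weight (bigD1 j)//= [in leRHS](bigD1 j)//=.
rewrite (eq_bigr (fun i => (oneDsqr (x ord0 i))^-1)); last first.
  by move=> i ij; rewrite !mxE eqxx (negbTE ij) mulr0 addr0.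
rewrite mulrA ler_wpM2r//; first by apply: prodr_ge0 => i _; rewrite invr_ge0 ltW// oneDsqr_gt0.
rewrite !mxE !eqxx mulr1 ler_pdivlMr ?oneDsqr_gt0// mulrC.
rewrite ler_pdivrMr ?oneDsqr_gt0// /oneDsqr; move: (x ord0 j) => y.
(* The difference of the two sides is 2 (y + 3 s / 2)^2 + 2 - 3 s^2 / 2. *)
have := sqr_ge0 (2 * y + 3 * s); have : s * s <= 1 by nra.
by rewrite !expr2; nra.
Qed.

Lemma rschwartz_derivable h (j : 'I_d) x : rschwartz h ->
  derivable h x (delta_mx ord0 j).
Proof.
by move=> hh; apply: diff_derivable; have [+ _] := hh [::]; exact.
Qed.

(** Differentiating under the translation x -> x + e_j / n: the transform of the
    difference quotient is explicit, and dominated convergence applies since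
    the quotients are bounded by a multiple of [decay_weight]. *)
Lemma cvg_transform_partial h (j : 'I_d) (u : 'rV[R]_d -> R) :
  rschwartz h -> measurable_fun setT u -> (forall x, `|u x| <= 1) ->
  n.+1%:R * (\int[mu]_x (h x * u (x - (n.+1%:R^-1 : R) *: delta_mx ord0 j)) -
             \int[mu]_x (h x * u x)) @[n --> \oo] -->
  \int[mu]_x (rpartial j h x * u x).
Proof.
move=> hh mu' u1; set e := delta_mx ord0 j.
have mh := rschwartz_measurable hh; have ih := rschwartz_integrable hh.
have hp := rschwartz_partial j hh.
have mp := rschwartz_measurable hp.
have [M HM] := rschwartz_decay hp.
have M0 : 0 <= M.
  by have := le_trans (normr_ge0 _) (HM 0); rewrite pmulr_lge0// decay_weight_gt0.
pose D n x := n.+1%:R * (h (x + (n.+1%:R^-1 : R) *: e) - h x) * u x.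
have mshift n : measurable_fun setT (fun x : 'rV[R]_d => x + (n.+1%:R^-1 : R) *: e).
  have := @measurable_affine_rV R d 1 ((n.+1%:R^-1 : R) *: e).
  by under eq_fun do rewrite scale1r.
have mD n : measurable_fun setT (D n).
  apply: measurable_funM => //; apply: measurable_funM => //.
  by apply: measurable_funB => //; exact: (measurableT_comp mh).
have Dcvg x : D n x @[n --> \oo] --> rpartial j h x * u x.
  apply: cvgMl; exact: (derive_harmonic (@rschwartz_derivable h j x hh)).
have Dbound n x : `|D n x| <= 3 * M * decay_weight x.
  have n0 : 0 < n.+1%:R^-1 :> R by rewrite invr_gt0.
  have [s /andP[s0 sn] E] := MVT_line x n0 (fun y => @rschwartz_derivable h j y hh).
  rewrite /D E mulrA divff ?pnatr_eq0// mul1r normrM.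
  apply: (@le_trans _ _ (M * decay_weight (x + s *: e) * 1)).
    by apply: ler_pM => //; exact: HM.
  rewrite mulr1 (mulrC 3) -mulrA ler_wpM2l//; apply: decay_weight_shift.
  rewrite (ltW s0)/= (le_trans (ltW sn))// invf_le1// ler1n//.
have iW := integrableRZ (3 * M) (@integrable_decay_weight R d).
have := Rintegral_dominated_cvg mD Dcvg iW Dbound.
have -> : (fun n => \int[mu]_x D n x) = (fun n => n.+1%:R *
    (\int[mu]_x (h x * u (x - (n.+1%:R^-1 : R) *: e)) - \int[mu]_x (h x * u x))).
  apply/funext => n; rewrite /D; set v := _ *: e.
  have mv : measurable_fun setT (fun x => u (x - v)).
    apply: (measurableT_comp mu').
    have := @measurable_affine_rV R d 1 (- v).
    by under eq_fun do rewrite scale1r.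
  have iF := integrable_mul_bounded ih mv (fun x => u1 (x - v)).
  have iu := integrable_mul_bounded ih mu' u1.
  have mEF := (measurable_EFinP _ _).2 (integrableR_measurable iF).
  have iFv : mu.-integrable setT (EFin \o (fun x => h (x + v) * u x)).
    apply/integrableP; split.
      apply/measurable_EFinP; apply: measurable_funM => //.
      exact: (measurableT_comp mh (mshift n)).
    have [_] := integrableP _ _ _ iF; rewrite -(@integral_shift R d v
        (fun x => `|(h x * u (x - v))%:E|%E)); last exact: measurableT_comp.
    by under eq_integral do rewrite addrK.
  have shift : \int[mu]_x (h (x + v) * u x) = \int[mu]_x (h x * u (x - v)).
    congr fine; rewrite -[RHS](integral_shift v mEF).
    by apply: eq_integral => x _ /=; rewrite addrK.
  rewrite -shift -RintegralB// -RintegralZl//; last exact: integrableRB.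
  by apply: eq_Rintegral => x _; rewrite -mulrBl mulrA.
by [].
Qed.

Lemma theta_sub_delta x xi (j : 'I_d) (r : R) :
  theta (x - r *: delta_mx ord0 j) xi = theta x xi - 2 * pi * xi ord0 j * r.
Proof.
rewrite /theta dotpBl mulrBr; congr (_ - _); rewrite -mulrA; congr (_ * _).
rewrite /dotp (bigD1 j)//= big1 ?addr0; first by rewrite !mxE !eqxx mulr1 mulrC.
by move=> i ij; rewrite !mxE (negbTE ij) andbF mulr0 mul0r.
Qed.

Lemma is_derive_trig0 (k A B : R) :
  is_derive (0 : R) 1 (fun r => cos (k * r) * A + sin (k * r) * B) (k * B).
Proof.
have dl : is_derive (0 : R) 1 (fun s : R => k * s) k.
  by apply: (is_derive_eq (is_deriveZ k (is_derive_id (0 : R) 1))); exact: mulr1.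
have ds := is_derive1_comp (is_derive_sin (k * 0)) dl.
have dc := is_derive1_comp (is_derive_cos (k * 0)) dl.
have D := is_deriveD (is_deriveZ A dc) (is_deriveZ B ds).
have -> : (fun r => cos (k * r) * A + sin (k * r) * B) =
    A \*: (cos \o *%R k) + B \*: (sin \o *%R k).
  by apply/funext => r; rewrite !fctE /= ![_ *: _]mulrC.
apply: is_derive_eq; rewrite mulr0 sin0 cos0 oppr0 mul0r mul1r scaler0 add0r.
exact: mulrC.
Qed.

Lemma cvg_trig0 (k A B : R) :
  n.+1%:R * ((cos (k * n.+1%:R^-1) * A + sin (k * n.+1%:R^-1) * B) - A) @[n --> \oo]
    --> k * B.
Proof.
have dphi := is_derive_trig0 k A B.
have := @derive_harmonic R _ 0 1 (@ex_derive _ _ _ _ _ _ _ dphi).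
have -> : 'D_1 (fun r => cos (k * r) * A + sin (k * r) * B) 0 = k * B.
  by case: dphi.
have -> // : (fun n : nat => n.+1%:R *
    ((cos (k * (0 + (n.+1%:R^-1 : R) *: (1 : R))) * A +
      sin (k * (0 + (n.+1%:R^-1 : R) *: (1 : R))) * B) -
     (cos (k * 0) * A + sin (k * 0) * B))) =
  (fun n => n.+1%:R * ((cos (k * n.+1%:R^-1) * A + sin (k * n.+1%:R^-1) * B) - A)).
apply/funext => n.
by rewrite add0r [_ *: 1]mulr1 mulr0 cos0 sin0 mul1r mul0r addr0.
Qed.

Lemma cosT_partial h (j : 'I_d) xi : rschwartz h ->
  cosT (rpartial j h) xi = 2 * pi * xi ord0 j * sinT h xi.
Proof.
move=> hh; have ih := rschwartz_integrable hh.
set k := 2 * pi * xi ord0 j.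
have mc : measurable_fun setT (fun x => cos (theta x xi)).
  by under eq_fun do rewrite thetaC; exact: measurable_cos_theta_r.
have := @cvg_transform_partial h j _ hh mc (fun x => normr_cos_le1 _).
have -> : (fun n => n.+1%:R * (\int[mu]_x (h x *
      cos (theta (x - (n.+1%:R^-1 : R) *: delta_mx ord0 j) xi)) -
    \int[mu]_x (h x * cos (theta x xi)))) =
    (fun n => n.+1%:R * ((cos (k * n.+1%:R^-1) * cosT h xi +
      sin (k * n.+1%:R^-1) * sinT h xi) - cosT h xi)).
  apply/funext => n; congr (_ * (_ - _)).
  have ic := integrable_mul_cos xi ih; have is_ := integrable_mul_sin xi ih.
  rewrite /cosT /sinT -!RintegralZl//.
  rewrite -RintegralD//; [|exact: integrableRZ|exact: integrableRZ].
  by apply: eq_Rintegral => x _; rewrite theta_sub_delta -/k cosB; ring.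
by move=> /cvg_unique; apply => //; exact: cvg_trig0.
Qed.

Lemma sinT_partial h (j : 'I_d) xi : rschwartz h ->
  sinT (rpartial j h) xi = - (2 * pi * xi ord0 j * cosT h xi).
Proof.
move=> hh; have ih := rschwartz_integrable hh.
set k := 2 * pi * xi ord0 j.
have mc : measurable_fun setT (fun x => sin (theta x xi)).
  by under eq_fun do rewrite thetaC; exact: measurable_sin_theta_r.
have := @cvg_transform_partial h j _ hh mc (fun x => normr_sin_le1 _).
have -> : (fun n => n.+1%:R * (\int[mu]_x (h x *
      sin (theta (x - (n.+1%:R^-1 : R) *: delta_mx ord0 j) xi)) -
    \int[mu]_x (h x * sin (theta x xi)))) =
    (fun n => n.+1%:R * ((cos (k * n.+1%:R^-1) * sinT h xi +
      sin (k * n.+1%:R^-1) * - cosT h xi) - sinT h xi)).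
  apply/funext => n; congr (_ * (_ - _)).
  have ic := integrable_mul_cos xi ih; have is_ := integrable_mul_sin xi ih.
  rewrite mulrN /cosT /sinT -!RintegralZl//.
  rewrite -RintegralB//; [|exact: integrableRZ|exact: integrableRZ].
  by apply: eq_Rintegral => x _; rewrite theta_sub_delta -/k sinB; ring.
rewrite -mulrN; by move=> /cvg_unique; apply => //; exact: cvg_trig0.
Qed.

Definition transform_size h xi : R := `|cosT h xi| + `|sinT h xi|.

Lemma transform_size_partial h (j : 'I_d) xi : rschwartz h ->
  `|xi ord0 j| * transform_size h xi <= transform_size (rpartial j h) xi.
Proof.
move=> hh; rewrite /transform_size cosT_partial// sinT_partial// normrN !normrM.
rewrite addrC -!mulrDr ler_wpM2r//.
have pi2 := pi_ge2 R.
by rewrite ler_peMl// !ger0_norm ?pi_ge0//; lra.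
Qed.

(** Transforming the iterated derivatives of [h] produces every monomial in [xi], each
    factor coming with a constant 2 pi >= 1. *)
Lemma rschwartz_transform_decay h : rschwartz h ->
  exists M : R, forall xi, transform_size h xi <= M * decay_weight xi.
Proof.
move=> hh; apply: decay_of_monomial_bounds => [xi|t]; first exact: addr_ge0.
have it := rschwartz_integrable (rschwartz_iter t hh).
exists (2 * \int[mu]_x `|iter_rpartial t h x|) => xi.
apply: (@le_trans _ _ (transform_size (iter_rpartial t h) xi)); last first.
  by rewrite mulr2n mulrDl mul1r lerD ?normr_cosT ?normr_sinT.
elim: t {it} => [|j t IH]; first by rewrite big_nil mul1r.
rewrite big_cons -mulrA; apply: le_trans (transform_size_partial j xi _).
  by rewrite ler_wpM2l.
exact: rschwartz_iter.
Qed.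

Lemma integrable_cosT h : rschwartz h -> mu.-integrable setT (EFin \o cosT h).
Proof.
move=> hh; have [M HM] := rschwartz_transform_decay hh.
apply: le_integrableR _ (integrableRZ M (@integrable_decay_weight R d)).
  by apply: measurable_cosT; exact: rschwartz_integrable.
by move=> xi; apply: le_trans (HM xi); rewrite lerDl.
Qed.

Lemma integrable_sinT h : rschwartz h -> mu.-integrable setT (EFin \o sinT h).
Proof.
move=> hh; have [M HM] := rschwartz_transform_decay hh.
apply: le_integrableR _ (integrableRZ M (@integrable_decay_weight R d)).
  by apply: measurable_sinT; exact: rschwartz_integrable.
by move=> xi; apply: le_trans (HM xi); rewrite lerDr.
Qed.

End transform_of_derivative.

(** * Lipschitz bounds from derivative bounds almost everywhere *)

Section derivative_bounded_almost_everywhere.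
Context {R : realType}.
Local Notation leb := (@lebesgue_measure R).
Implicit Types (F : R -> R) (E : set R).

(** Real induction on the points [x] up to which [F] grows no more than allowed,
    where the allowance is enlarged by the measure of shrinking open
    neighborhoods of the exceptional set: at an exceptional point this
    correction has an infinite derivative, so it beats the derivative of [F]. *)
Lemma le_of_ae_derive_le F E (K v u : R) :
  (forall x, derivable F x 1) -> measurable E -> leb E = 0%E ->
  (forall x, ~ E x -> 'D_1 F x <= K) -> v <= u ->
  F u - F v <= K * (u - v).
Proof.
move=> dF mE E0 FK vu; apply/ler_addgt0Pr => e0 e0_gt0.
pose e := e0 / (u - v + 1).
have uv1 : 0 < u - v + 1 by rewrite ltr_wpDl ?subr_ge0.
have e_gt0 : 0 < e by rewrite divr_gt0.
have /choice[U HU] n : exists U : set R,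
    [/\ open U, E `<=` U & (leb U <= (e / (2 ^ n.+1)%:R)%:E)%E].
  have en : 0 < e / (2 ^ n.+1)%:R by rewrite divr_gt0// ltr0n expn_gt0.
  have Eoo : (leb E < +oo)%E by rewrite E0.
  have [U [oU EU UE]] := lebesgue_regularity_outer mE Eoo en.
  exists U; split => //; apply: le_trans (ltW UE).
  rewrite -[X in leb X](setDUK EU) setUC measureU0//.
  by apply: measurableD => //; exact: open_measurable.
have oU n : open (U n) by have [] := HU n.
have EU n : E `<=` U n by have [] := HU n.
have mU n (x : R) : measurable (U n `&` `[v, x]).
  by apply: measurableI => //; exact: open_measurable.
pose G (x : R) := (\sum_(n <oo) leb (U n `&` `[v, x]))%E.
have Gle x : (G x <= e%:E)%E.
  apply: le_trans (epsilon_trick0 xpredT (ltW e_gt0)).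
  apply: lee_nneseries => [n _ _|n _]; first exact: measure_ge0.
  have [_ _] := HU n; apply: le_trans; apply: le_measure; rewrite ?inE//.
    exact: mU.
  exact: open_measurable.
have G0 x : (0 <= G x)%E by apply: nneseries_ge0 => n _ _; exact: measure_ge0.
have Gfin x : G x \is a fin_num.
  by rewrite ge0_fin_numE// (le_lt_trans (Gle x))// ltry.
have Gjump (s y : R) (N : nat) : v <= s -> s <= y ->
    (forall n, (n < N)%N -> `]s, y] `<=` U n) ->
    (G s + (N%:R * (y - s))%:E <= G y)%E.
  move=> vs sy sub.
  pose b n : \bar R := if (n < N)%N then (y - s)%:E else 0%E.
  have b0 n : (0 <= b n)%E by rewrite /b; case: ifP => // _; rewrite lee_fin subr_ge0.
  have bN : ((N%:R * (y - s))%:E <= \sum_(n <oo) b n)%E.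
    apply: le_trans (nneseries_lim_ge N _) => //.
    rewrite big_mkord (eq_bigr (fun=> (y - s)%:E)); last first.
      by move=> i _; rewrite /b ltn_ord.
    by rewrite sumEFin sumr_const card_ord mulr_natl.
  apply: le_trans (leeD (le_refl _) bN) _.
  rewrite -nneseriesD//.
  apply: lee_nneseries => [n _ _|n _]; first by rewrite adde_ge0.
  rewrite /b; case: ifPn => nN; last first.
    rewrite adde0; apply: le_measure; rewrite ?inE; [exact: mU|exact: mU|].
    by apply: setIS => z /=; rewrite !in_itv/= => /andP[-> /le_trans]; apply.
  have -> : ((y - s)%:E = leb `]s, y])%E.
    rewrite lebesgue_measure_itv/= lte_fin; case: ifPn => //.
    by rewrite -leNgt => ys; rewrite (le_anti (introT andP (conj sy ys))) subrr.
  rewrite -measureU//; last 2 first.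
  - exact: mU.
  - rewrite -subset0 => z [[_ /=]]; rewrite !in_itv/= => /andP[_ zs] /andP[sz _].
    by move: (lt_le_trans sz zs); rewrite ltxx.
  - apply: le_measure; rewrite ?inE; [|exact: mU|].
      by apply: measurableU => //; exact: mU.
    move=> z [[Uz]|/= zsy].
      rewrite /= !in_itv/= => /andP[vz zs]; split => //=.
      by rewrite vz (le_trans zs).
    split; first exact: (sub n nN).
    move: zsy; rewrite !in_itv/= => /andP[sz ->]; rewrite andbT.
    by rewrite (le_trans vs)// ltW.
pose H x := F x - F v - (K + e) * (x - v).
pose S := [set x | v <= x <= u /\ H x <= fine (G x)].
have cF : continuous F.
  by move=> x; exact/differentiable_continuous/derivable1_diffP.
have cH : continuous H.
  move=> x; apply: cvgB; first by apply: cvgB; [exact: cF|exact: cvg_cst].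
  apply: cvgMr; apply: cvgB; [exact: cvg_id|exact: cvg_cst].
have Sv : S v.
  split; first by rewrite lexx.
  by rewrite /H !subrr mulr0 subr0 fine_ge0.
have Sub x : S x -> x <= u by move=> [/andP[]].
have supS : has_sup S by split; [exists v|exists u => x /Sub].
pose s := sup S.
have vs : v <= s by apply: ub_le_sup => //; exact: supS.2.
have su : s <= u by apply: ge_sup => //; exists v.
have Ss : S s.
  split; first by rewrite vs.
  rewrite leNgt; apply/negP => Gs.
  have /nbhs_ballP[r /= r0 Hr] : \forall y \near s, fine (G s) < H y.
    exact: (cvgr_gt _ (cH s)).
  have [x Sx sx] := sup_adherent r0 supS.
  have xs : x <= s by apply: ub_le_sup => //; exact: supS.2.
  have : fine (G s) < H x.
    by apply: Hr; rewrite /ball/= ger0_norm ?subr_ge0// ltrBlDr -ltrBlDl.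
  apply/negP; rewrite -leNgt; have [/andP[vx _] Hx] := Sx.
  apply: (le_trans Hx); rewrite fine_le//.
  apply: le_trans (Gjump x s 0%N vx xs _) => //.
  by rewrite mul0r adde0.
have usE : s = u.
  apply/eqP; rewrite eq_le su/= leNgt; apply/negP => slu.
  have [N [FN NE]] : exists N, 'D_1 F s < K + e + N%:R /\ ((0 < N)%N -> E s).
    have [Es|nEs] := pselect (E s); last first.
      exists 0%N; split => //; rewrite addr0.
      by rewrite (le_lt_trans (FK _ nEs))// ltrDl.
    exists (Num.truncn `|'D_1 F s - (K + e)|).+1; split => //.
    rewrite -ltrBlDl; apply: le_lt_trans (ler_norm _) _.
    by rewrite truncnS_gt.
  have [g [gE cg gs]] := (is_derive1_caratheodory F s ('D_1 F s)).1 (DeriveDef (dF s) erefl).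
  have nU : \forall y \near s, forall n, (n < N)%N -> U n y.
    elim: N NE {FN} => [_|N IH NE]; first by near=> y => n.
    have Us : \forall y \near s, U N y.
      by apply: open_nbhs_nbhs; split; [exact: oU|exact: EU (NE isT)].
    near=> y => n; rewrite ltnS leq_eqVlt => /predU1P[->|nN].
      by near: y.
    move: n nN; near: y; apply: IH => N0; exact: (NE isT).
  have ng : \forall y \near s, g y < K + e + N%:R.
    by apply: (cvgr_lt _ cg); rewrite gs.
  have /nbhs_ballP[r /= r0 Hr] : nbhs s ([set y | g y < K + e + N%:R] `&`
      [set y | forall n, (n < N)%N -> U n y]) by exact: filterI.
  pose y := Num.min u (s + r / 2).
  have sy : s < y by rewrite lt_min slu ltrDl divr_gt0.
  have yr : y - s < r.
    by rewrite ltrBlDl (@le_lt_trans _ _ (s + r / 2)) ?ge_min ?lexx ?orbT// ltrD2l ltr_pdivrMr// ltr_pMr// ltr1n.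
  have yball z : s < z <= y -> ball s r z.
    move=> /andP[sz zy]; rewrite /ball/= distrC gtr0_norm ?subr_gt0//.
    by rewrite (le_lt_trans _ yr)// lerD2r.
  have Sy : S y.
    split; first by rewrite (le_trans vs (ltW sy)) ge_min lexx.
    have gy : g y < K + e + N%:R by apply: (Hr _ (yball y _)).1; rewrite sy lexx.
    have sub n : (n < N)%N -> `]s, y] `<=` U n.
      by move=> nN z /=; rewrite in_itv/= => /yball/Hr[_]; exact.
    have jump := Gjump s y N vs (ltW sy) sub.
    have [_ Hs] := Ss; rewrite -lee_fin fineK// in Hs.
    rewrite -lee_fin fineK//; apply: le_trans jump.
    apply: (@le_trans _ _ ((H s)%:E + (N%:R * (y - s))%:E)%E); last by rewrite leeD2r.
    rewrite -EFinD lee_fin /H -subr_ge0.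
    have -> : F s - F v - (K + e) * (s - v) + N%:R * (y - s) -
        (F y - F v - (K + e) * (y - v)) =
        (K + e + N%:R) * (y - s) - (F y - F s) by ring.
    by rewrite gE -mulrBl mulr_ge0// subr_ge0// ltW.
  by have := ub_le_sup supS.2 Sy; rewrite -/s leNgt sy.
have [_] := Ss; rewrite usE /H lerBlDr => h.
apply: (le_trans h); rewrite mulrDl addrCA lerD2l.
apply: (@le_trans _ _ (e + e * (u - v))).
  by rewrite lerD2r -lee_fin fineK.
by rewrite -{1}(mulr1 e) -mulrDr addrC /e divfK ?gt_eqF.
Unshelve. all: by end_near. Qed.

Lemma lipschitz_of_ae_derivative F E (K : R) :
  (forall x, derivable F x 1) -> measurable E -> leb E = 0%E ->
  (forall x, ~ E x -> `|'D_1 F x| <= K) ->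
  forall u v, `|F u - F v| <= K * `|u - v|.
Proof.
move=> dF mE E0 FK u v; wlog vu : u v / v <= u.
  move=> H; have [/H //|/ltW/H] := leP v u.
  by rewrite distrC [X in _ * X]distrC.
rewrite [X in _ * X]ger0_norm ?subr_ge0// ler_norml; apply/andP; split.
  rewrite lerNl opprB.
  have dNF x : derivable (\- F) x 1 by exact: derivableN.
  have h : (\- F) u - (\- F) v <= K * (u - v).
    apply: le_of_ae_derive_le dNF mE E0 _ vu => x Ex.
    by rewrite deriveN// (le_trans _ (FK _ Ex))// -normrN ler_norm.
  by move: h; rewrite /= opprK addrC.
apply: le_of_ae_derive_le dF mE E0 _ vu => x Ex.
exact: le_trans (ler_norm _) (FK _ Ex).
Qed.

End derivative_bounded_almost_everywhere.

(** * The multiplier along rays *)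

Section rays.
Context {R : realType} (d : nat).
Local Notation mu := (@lebesgue_rV R d).
Local Notation leb := (@lebesgue_measure R).
Implicit Types (xi : 'rV[R]_d) (a : 'rV[R]_d -> R[i]).

Lemma ge0_of_ge0_off_null (h : R -> R) (E : set R) : continuous h ->
  measurable E -> leb E = 0%E -> (forall u, ~ E u -> 0 <= h u) ->
  forall u, 0 <= h u.
Proof.
move=> ch mE E0 hE u; rewrite leNgt; apply/negP => hu.
have /nbhs_ballP[r /= r0 Hr] : \forall y \near u, h y < 0.
  exact: (cvgr_lt _ (ch u)).
have : (leb (ball u r) <= leb E)%E.
  apply: le_measure; rewrite ?inE//; first exact: measurable_ball.
  move=> y /Hr hy; apply: contrapT => /hE.
  by rewrite leNgt hy.
rewrite E0 lebesgue_measure_ball ?(ltW r0)// leNgt => /negP; apply.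
by rewrite lte_fin mulrn_wgt0.
Qed.

(** Tonelli in (xi, u): every dilation preserves null sets. *)
Lemma ae_null_on_ray (N : set 'rV[R]_d) : measurable N -> mu N = 0%E ->
  {ae mu, forall xi, measurable [set u | N (expR u *: xi)] /\
                     leb [set u | N (expR u *: xi)] = 0%E}.
Proof.
move=> mN N0.
pose B : set ('rV[R]_d * measurableTypeR R) := [set p | N (expR p.2 *: p.1)].
have mB : measurable B.
  rewrite -[X in measurable X]setTI.
  apply: (measurable_fun_rV (f := fun p : 'rV[R]_d * measurableTypeR R => expR p.2 *: p.1)) => //.
  move=> i; under eq_fun do rewrite mxE.
  apply: measurable_funM.
    exact: (measurableT_comp (@measurable_expR R) measurable_snd).
  exact: (measurableT_comp (measurable_rV_coord i) measurable_fst).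
have mB1 xi : measurable [set u | N (expR u *: xi)].
  have := measurable_xsection xi mB.
  by rewrite /xsection; under eq_set do rewrite inE.
pose f (p : 'rV[R]_d * measurableTypeR R) : \bar R := (\1_B p)%:E.
have mf : measurable_fun setT f.
  exact/measurable_EFinP/measurable_indic.
have f0 p : (0 <= f p)%E by rewrite lee_fin.
have I0 : (\int[mu]_xi \int[leb]_u f (xi, u) = 0)%E.
  apply: (etrans (fubini_tonelli f mf f0)).
  apply: integral0_eq => u _.
  rewrite -(lebesgue_rV_scale_null (expR_gt0 u) mN N0).
  rewrite -[X in mu X]setIT -integral_indic//.
  have := measurable_ysection u mB.
  by rewrite /ysection; under eq_set do rewrite inE.
have mI : measurable_fun setT (fun xi => \int[leb]_u f (xi, u))%E.
  exact: (measurable_fun_fubini_tonelli_F f mf f0).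
have /(ae_eq_integral_abs mu measurableT mI) : (\int[mu]_xi `|\int[leb]_u f (xi, u)| = 0)%E.
  by under eq_integral do rewrite gee0_abs ?integral_ge0//.
move=> H; apply: filterS H => xi H; have h := H I; split; first exact: mB1.
rewrite -[X in leb X]setIT -integral_indic//. exact: mB1.
Qed.

Lemma derive_along_ray (f : 'rV[R]_d -> R) xi (u : R) :
  (forall x, differentiable f x) ->
  is_derive u 1 (fun u : R => f (expR u *: xi))
    (\sum_(j < d) (expR u *: xi) ord0 j * 'D_(delta_mx ord0 j) f (expR u *: xi)).
Proof.
move=> df; set x := expR u *: xi.
have de : differentiable (@expR R) u.
  by apply/derivable1_diffP; exact: derivable_expR.
have dg : differentiable (fun u : R => expR u *: xi) u.
  exact: differentiableZl.
have dfg : differentiable (f \o (fun u : R => expR u *: xi)) u.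
  exact: differentiable_comp.
split; first by apply/derivable1_diffP.
rewrite deriveE// diff_comp//=.
rewrite [X in 'd f _ X](_ : _ = x); last first.
  rewrite diffZl//=; congr (_ *: _).
  by rewrite -deriveE//; have := is_derive_expR u; case.
transitivity ('d f x (\sum_(j < d) x ord0 j *: delta_mx ord0 j)).
  by rewrite -row_sum_delta.
rewrite linear_sum; apply: eq_bigr => j _.
by rewrite linearZ/= deriveE.
Qed.

Lemma Re_euler_derivative a xi : complex.Re (euler_derivative a xi) =
  \sum_(j < d) xi ord0 j * 'D_(delta_mx ord0 j) (fun y => complex.Re (a y)) xi.
Proof.
rewrite /euler_derivative (big_morph (@complex.Re R) (id1 := 0) (op1 := +%R))//; last by case=> ? ? [].
by apply: eq_bigr => j _ /=; rewrite mul0r subr0.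
Qed.

Lemma Im_euler_derivative a xi : complex.Im (euler_derivative a xi) =
  \sum_(j < d) xi ord0 j * 'D_(delta_mx ord0 j) (fun y => complex.Im (a y)) xi.
Proof.
rewrite /euler_derivative (big_morph (@complex.Im R) (id1 := 0) (op1 := +%R))//; last by case=> ? ? [].
by apply: eq_bigr => j _ /=; rewrite mul0r addr0.
Qed.

Lemma enormZ (r : R) xi : 0 <= r -> enorm (r *: xi) = r * enorm xi.
Proof.
move=> r0; rewrite /enorm (_ : dotp (r *: xi) (r *: xi) = r ^+ 2 * dotp xi xi).
  by rewrite sqrtrM ?sqr_ge0// sqrtr_sqr ger0_norm.
by rewrite /dotp mulr_sumr; apply: eq_bigr => j _; rewrite !mxE; ring.
Qed.

Lemma cmodE (z : R[i]) :
  cmod z = Num.sqrt (complex.Re z ^+ 2 + complex.Im z ^+ 2).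
Proof. by case: z. Qed.

Lemma cmod_ge0 (z : R[i]) : 0 <= cmod z.
Proof. by rewrite cmodE sqrtr_ge0. Qed.

Lemma cmod_le_add (z : R[i]) : cmod z <= `|complex.Re z| + `|complex.Im z|.
Proof.
rewrite -ler_sqr ?nnegrE ?cmod_ge0 ?addr_ge0// cmod_sqr.
rewrite -[complex.Re z ^+ 2]real_normK ?num_real//.
rewrite -[complex.Im z ^+ 2]real_normK ?num_real// sqrrD lerD2r lerDl.
by rewrite mulrn_wge0// mulr_ge0.
Qed.

(** The hypotheses on [a], known almost everywhere, hold everywhere along almost
    every ray: by Fubini the exceptional set meets almost every ray in a null
    set, off which continuity gives the size bounds and
    [lipschitz_of_ae_derivative] the regularity. *)
Lemma ray_bounds (K A : R) a : (forall xi, cdifferentiable a xi) ->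
  {ae mu, forall xi, cmod (a xi) <= A} ->
  {ae mu, forall xi,
     [/\ cmod (a xi) <= K * (enorm xi / Num.sqrt d%:R),
         cmod (a xi) <= K * (Num.sqrt d%:R / enorm xi) &
         cmod (euler_derivative a xi) <= K]} ->
  {ae mu, forall xi, exists2 y : R, 0 <= y & forall u,
     [/\ cmod (a (expR u *: xi)) <= A,
         cmod (a (expR u *: xi)) <= K * (expR u * y),
         cmod (a (expR u *: xi)) <= K * (expR (- u) / y) &
         forall v, cmod (a (expR u *: xi) - a (expR v *: xi)) <= 2 * K * `|u - v|]}.
Proof.
move=> da hA hK.
have [N [mN N0 bad]] : mu.-negligible (~` [set xi | cmod (a xi) <= A /\
    [/\ cmod (a xi) <= K * (enorm xi / Num.sqrt d%:R),
        cmod (a xi) <= K * (Num.sqrt d%:R / enorm xi) &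
        cmod (euler_derivative a xi) <= K]]).
  exact: (filterI hA hK).
apply: filterS (ae_null_on_ray mN N0) => xi [mE E0].
set E := [set u | _] in mE E0.
have good u : ~ E u -> cmod (a (expR u *: xi)) <= A /\
    [/\ cmod (a (expR u *: xi)) <= K * (enorm (expR u *: xi) / Num.sqrt d%:R),
        cmod (a (expR u *: xi)) <= K * (Num.sqrt d%:R / enorm (expR u *: xi)) &
        cmod (euler_derivative a (expR u *: xi)) <= K].
  by move=> nE; apply: contrapT => h; apply: nE; exact: bad.
have dRe := derive_along_ray xi _ (fun x => (da x).1).
have dIm := derive_along_ray xi _ (fun x => (da x).2).
have cRe : continuous (fun u => complex.Re (a (expR u *: xi))).
  by move=> u; apply/differentiable_continuous/derivable1_diffP; case: (dRe u).
have cIm : continuous (fun u => complex.Im (a (expR u *: xi))).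
  by move=> u; apply/differentiable_continuous/derivable1_diffP; case: (dIm u).
have cm : continuous (fun u => cmod (a (expR u *: xi))).
  under eq_fun do rewrite cmodE !expr2.
  move=> u; apply: (@continuous_comp _ _ _ (fun u =>
    complex.Re (a (expR u *: xi)) * complex.Re (a (expR u *: xi)) +
    complex.Im (a (expR u *: xi)) * complex.Im (a (expR u *: xi))) (@Num.sqrt R)).
    by apply: cvgD; apply: cvgM; (exact: cRe || exact: cIm).
  exact: sqrt_continuous.
have le_all (h : R -> R) : continuous h ->
    (forall u, ~ E u -> cmod (a (expR u *: xi)) <= h u) ->
    forall u, cmod (a (expR u *: xi)) <= h u.
  move=> ch hE u; rewrite -subr_ge0.
  apply: (ge0_of_ge0_off_null (h := fun u => h u - _) _ mE E0) => [x|x Ex].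
    by apply: cvgB; [exact: ch|exact: cm].
  by rewrite subr_ge0 hE.
exists (enorm xi / Num.sqrt d%:R); first by rewrite divr_ge0 ?sqrtr_ge0.
have lipRe := @lipschitz_of_ae_derivative R (fun u => complex.Re (a (expR u *: xi))) E K
  (fun x => @ex_derive _ _ _ _ _ _ _ (dRe x)) mE E0.
have lipIm := @lipschitz_of_ae_derivative R (fun u => complex.Im (a (expR u *: xi))) E K
  (fun x => @ex_derive _ _ _ _ _ _ _ (dIm x)) mE E0.
move=> u; split.
- apply: (le_all (cst A)) => [x|x /good[]//].
  exact: cvg_cst.
- apply: (le_all (fun u => K * (expR u * (enorm xi / Num.sqrt d%:R)))) => [x|x /good[_ []]].
    apply: cvgMr; apply: cvgMl; exact: continuous_expR.
  by move=> + _ _; rewrite enormZ ?expR_ge0// -mulrA.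
- apply: (le_all (fun u => K * (expR (- u) / (enorm xi / Num.sqrt d%:R)))) => [x|x /good[_ []]].
    apply: cvgMr; apply: cvgMl.
    by apply: continuous_comp; [exact: opp_continuous|exact: continuous_expR].
  move=> _ + _; rewrite enormZ ?expR_ge0// expRN invf_div invfM.
  by rewrite [Num.sqrt _ * (_ * _)]mulrCA.
- move=> v; apply: le_trans (cmod_le_add _) _; rewrite mulr2n mulrDl mul1r mulrDl.
  apply: lerD.
    have -> : complex.Re (a (expR u *: xi) - a (expR v *: xi)) =
        complex.Re (a (expR u *: xi)) - complex.Re (a (expR v *: xi)).
      by case: (a _); case: (a _).
    apply: lipRe => x /good[_ [_ _]]; apply: le_trans.
    case: (dRe x) => _ ->; rewrite -Re_euler_derivative; exact: normr_Re_cmod.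
  have -> : complex.Im (a (expR u *: xi) - a (expR v *: xi)) =
      complex.Im (a (expR u *: xi)) - complex.Im (a (expR v *: xi)).
    by case: (a _); case: (a _).
  apply: lipIm => x /good[_ [_ _]]; apply: le_trans.
  case: (dIm x) => _ ->; rewrite -Im_euler_derivative; exact: normr_Im_cmod.
Qed.

End rays.

(** * Sums of squared increments over a mesh *)

Section dyadic_sums.
Context {R : realType}.
Implicit Types (rho z t : R).

(** Both halves of the sum are geometric, whatever the position of the peak; the
    bound for [z <= 1] decreases in [z] so as to pay for the shift
    [z |-> z / rho]. *)
Lemma sum_min_geometric rho z n : 0 < rho < 1 -> 0 <= z ->
  \sum_(p < n) Num.min (z * rho ^- p) (rho ^+ p / z) <= 2 / (1 - rho).
Proof.
move=> /andP[rho0 rho1]; have r1 : 0 < 1 - rho by rewrite subr_gt0.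
rewrite le_eqVlt => /predU1P[<-|z0].
  rewrite big1 => [|p _]; first by rewrite divr_ge0// ltW.
  by rewrite mul0r invr0 mulr0 minxx.
pose B z := if z <= 1 then (2 - z) / (1 - rho) else z^-1 / (1 - rho).
have B2 x : 0 < x -> B x <= 2 / (1 - rho).
  move=> x0; rewrite /B; case: ifPn => [_|/negbTE x1]; rewrite ler_pM2r ?invr_gt0//.
    lra.
  have {}x1 : 1 < x by rewrite ltNge x1.
  by rewrite (@le_trans _ _ 1)// ?ler1n// invf_le1// ltW.
apply: le_trans (B2 z z0).
elim: n z z0 => [|n IH] x x0.
  rewrite big_ord0 /B; case: ifPn => x1; rewrite divr_ge0 ?(ltW r1)//.
    lra.
  by rewrite invr_ge0 ltW.
rewrite big_ord_recl/= expr0 invr1 mulr1 mul1r.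
have xr0 : 0 < x / rho by rewrite divr_gt0.
rewrite (eq_bigr (fun p : 'I_n => Num.min (x / rho * rho ^- p) (rho ^+ p / (x / rho)))); last first.
  move=> p _; rewrite /bump/= add1n; congr Num.min.
    by rewrite exprS invfM mulrA.
  by rewrite invf_div exprS mulrA [rho * _]mulrC.
apply: le_trans (lerD (le_refl _) (IH _ xr0)) _.
rewrite /B ler_pdivrMr// mul1r.
have [x1|x1] := leP x 1.
  apply: (@le_trans _ _ (x + (if x <= rho then (2 - x / rho) / (1 - rho)
      else (x / rho)^-1 / (1 - rho)))).
    by rewrite lerD2r ge_min lexx.
  rewrite ler_pdivlMr// mulrDl; case: ifPn => [xr|/negbTE xr].
    rewrite divfK ?gt_eqF//.
    have : (x / rho) * rho = x by rewrite divfK// gt_eqF.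
    move: (x / rho) xr0 => w w0 wE.
    have := mulr_ge0 (ltW w0) (sqr_ge0 (1 - rho)).
    by rewrite -wE expr2; lra.
  rewrite divfK ?gt_eqF// invf_div.
  have {}xr : rho < x by rewrite ltNge xr.
  have : (rho / x) * x = rho by rewrite divfK// gt_eqF.
  have : rho / x < 1 by rewrite ltr_pdivrMr// mul1r.
  have : 0 < rho / x by rewrite divr_gt0.
  move: (rho / x) => w w0 w1 wE; rewrite -wE.
  have h1 : 0 <= 1 - x by rewrite subr_ge0.
  have h2 : 0 <= 2 - w * (1 + x) by nra.
  by have := mulr_ge0 h1 h2; lra.
have xr : (x <= rho) = false by apply/negbTE; rewrite -ltNge (lt_trans rho1).
rewrite xr ler_pdivlMr// mulrDl divfK ?gt_eqF// invf_div.
apply: (@le_trans _ _ (x^-1 * (1 - rho) + rho / x)).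
  by rewrite lerD2r ler_pM2r// ge_min lexx orbT.
by rewrite mulrBr mulr1 [rho / x]mulrC subrK.
Qed.

Definition root4 t : R := Num.sqrt (Num.sqrt t).

Lemma root4_ge0 t : 0 <= root4 t. Proof. exact: sqrtr_ge0. Qed.

Lemma root4_le t t' : t <= t' -> root4 t <= root4 t'.
Proof. by move=> tt'; rewrite !ler_wsqrtr. Qed.

Lemma root4M t t' : 0 <= t -> root4 (t * t') = root4 t * root4 t'.
Proof. by move=> t0; rewrite /root4 sqrtrM// sqrtrM ?sqrtr_ge0. Qed.

Lemma root4V t : 0 <= t -> root4 t^-1 = (root4 t)^-1.
Proof. by move=> t0; rewrite /root4 !sqrtrV ?sqrtr_ge0. Qed.

Lemma sqrt_expR t : Num.sqrt (expR t) = expR (t / 2).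
Proof.
rewrite -[RHS]ger0_norm ?expR_ge0// -sqrtr_sqr expr2 -expRD.
congr (Num.sqrt (expR _)); by field.
Qed.

Lemma root4_expR t : root4 (expR t) = expR (t / 4).
Proof. by rewrite /root4 !sqrt_expR; congr expR; field. Qed.

(** From t^2 = t^(1/2) t^(1/4) t^(5/4). *)
Lemma sqr_le_interpolate t A B D : 0 <= t -> t <= A -> t <= B -> t <= D ->
  t ^+ 2 <= Num.sqrt A * root4 B * (D * root4 D).
Proof.
move=> t0 tA tB tD.
have -> : t ^+ 2 = Num.sqrt t * root4 t * (t * root4 t).
  have h4 : root4 t * root4 t = Num.sqrt t by rewrite -expr2 sqr_sqrtr ?sqrtr_ge0.
  have h2 : Num.sqrt t * Num.sqrt t = t by rewrite -expr2 sqr_sqrtr.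
  by rewrite mulrACA h4 mulrAC h2 expr2.
apply: ler_pM; rewrite ?mulr_ge0 ?sqrtr_ge0//.
  by apply: ler_pM; rewrite ?sqrtr_ge0 ?ler_wsqrtr// root4_le.
by apply: ler_pM; rewrite ?sqrtr_ge0// root4_le.
Qed.

Lemma one_sub_expRN t : 0 <= t <= 1 -> t / 2 <= 1 - expR (- t).
Proof.
move=> /andP[t0 t1].
have h : 1 + t <= expR t by exact: expR_ge1Dx.
have h0 : 0 < 1 + t by rewrite ltr_pwDl.
rewrite lerBrDr -lerBrDl expRN.
apply: (@le_trans _ _ (1 + t)^-1); first by rewrite lef_pV2 ?posrE ?expR_gt0.
rewrite -[leLHS]mul1r ler_pdivrMr//; nra.
Qed.

(** On either side of its peak the fourth root of the bump decays geometrically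
    with ratio e^(-delta/4), so that [sum_min_geometric] applies; the constant
    comes from 1 - e^(-delta/4) >= delta / 8. *)
Lemma sum_bump_root4 (delta y : R) n : 0 < delta <= 1 -> 0 <= y ->
  \sum_(p < n) root4 (Num.min (expR (p%:R * delta) * y) (expR (- (p%:R * delta)) / y))
    <= 16 / delta.
Proof.
move=> /andP[d0 d1] y0; set rho := expR (- (delta / 4)).
have rho0 : 0 < rho by exact: expR_gt0.
have rr : delta / 8 <= 1 - rho.
  have : 0 <= delta / 4 <= 1.
    by apply/andP; split; [rewrite divr_ge0// ltW|rewrite ler_pdivrMr//; lra].
  move=> /one_sub_expRN; apply: le_trans; lra.
have rho1 : rho < 1 by rewrite -subr_gt0 (lt_le_trans _ rr)// divr_gt0.
rewrite (eq_bigr (fun p : 'I_n =>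
    Num.min (root4 y * rho ^- p) (rho ^+ p / root4 y))); last first.
  move=> p _.
  have E1 : root4 (expR (p%:R * delta) * y) = root4 y * rho ^- p.
    rewrite root4M ?expR_ge0// root4_expR [LHS]mulrC; congr (_ * _).
    by rewrite /rho -expRM_natl -expRN; congr expR; field.
  have E2 : root4 (expR (- (p%:R * delta)) / y) = rho ^+ p / root4 y.
    rewrite root4M ?expR_ge0// (root4V y0) root4_expR; congr (_ / _).
    by rewrite /rho -expRM_natl; congr expR; field.
  rewrite -E1 -E2; case: leP => h; rewrite /Num.min; case: ifPn => //.
    by rewrite -leNgt => h'; apply/eqP; rewrite eq_le h' root4_le.
  by move=> h'; apply/eqP; rewrite eq_le root4_le ?(ltW h)// ltW.
apply: le_trans (sum_min_geometric n _ (root4_ge0 y)) _; first by rewrite rho0.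
have r0 : 0 < 1 - rho by rewrite subr_gt0.
rewrite ler_pdivrMr// mulrAC ler_pdivlMr//; lra.
Qed.

(** What [ray_bounds] provides along a ray, in the logarithmic variable. *)
Definition ray_controlled (K A : R) (b : R -> R[i]) : Prop :=
  exists2 y : R, 0 <= y & forall u,
     [/\ cmod (b u) <= A, cmod (b u) <= K * (expR u * y),
         cmod (b u) <= K * (expR (- u) / y) &
         forall v, cmod (b u - b v) <= 2 * K * `|u - v|].

Lemma ray_controlled_opp K A b : ray_controlled K A b ->
  ray_controlled K A (fun u => b (- u)).
Proof.
move=> [y y0 H]; exists y^-1; rewrite ?invr_ge0// => u.
have [h1 h2 h3 h4] := H (- u); split => //.
- by rewrite opprK in h3.
- by rewrite invrK.
- by move=> v; rewrite (le_trans (h4 _))// opprK addrC distrC.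
Qed.

Lemma cmodD_le (z w : R[i]) : cmod (z + w) <= cmod z + cmod w.
Proof. exact: le_normcD. Qed.

Lemma cmodN (z : R[i]) : cmod (- z) = cmod z.
Proof. exact: normcN. Qed.

Definition chain_const (K : R) : R :=
  32 * K * Num.sqrt 2 * root4 ((1 + expR 1) * K) * root4 (2 * K) +
  16 * K * root4 K * root4 K.

(** [sqr_le_interpolate] is applied to the three bounds 2 A, c times the bump, and
    2 K delta. The fourth root of the bump sums to at most 16 / delta, which still
    leaves delta^(1/4) of the factor delta^(5/4). *)
Lemma sum_increments K A b (delta : R) n : 0 < K -> 0 <= A ->
  0 < delta <= 1 -> ray_controlled K A b ->
  \sum_(p < n) cmod (b (p.+1%:R * delta) - b (p%:R * delta)) ^+ 2 <=
  chain_const K * Num.sqrt A * root4 delta.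
Proof.
move=> K0 A0 d01 [y y0 H]; have /andP[d0 d1] := d01.
set bump := fun p : nat => Num.min (expR (p%:R * delta) * y) (expR (- (p%:R * delta)) / y).
have e1 : 1 <= expR 1 :> R by rewrite -expR0 ler_expR.
set c := (1 + expR 1) * K.
have c0 : 0 <= c by rewrite mulr_ge0 ?(ltW K0)// addr_ge0// expR_ge0.
apply: (@le_trans _ _ (\sum_(p < n) (Num.sqrt (2 * A) * root4 c *
    (2 * K * delta * root4 (2 * K * delta))) * root4 (bump p))).
  apply: ler_sum => p _.
  have [a1 a2 a3 a4] := H (p.+1%:R * delta).
  have [b1 b2 b3 _] := H (p%:R * delta).
  have tri := cmodD_le (b (p.+1%:R * delta)) (- b (p%:R * delta)).
  rewrite cmodN in tri.
  have pd : p.+1%:R * delta = delta + p%:R * delta by rewrite -natr1 mulrDl mul1r addrC.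
  have ed : expR (p.+1%:R * delta) <= expR 1 * expR (p%:R * delta).
    by rewrite pd expRD ler_wpM2r ?expR_ge0// ler_expR.
  have ed' : expR (- (p.+1%:R * delta)) <= expR (- (p%:R * delta)).
    by rewrite ler_expR lerN2 pd lerDr ltW.
  rewrite mulrAC -[_ * root4 c * root4 _]mulrA -root4M//.
  apply: sqr_le_interpolate; first exact: cmod_ge0.
  - by rewrite (le_trans tri)// mulr2n mulrDl mul1r lerD.
  - have cX : cmod (b (p.+1%:R * delta) - b (p%:R * delta)) <=
        c * (expR (p%:R * delta) * y).
      rewrite (le_trans tri)// /c mulrDl mul1r mulrDl addrC lerD//.
      rewrite (le_trans a2)// -mulrA [expR 1 * _]mulrCA ler_wpM2l ?(ltW K0)//.
      by rewrite mulrA ler_wpM2r.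
    have cY : cmod (b (p.+1%:R * delta) - b (p%:R * delta)) <=
        c * (expR (- (p%:R * delta)) / y).
      have Y0 : 0 <= expR (- (p%:R * delta)) / y by rewrite divr_ge0 ?expR_ge0.
      rewrite (le_trans tri)// /c mulrDl mul1r mulrDl addrC lerD//.
      apply: (le_trans a3); apply: (@le_trans _ _ (K * (expR (- (p%:R * delta)) / y))).
        by rewrite ler_wpM2l ?(ltW K0)// ler_wpM2r ?invr_ge0.
      by rewrite ler_wpM2r// ler_peMl// ltW.
    by rewrite /bump /Num.min; case: ifP.
  - by apply: (le_trans (a4 _)); rewrite pd addrK ger0_norm// ltW.
rewrite -mulr_sumr.
apply: (@le_trans _ _ (Num.sqrt (2 * A) * root4 c *
    (2 * K * delta * root4 (2 * K * delta)) * (16 / delta))).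
  rewrite ler_wpM2l ?sum_bump_root4//.
  by rewrite !mulr_ge0 ?sqrtr_ge0 ?(ltW K0) ?(ltW d0).
rewrite sqrtrM// (root4M delta) ?mulr_ge0 ?(ltW K0)//.
apply: (@le_trans _ _ (32 * K * Num.sqrt 2 * root4 c * root4 (2 * K) *
    Num.sqrt A * root4 delta)).
  rewrite le_eqVlt; apply/orP; left; apply/eqP.
  by field; rewrite gt_eqF.
rewrite -[leRHS]mulrA -[leLHS]mulrA ler_wpM2r ?mulr_ge0 ?sqrtr_ge0//.
by rewrite /chain_const -/c lerDl !mulr_ge0 ?sqrtr_ge0 ?(ltW K0).
Qed.

(** As for [sum_increments] at step 1, except that the third bound is K: the bump never
    exceeds 1. *)
Lemma sum_values K A b n : 0 < K -> 0 <= A -> ray_controlled K A b ->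
  \sum_(p < n) cmod (b p%:R) ^+ 2 <= chain_const K * Num.sqrt A.
Proof.
move=> K0 A0 [y y0 H].
set bump := fun p : nat => Num.min (expR (p%:R * 1) * y) (expR (- (p%:R * 1)) / y).
apply: (@le_trans _ _ (\sum_(p < n) (Num.sqrt A * root4 K * (K * root4 K)) * root4 (bump p))).
  apply: ler_sum => p _.
  have [b1 b2 b3 _] := H p%:R.
  have bb : cmod (b p%:R) <= K * bump p.
    by rewrite /bump mulr1 /Num.min; case: ifP.
  rewrite mulrAC -[_ * root4 K * root4 _]mulrA -root4M ?(ltW K0)//.
  apply: sqr_le_interpolate => //; first exact: cmod_ge0.
  apply: (le_trans bb); rewrite ler_piMr ?(ltW K0)// /bump mulr1.
  have [h|h] := leP (expR p%:R * y) 1; first by rewrite ge_min h.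
  rewrite ge_min expRN -invfM invf_le1 ?(ltW h) ?orbT//.
  exact: lt_trans ltr01 h.
rewrite -mulr_sumr.
apply: (@le_trans _ _ (Num.sqrt A * root4 K * (K * root4 K) * (16 / 1))).
  rewrite ler_wpM2l ?sum_bump_root4 ?ltr01 ?lexx//.
  by rewrite !mulr_ge0 ?sqrtr_ge0 ?(ltW K0).
apply: (@le_trans _ _ (16 * K * root4 K * root4 K * Num.sqrt A)).
  by rewrite le_eqVlt; apply/orP; left; apply/eqP; field.
rewrite ler_wpM2r ?sqrtr_ge0// /chain_const lerDr.
by rewrite !mulr_ge0 ?sqrtr_ge0 ?(ltW K0)// addr_ge0 ?expR_ge0.
Qed.

End dyadic_sums.

(** * Chaining *)

Section chaining.
Context {R : realType}.

(** Level 0 keeps the values at the integers themselves, from which the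
    increments of the higher levels reach every dyadic point. *)
Definition dyadic_diff (V : zmodType) (b : R -> V) (l p : nat) : V :=
  if l is _.+1 then b (p.+1%:R * 2 ^- l) - b (p%:R * 2 ^- l) else b p%:R.

(** The eighth root of 1/2: the gain delta^(1/4) of [sum_increments] is its 2l-th
    power at delta = 2^-l. *)
Definition chain_ratio : R := Num.sqrt (root4 2^-1).

Lemma chain_ratio_gt0 : 0 < chain_ratio.
Proof. by rewrite !sqrtr_gt0 invr_gt0. Qed.

Lemma chain_ratio_lt1 : chain_ratio < 1.
Proof.
have H (x : R) : x < 1 -> Num.sqrt x < 1.
  by move=> x1; rewrite -[ltRHS](@sqrtr1 R) ltr_sqrt.
by do 3 apply: (H _); rewrite invf_lt1// ltr1n.
Qed.

Lemma root4_exp2V l : root4 (2 ^- l) = chain_ratio ^+ l * chain_ratio ^+ l.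
Proof.
have H n : root4 (2^-1 ^+ n) = (root4 2^-1) ^+ n :> R.
  elim: n => [|n IH]; first by rewrite !expr0 /root4 !sqrtr1.
  by rewrite !exprS root4M ?invr_ge0// IH.
rewrite -exprVn H -exprMn; congr (_ ^+ _).
by rewrite -expr2 sqr_sqrtr// sqrtr_ge0.
Qed.

Lemma sum_dyadic_diff (K A : R) (b : R -> R[i]) l n : 0 < K -> 0 <= A ->
  ray_controlled K A b ->
  \sum_(p < n) cmod (dyadic_diff b l p) ^+ 2 <=
  chain_const K * Num.sqrt A * (chain_ratio ^+ l * chain_ratio ^+ l).
Proof.
move=> K0 A0 bK; rewrite -root4_exp2V; case: l => [|l].
  by rewrite expr0 invr1 /root4 !sqrtr1 mulr1; exact: sum_values.
apply: sum_increments => //; rewrite invr_gt0 exprn_gt0//= invf_le1 ?exprn_gt0//.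
by rewrite exprn_ege1// ler1n.
Qed.

(** Adds one term to a Cauchy-Schwarz bound: the cross term [2 * X * c] is split by the
    inequality of means, weighted so that [W] and [w] add up. *)
Lemma weighted_cauchy_schwarz_step (W w Q X c : R) : 0 < W -> 0 < w ->
  X ^+ 2 <= W * Q -> (X + c) ^+ 2 <= (W + w) * (Q + w^-1 * c ^+ 2).
Proof.
move=> W0 w0 XQ.
have h1 : 2 * (X * c) <= w * Q + W * (w^-1 * c ^+ 2).
  apply: (@le_trans _ _ (w / W * X ^+ 2 + W * (w^-1 * c ^+ 2))); last first.
    by rewrite lerD2r -mulrA ler_wpM2l ?(ltW w0)// mulrC ler_pdivrMr// mulrC.
  have E : w / W * X ^+ 2 + W * (w^-1 * c ^+ 2) - 2 * (X * c) =
      (w * W)^-1 * (w * X - W * c) ^+ 2 by field; rewrite !gt_eqF.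
  by rewrite -subr_ge0 E mulr_ge0 ?sqr_ge0// invr_ge0 mulr_ge0 ?ltW.
have -> : (W + w) * (Q + w^-1 * c ^+ 2) =
    W * Q + c ^+ 2 + (w * Q + W * (w^-1 * c ^+ 2)).
  by field; rewrite gt_eqF.
rewrite (_ : (X + c) ^+ 2 = X ^+ 2 + c ^+ 2 + 2 * (X * c)); last by ring.
by rewrite lerD// lerD.
Qed.

(** From level [n] to level [n.+1], an odd multiple of [2 ^- n.+1] is one increment away
    from its left neighbour, which belongs to level [n]; an even multiple already
    belongs to level [n]. *)
Lemma chaining_at_dyadic (h : R -> R) (r : R) n m : 0 < r ->
  exists s : nat -> nat, h (m%:R * 2 ^- n) ^+ 2 <=
    (\sum_(l < n.+1) r ^+ l) * (\sum_(l < n.+1) r ^- l * dyadic_diff h l (s l) ^+ 2).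
Proof.
move=> r0; elim: n m => [|n IH] m.
  exists (fun=> m); rewrite !big_ord1 !expr0 invr1 mulr1 !mul1r.
  by rewrite /dyadic_diff.
have [s Hs] := IH m./2.
(* For odd [m] the last increment starts at [m.-1]; for even [m] any index does. *)
exists (fun l => if l == n.+1 then m.-1 else s l).
rewrite !(big_ord_recr n.+1) /= eqxx.
rewrite [\sum_(l < n.+1) r ^- l * _](eq_bigr (fun l : 'I_n.+1 => r ^- l * dyadic_diff h l (s l) ^+ 2)); last first.
  by move=> l _; rewrite ltn_eqF.
have W0 : 0 < \sum_(l < n.+1) r ^+ l.
  rewrite big_ord_recl expr0 ltr_pwDl// sumr_ge0// => l _.
  by rewrite exprn_ge0 ?ltW.
have rn0 : 0 < r ^+ n.+1 by rewrite exprn_gt0.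
have two : 2 ^- n = 2 * 2 ^- n.+1 :> R.
  by rewrite exprS invfM mulrA divff// mul1r.
have [om|em] := boolP (odd m).
  have mE : m.-1 = (m./2).*2 by rewrite -[in LHS](odd_double_half m) om.
  have -> : h (m%:R * 2 ^- n.+1) = h (m./2%:R * 2 ^- n) + dyadic_diff h n.+1 m.-1.
    rewrite /dyadic_diff prednK ?odd_gt0// two mulrA.
    have -> : (m./2)%:R * 2 = m.-1%:R :> R by rewrite mE -muln2 natrM.
    by rewrite addrC subrK.
  exact: weighted_cauchy_schwarz_step.
have -> : h (m%:R * 2 ^- n.+1) = h (m./2%:R * 2 ^- n).
  congr h; rewrite two mulrA; congr (_ * _).
  by rewrite -natrM muln2 even_halfK.
apply: (le_trans Hs); apply: ler_pM.
- exact: ltW.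
- by apply: sumr_ge0 => l _; rewrite mulr_ge0 ?sqr_ge0// invr_ge0 exprn_ge0// ltW.
- by rewrite lerDl ltW.
- by rewrite lerDl mulr_ge0 ?sqr_ge0// invr_ge0 ltW.
Qed.

Lemma sum_geometric_le (r : R) n : 0 < r < 1 -> \sum_(l < n) r ^+ l <= (1 - r)^-1.
Proof.
move=> /andP[r0 r1]; have r1' : 0 < 1 - r by rewrite subr_gt0.
rewrite -[leRHS]mul1r ler_pdivlMr// mulrC.
rewrite -[1 - r]opprB mulNr -subrX1 opprB gerBl.
by rewrite exprn_ge0 ?ltW.
Qed.

(** By continuity and density, [chaining_at_dyadic] extends to every point;
    replacing the single increment of each level by the sum over the level makes
    the right-hand side independent of the point. *)
Lemma chaining (h : R -> R) (r u : R) : 0 < r < 1 -> continuous h -> 0 <= u ->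
  ((h u ^+ 2)%:E <= (1 - r)^-1%:E *
    \sum_(l <oo) \sum_(p <oo) (r ^- l * dyadic_diff h l p ^+ 2)%:E)%E.
Proof.
move=> r01 ch u0; have /andP[r0 r1] := r01.
have r1' : 0 < 1 - r by rewrite subr_gt0.
set Q := (\sum_(l <oo) _)%E.
have t0 l p : 0 <= r ^- l * dyadic_diff h l p ^+ 2.
  by rewrite mulr_ge0 ?sqr_ge0// invr_ge0 exprn_ge0// ltW.
have S0 l : (0 <= \sum_(p <oo) (r ^- l * dyadic_diff h l p ^+ 2)%:E)%E.
  by apply: nneseries_ge0 => p _ _; rewrite lee_fin.
have at_dyadic n m : ((h (m%:R * 2 ^- n) ^+ 2)%:E <= (1 - r)^-1%:E * Q)%E.
  have [s Hs] := chaining_at_dyadic h n m r0.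
  have le1 : ((\sum_(l < n.+1) r ^- l * dyadic_diff h l (s l) ^+ 2)%:E <= Q)%E.
    apply: le_trans (nneseries_lim_ge n.+1 _); last by move=> l _ _; exact: S0.
    rewrite big_mkord -sumEFin; apply: lee_sum => l _.
    apply: le_trans (nneseries_lim_ge (s l).+1 _); last by move=> p _ _; rewrite lee_fin.
    rewrite big_nat_recr//= leeDr// sume_ge0// => p _.
    by rewrite lee_fin.
  apply: le_trans (_ : _ <= ((1 - r)^-1 * (\sum_(l < n.+1) r ^- l * dyadic_diff h l (s l) ^+ 2))%:E)%E _.
    rewrite lee_fin; apply: (le_trans Hs); rewrite ler_wpM2r ?sumr_ge0//.
    exact: sum_geometric_le.
  by rewrite EFinM lee_wpmul2l// lee_fin invr_ge0 ltW.
rewrite leNgt; apply/negP => hu.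
have B0 : (0 <= (1 - r)^-1%:E * Q)%E.
  rewrite mule_ge0 ?lee_fin ?invr_ge0 ?(ltW r1')//.
  by apply: nneseries_ge0 => l _ _; exact: S0.
have Bfin : ((1 - r)^-1%:E * Q)%E \is a fin_num.
  by rewrite ge0_fin_numE// (lt_le_trans hu)// leey.
move: hu at_dyadic; rewrite -(fineK Bfin) lte_fin => hu at_dyadic.
have ch2 : continuous (fun x => h x * h x) by move=> x; apply: cvgM; exact: ch.
have /nbhs_ballP[e /= e0 He] : \forall x \near u, fine ((1 - r)^-1%:E * Q) < h x * h x.
  by apply: (cvgr_gt _ (ch2 u)); rewrite -expr2.
have [n ne] : exists n, 2 ^- n < e :> R.
  exists (Num.truncn e^-1).+1.
  rewrite -[ltRHS]invrK ltf_pV2 ?posrE ?invr_gt0 ?exprn_gt0//.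
  apply: lt_le_trans (truncnS_gt _) _.
  by rewrite -natrX ler_nat ltnW// ltn_expl.
pose m := Num.truncn (u * 2 ^+ n).
have n0 : 0 < 2 ^+ n :> R by rewrite exprn_gt0.
have : fine ((1 - r)^-1%:E * Q) < h (m%:R * 2 ^- n) * h (m%:R * 2 ^- n).
  apply: He; rewrite /ball/=.
  have /andP[m1 m2] := truncn_itv (mulr_ge0 u0 (ltW n0)).
  have m1' : m%:R * 2 ^- n <= u by rewrite ler_pdivrMr.
  rewrite ger0_norm ?subr_ge0// (lt_trans _ ne)// ltrBlDr.
  rewrite -[X in _ < X + _]mul1r -mulrDl ltr_pdivlMr// (lt_le_trans m2)//.
  by rewrite -natr1 addrC.
apply/negP; rewrite -leNgt -expr2.
by have := at_dyadic n m; rewrite lee_fin.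
Qed.

End chaining.

(** * Complex-valued transforms *)

Section maximal_bound.
Context {R : realType} (d : nat).
Local Notation mu := (@lebesgue_rV R d).
Implicit Types (a f m F : 'rV[R]_d -> R[i]) (x xi : 'rV[R]_d).

Definition cintegrable m : Prop :=
  mu.-integrable setT (EFin \o (fun xi => complex.Re (m xi))) /\
  mu.-integrable setT (EFin \o (fun xi => complex.Im (m xi))).

Definition cmeasurable m : Prop :=
  measurable_fun setT (fun xi => complex.Re (m xi)) /\
  measurable_fun setT (fun xi => complex.Im (m xi)).

Lemma cReM (z w : R[i]) : complex.Re (z * w) =
  complex.Re z * complex.Re w - complex.Im z * complex.Im w.
Proof. by case: z; case: w. Qed.

Lemma cImM (z w : R[i]) : complex.Im (z * w) =
  complex.Re z * complex.Im w + complex.Im z * complex.Re w.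
Proof. by case: z => ? ?; case: w => ? ? /=. Qed.

Lemma cReB (z w : R[i]) : complex.Re (z - w) = complex.Re z - complex.Re w.
Proof. by case: z; case: w. Qed.

Lemma cImB (z w : R[i]) : complex.Im (z - w) = complex.Im z - complex.Im w.
Proof. by case: z; case: w. Qed.

Lemma cmodM (z w : R[i]) : cmod (z * w) = cmod z * cmod w.
Proof. exact: ComplexField.Normc.normcM. Qed.

Lemma cintegrable_measurable m : cintegrable m -> cmeasurable m.
Proof. by move=> [/integrableR_measurable ? /integrableR_measurable ?]. Qed.

Lemma cintegrableB m m' : cintegrable m -> cintegrable m' ->
  cintegrable (fun xi => m xi - m' xi).
Proof.
move=> [h1 h2] [h1' h2']; split.
  by under eq_fun do rewrite /= cReB; exact: integrableRB.
by under eq_fun do rewrite /= cImB; exact: integrableRB.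
Qed.

Lemma cintegrableM m F (M : R) : cmeasurable m -> (forall xi, cmod (m xi) <= M) ->
  cintegrable F -> cintegrable (fun xi => m xi * F xi).
Proof.
move=> [m1 m2] bm [i1 i2].
have bRe xi : `|complex.Re (m xi)| <= M by exact: le_trans (normr_Re_cmod _) (bm xi).
have bIm xi : `|complex.Im (m xi)| <= M by exact: le_trans (normr_Im_cmod _) (bm xi).
split.
  under eq_fun do rewrite /= cReM mulrC [X in _ - X]mulrC.
  by apply: integrableRB; apply: integrable_mul_bounded.
under eq_fun do rewrite /= cImM mulrC [X in _ + X]mulrC.
by apply: integrableRD; apply: integrable_mul_bounded.
Qed.

Lemma fourier_ReIm f :
  mu.-integrable setT (EFin \o (fun x => complex.Re (f x))) ->
  mu.-integrable setT (EFin \o (fun x => complex.Im (f x))) ->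
  (fun xi => complex.Re (fourier f xi)) =
    (fun xi => cosT (fun x => complex.Re (f x)) xi +
               sinT (fun x => complex.Im (f x)) xi) /\
  (fun xi => complex.Im (fourier f xi)) =
    (fun xi => cosT (fun x => complex.Im (f x)) xi -
               sinT (fun x => complex.Re (f x)) xi).
Proof. by move=> i1 i2; split; apply/funext => xi; rewrite fourierE. Qed.

Lemma ifourier_ReIm m :
  mu.-integrable setT (EFin \o (fun x => complex.Re (m x))) ->
  mu.-integrable setT (EFin \o (fun x => complex.Im (m x))) ->
  (fun x => complex.Re (ifourier m x)) =
    (fun x => cosT (fun xi => complex.Re (m xi)) x -
              sinT (fun xi => complex.Im (m xi)) x) /\
  (fun x => complex.Im (ifourier m x)) =
    (fun x => cosT (fun xi => complex.Im (m xi)) x +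
              sinT (fun xi => complex.Re (m xi)) x).
Proof. by move=> i1 i2; split; apply/funext => xi; rewrite ifourierE. Qed.

Lemma cintegrable_fourier f : schwartz f -> cintegrable (fourier f).
Proof.
move=> /schwartz_rschwartz[s1 s2].
have i1 := rschwartz_integrable s1; have i2 := rschwartz_integrable s2.
have [E1 E2] := fourier_ReIm i1 i2; split.
  by rewrite E1; apply: integrableRD; [exact: integrable_cosT|exact: integrable_sinT].
by rewrite E2; apply: integrableRB; [exact: integrable_cosT|exact: integrable_sinT].
Qed.

Lemma ifourierB m m' x : cintegrable m -> cintegrable m' ->
  ifourier (fun xi => m xi - m' xi) x = ifourier m x - ifourier m' x.
Proof.
move=> im im'; have [h1 h2] := cintegrableB im im'.
have [i1 i2] := im; have [i1' i2'] := im'.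
rewrite !ifourierE//.
have cB g g' : mu.-integrable setT (EFin \o g) -> mu.-integrable setT (EFin \o g') ->
    cosT (fun xi => g xi - g' xi) x = cosT g x - cosT g' x.
  move=> ig ig'; rewrite /cosT -RintegralB//; [|exact: integrable_mul_cos|exact: integrable_mul_cos].
  by apply: eq_Rintegral => y _; rewrite mulrBl.
have sB g g' : mu.-integrable setT (EFin \o g) -> mu.-integrable setT (EFin \o g') ->
    sinT (fun xi => g xi - g' xi) x = sinT g x - sinT g' x.
  move=> ig ig'; rewrite /sinT -RintegralB//; [|exact: integrable_mul_sin|exact: integrable_mul_sin].
  by apply: eq_Rintegral => y _; rewrite mulrBl.
have E1 : (fun xi => complex.Re (m xi - m' xi)) =
    (fun xi => complex.Re (m xi) - complex.Re (m' xi)) by apply/funext => y; exact: cReB.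
have E2 : (fun xi => complex.Im (m xi - m' xi)) =
    (fun xi => complex.Im (m xi) - complex.Im (m' xi)) by apply/funext => y; exact: cImB.
by rewrite E1 E2 !cB// !sB//; congr Complex; ring.
Qed.

Lemma measurable_cmod_sqr m : cmeasurable m ->
  measurable_fun setT (fun x => (cmod (m x) ^+ 2)%:E).
Proof.
move=> [m1 m2]; apply/measurable_EFinP; under eq_fun do rewrite cmod_sqr.
by apply: measurable_funD; exact: measurable_funX.
Qed.

Lemma cmeasurable_ifourier m : cintegrable m -> cmeasurable (ifourier m).
Proof.
move=> [i1 i2]; have [E1 E2] := ifourier_ReIm i1 i2; split; rewrite ?E1 ?E2.
  by apply: measurable_funB; [exact: measurable_cosT|exact: measurable_sinT].
by apply: measurable_funD; [exact: measurable_cosT|exact: measurable_sinT].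
Qed.

Lemma cmeasurable_fourier f : cintegrable f -> cmeasurable (fourier f).
Proof.
move=> [i1 i2]; have [E1 E2] := fourier_ReIm i1 i2; split; rewrite ?E1 ?E2.
  by apply: measurable_funD; [exact: measurable_cosT|exact: measurable_sinT].
by apply: measurable_funB; [exact: measurable_cosT|exact: measurable_sinT].
Qed.

(** Both Fourier integrals are sums of two real transforms; bounding the square
    of a sum by twice the sum of the squares costs the factor 2. *)
Lemma transform_L2 (T : ('rV[R]_d -> R[i]) -> 'rV[R]_d -> R[i]) m : cintegrable m ->
  cmeasurable (T m) ->
  (forall x, cmod (T m x) ^+ 2 <=
    2 * (cosT (fun xi => complex.Re (m xi)) x ^+ 2 +
         sinT (fun xi => complex.Re (m xi)) x ^+ 2) +
    2 * (cosT (fun xi => complex.Im (m xi)) x ^+ 2 +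
         sinT (fun xi => complex.Im (m xi)) x ^+ 2)) ->
  (\int[mu]_x (cmod (T m x) ^+ 2)%:E <= 2%:E * \int[mu]_xi (cmod (m xi) ^+ 2)%:E)%E.
Proof.
move=> [i1 i2] mT le2.
under [X in (_ <= _ * X)%E]eq_integral do rewrite cmod_sqr.
apply: le_trans (bessel2 i1 i2).
apply: ge0_le_integral => //.
- by move=> x _; rewrite lee_fin sqr_ge0.
- exact: measurable_cmod_sqr.
- have m1 := measurable_cosT i1; have m2 := measurable_sinT i1.
  have m3 := measurable_cosT i2; have m4 := measurable_sinT i2.
  apply/measurable_EFinP; apply: measurable_funD; apply: measurable_funM => //;
    by apply: measurable_funD; exact: measurable_funX.
- by move=> x _; rewrite lee_fin; exact: le2.
Qed.

Lemma ifourier_L2 m : cintegrable m ->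
  (\int[mu]_x (cmod (ifourier m x) ^+ 2)%:E <=
   2%:E * \int[mu]_xi (cmod (m xi) ^+ 2)%:E)%E.
Proof.
move=> im; apply: transform_L2 => //; first exact: cmeasurable_ifourier.
move=> x; have [i1 i2] := im; rewrite ifourierE// cmod_sqr /=.
set c1 := cosT _ x; set s1 := sinT _ x; set c2 := cosT _ x; set s2 := sinT _ x.
rewrite -subr_ge0.
have -> : 2 * (c1 ^+ 2 + s2 ^+ 2) + 2 * (c2 ^+ 2 + s1 ^+ 2) -
  ((c1 - s1) ^+ 2 + (c2 + s2) ^+ 2) = (c1 + s1) ^+ 2 + (c2 - s2) ^+ 2 by ring.
by rewrite addr_ge0 ?sqr_ge0.
Qed.

Lemma fourier_L2 f : cintegrable f ->
  (\int[mu]_xi (cmod (fourier f xi) ^+ 2)%:E <=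
   2%:E * \int[mu]_x (cmod (f x) ^+ 2)%:E)%E.
Proof.
move=> i_f; apply: transform_L2 => //; first exact: cmeasurable_fourier.
move=> x; have [i1 i2] := i_f; rewrite fourierE// cmod_sqr /=.
set c1 := cosT _ x; set s1 := sinT _ x; set c2 := cosT _ x; set s2 := sinT _ x.
rewrite -subr_ge0.
have -> : 2 * (c1 ^+ 2 + s2 ^+ 2) + 2 * (c2 ^+ 2 + s1 ^+ 2) -
  ((c1 + s1) ^+ 2 + (c2 - s2) ^+ 2) = (c1 - s1) ^+ 2 + (c2 + s2) ^+ 2 by ring.
by rewrite addr_ge0 ?sqr_ge0.
Qed.

End maximal_bound.

(** * The square function of the chaining bound *)

Section chain_sum.
Context {R : realType}.
Local Notation r := (@chain_ratio R).

(** The double series of [chaining], for complex functions. *)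
Definition chain_sum (h : R -> R[i]) : \bar R :=
  (\sum_(l <oo) \sum_(p <oo) (r ^- l * cmod (dyadic_diff h l p) ^+ 2)%:E)%E.

Lemma chain_term_ge0 (h : R -> R[i]) l p :
  (0 <= (r ^- l * cmod (dyadic_diff h l p) ^+ 2)%:E)%E.
Proof.
by rewrite lee_fin mulr_ge0 ?sqr_ge0// invr_ge0 exprn_ge0// ltW// chain_ratio_gt0.
Qed.

Lemma chain_sum_ge0 h : (0 <= chain_sum h)%E.
Proof.
by apply: nneseries_ge0 => l _ _; apply: nneseries_ge0 => p _ _; exact: chain_term_ge0.
Qed.

Lemma chaining_complex (h : R -> R[i]) u :
  continuous (fun u => complex.Re (h u)) -> continuous (fun u => complex.Im (h u)) ->
  0 <= u -> ((cmod (h u) ^+ 2)%:E <= (1 - r)^-1%:E * chain_sum h)%E.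
Proof.
move=> c1 c2 u0.
have r01 : 0 < r < 1 by rewrite chain_ratio_gt0 chain_ratio_lt1.
have ri0 : (0 <= (1 - r)^-1%:E)%E by rewrite lee_fin invr_ge0 subr_ge0 ltW// chain_ratio_lt1.
have h1 := chaining r01 c1 u0; have h2 := chaining r01 c2 u0.
have t0 (g : R -> R) l p : (0 <= (r ^- l * dyadic_diff g l p ^+ 2)%:E)%E.
  by rewrite lee_fin mulr_ge0 ?sqr_ge0// invr_ge0 exprn_ge0// ltW// chain_ratio_gt0.
have s0 (g : R -> R) l : (0 <= \sum_(p <oo) (r ^- l * dyadic_diff g l p ^+ 2)%:E)%E.
  by apply: nneseries_ge0 => p _ _; exact: t0.
rewrite cmod_sqr EFinD; apply: le_trans (leeD h1 h2) _.
rewrite -ge0_muleDr; [|by apply: nneseries_ge0 => l _ _; exact: s0..].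
apply: lee_wpmul2l => //.
rewrite -nneseriesD; [|by move=> *; exact: s0..].
apply: lee_nneseries => [l _ _|l _]; first by rewrite adde_ge0.
rewrite -nneseriesD; [|by move=> *; exact: t0..].
apply: lee_nneseries => [p _ _|p _]; first by rewrite adde_ge0.
rewrite -EFinD -mulrDr cmod_sqr lee_fin.
by case: l => [|l]; rewrite /= ?cReB ?cImB.
Qed.

(** The frequency side of the argument: [sum_dyadic_diff] gains the factor
    [chain_ratio ^+ l] over the weights of [chain_sum]. *)
Lemma chain_sum_controlled (K A : R) b (z : R[i]) : 0 < K -> 0 <= A ->
  ray_controlled K A b ->
  (chain_sum (fun u => (b u * z)%R) <=
   (chain_const K * Num.sqrt A * (1 - r)^-1 * cmod z ^+ 2)%:E)%E.
Proof.
move=> K0 A0 bK; have r0 := @chain_ratio_gt0 R.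
have r01 : 0 < r < 1 by rewrite chain_ratio_gt0 chain_ratio_lt1.
have E l p : dyadic_diff (fun u => (b u * z)%R) l p = dyadic_diff b l p * z.
  by case: l => [|l] //=; rewrite mulrBl.
set c := chain_const K * Num.sqrt A.
have sum_p l : (\sum_(p <oo) (r ^- l * cmod (dyadic_diff (fun u => (b u * z)%R) l p) ^+ 2)%:E <=
    (c * cmod z ^+ 2 * r ^+ l)%:E)%E.
  apply: lime_le; first by apply: is_cvg_nneseries => p _ _; exact: chain_term_ge0.
  apply: nearW => n; rewrite big_mkord sumEFin lee_fin.
  under eq_bigr do rewrite E cmodM exprMn mulrA mulrAC.
  rewrite -mulr_sumr.
  have -> : c * cmod z ^+ 2 * r ^+ l = r ^- l * cmod z ^+ 2 * (c * (r ^+ l * r ^+ l)).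
    by field; rewrite gt_eqF ?exprn_gt0.
  rewrite ler_wpM2l ?mulr_ge0 ?cmod_ge0 ?invr_ge0 ?exprn_ge0 ?(ltW r0)//.
  exact: sum_dyadic_diff.
have c0 : 0 <= c * cmod z ^+ 2.
  rewrite -[leRHS]mulr1 -(expr0 r) -lee_fin; apply: le_trans (sum_p 0%N).
  by apply: nneseries_ge0 => p _ _; exact: chain_term_ge0.
apply: lime_le.
  apply: is_cvg_nneseries => l _ _; apply: nneseries_ge0 => p _ _.
  exact: chain_term_ge0.
apply: nearW => n; rewrite big_mkord.
apply: le_trans (_ : _ <= \sum_(l < n) (c * cmod z ^+ 2 * r ^+ l)%:E)%E _.
  by apply: lee_sum => l _; exact: sum_p.
rewrite sumEFin lee_fin -mulr_sumr [leRHS]mulrAC ler_wpM2l//.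
exact: sum_geometric_le.
Qed.

End chain_sum.

Section chain_sum_transform.
Context {R : realType} (d : nat).
Local Notation mu := (@lebesgue_rV R d).
Implicit Types (m : R -> 'rV[R]_d -> R[i]) (G : 'rV[R]_d -> R) (x xi : 'rV[R]_d).

Lemma dyadic_diff_ifourier m l p x : (forall u, cintegrable (m u)) ->
  dyadic_diff (fun u => ifourier (m u) x) l p =
  ifourier (fun xi => dyadic_diff (fun u => m u xi) l p) x.
Proof. by move=> im; case: l => //= l; rewrite ifourierB. Qed.

Lemma cintegrable_dyadic_diff m l p : (forall u, cintegrable (m u)) ->
  cintegrable (fun xi => dyadic_diff (fun u => m u xi) l p).
Proof. by move=> im; case: l => //= l; exact: cintegrableB. Qed.

Lemma integral_chain_sum m : (forall l p, cmeasurable (fun x => dyadic_diff (m^~ x) l p)) ->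
  (\int[mu]_x chain_sum (m^~ x) =
   \sum_(l <oo) \sum_(p <oo)
     ((chain_ratio ^- l)%:E * \int[mu]_x (cmod (dyadic_diff (m^~ x) l p) ^+ 2)%:E))%E.
Proof.
move=> mm.
have mt l p : measurable_fun setT (fun x =>
    (chain_ratio ^- l * cmod (dyadic_diff (m^~ x) l p) ^+ 2)%:E).
  under eq_fun do rewrite EFinM.
  by apply: measurable_funeM; exact: measurable_cmod_sqr.
have rl l : (0 <= (@chain_ratio R ^- l)%:E)%E.
  by rewrite lee_fin invr_ge0 exprn_ge0// ltW// chain_ratio_gt0.
rewrite /chain_sum integral_nneseries//; last 2 first.
- move=> l; apply: ge0_emeasurable_sum => p *; [exact: chain_term_ge0|exact: mt].
- by move=> l x _; apply: nneseries_ge0 => p _ _; exact: chain_term_ge0.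
apply: eq_eseriesr => l _; rewrite integral_nneseries//; last first.
  by move=> p x _; exact: chain_term_ge0.
apply: eq_eseriesr => p _; under eq_integral do rewrite EFinM.
rewrite ge0_integralZl//; first exact: measurable_cmod_sqr.
by move=> x _; rewrite lee_fin sqr_ge0.
Qed.

Lemma measurable_chain_sum m : (forall l p, cmeasurable (fun x => dyadic_diff (m^~ x) l p)) ->
  measurable_fun setT (fun x => chain_sum (m^~ x)).
Proof.
move=> mm; apply: ge0_emeasurable_sum => l *.
  by apply: nneseries_ge0 => p _ _; exact: chain_term_ge0.
apply: ge0_emeasurable_sum => p *; first exact: chain_term_ge0.
by under eq_fun do rewrite EFinM; apply: measurable_funeM; exact: measurable_cmod_sqr.
Qed.

(** The transform acts on each dyadic increment separately, so that Bessel's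
    inequality carries [chain_sum] from the frequency side to the space side. *)
Lemma integral_chain_sum_ifourier m : (forall u, cintegrable (m u)) ->
  (\int[mu]_x chain_sum (fun u => ifourier (m u) x) <=
   2%:E * \int[mu]_xi chain_sum (m^~ xi))%E.
Proof.
move=> im.
have id l p := cintegrable_dyadic_diff l p im.
have E l p : (fun x => dyadic_diff (fun u => ifourier (m u) x) l p) =
    ifourier (fun xi => dyadic_diff (m^~ xi) l p).
  by apply/funext => x; exact: dyadic_diff_ifourier.
have rl l : (0 <= (@chain_ratio R ^- l)%:E)%E.
  by rewrite lee_fin invr_ge0 exprn_ge0// ltW// chain_ratio_gt0.
have I0 (g : 'rV[R]_d -> R[i]) : (0 <= \int[mu]_x (cmod (g x) ^+ 2)%:E)%E.
  by apply: integral_ge0 => x _; rewrite lee_fin sqr_ge0.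
rewrite (@integral_chain_sum (fun u => ifourier (m u))); last first.
  by move=> l p; rewrite E; exact: cmeasurable_ifourier.
rewrite integral_chain_sum; last by move=> l p; exact: cintegrable_measurable.
rewrite -nneseriesZl; last first.
  by move=> l _; apply: nneseries_ge0 => p _ _; rewrite mule_ge0.
apply: lee_nneseries => [l _ _|l _].
  by apply: nneseries_ge0 => p _ _; rewrite mule_ge0.
rewrite -nneseriesZl; last by move=> p _; rewrite mule_ge0.
apply: lee_nneseries => [p _ _|p _]; first by rewrite mule_ge0.
rewrite muleCA; apply: lee_wpmul2l => //.
have -> : (\int[mu]_x (cmod (dyadic_diff (fun u => ifourier (m u) x) l p) ^+ 2)%:E =
    \int[mu]_x (cmod (ifourier (fun xi => dyadic_diff (m^~ xi) l p) x) ^+ 2)%:E)%E.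
  by apply: eq_integral => x _; rewrite dyadic_diff_ifourier.
exact: ifourier_L2.
Qed.

Lemma continuous_Rintegral_dominated (g : R -> 'rV[R]_d -> R) G :
  (forall u, mu.-integrable setT (EFin \o g u)) -> (forall xi, continuous (g^~ xi)) ->
  mu.-integrable setT (EFin \o G) -> (forall u xi, `|g u xi| <= G xi) ->
  continuous (fun u => \int[mu]_xi g u xi).
Proof.
move=> ig cg iG gG u.
have := @continuity_under_integral R _ _ mu g setT measurableT (u - 1) (u + 1)
  (fun v _ => ig v) _ G iG.
apply; last by rewrite inE /= in_itv /= ltrBlDr ltrDl ltr01.
- by apply: aeW => xi _ v _; exact: cg.
- by move=> v _; apply: aeW => xi _; exact: gG.
Qed.

Lemma continuous_ifourier m G x : (forall u, cintegrable (m u)) ->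
  (forall xi, continuous (fun u => complex.Re (m u xi))) ->
  (forall xi, continuous (fun u => complex.Im (m u xi))) ->
  mu.-integrable setT (EFin \o G) -> (forall u xi, cmod (m u xi) <= G xi) ->
  continuous (fun u => complex.Re (ifourier (m u) x)) /\
  continuous (fun u => complex.Im (ifourier (m u) x)).
Proof.
move=> im cR cI iG mG.
have bR u xi : `|complex.Re (m u xi)| <= G xi by exact: le_trans (normr_Re_cmod _) (mG u xi).
have bI u xi : `|complex.Im (m u xi)| <= G xi by exact: le_trans (normr_Im_cmod _) (mG u xi).
have cc (g : R -> 'rV[R]_d -> R) : (forall u, mu.-integrable setT (EFin \o g u)) ->
    (forall xi, continuous (g^~ xi)) -> (forall u xi, `|g u xi| <= G xi) ->
    continuous (fun u => cosT (g u) x) /\ continuous (fun u => sinT (g u) x).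
  move=> ig cg gG; split; apply: continuous_Rintegral_dominated iG _.
  - by move=> u; exact: integrable_mul_cos.
  - by move=> xi u; apply: cvgMl; exact: cg.
  - by move=> u xi; rewrite normrM (le_trans (ler_piMr _ (normr_cos_le1 _))).
  - by move=> u; exact: integrable_mul_sin.
  - by move=> xi u; apply: cvgMl; exact: cg.
  - by move=> u xi; rewrite normrM (le_trans (ler_piMr _ (normr_sin_le1 _))).
have [c1 c2] := cc _ (fun u => (im u).1) cR bR.
have [c3 c4] := cc _ (fun u => (im u).2) cI bI.
split; under eq_fun do rewrite (ifourierE _ (im _).1 (im _).2) /=.
  by move=> u; apply: cvgB; [exact: c1|exact: c4].
by move=> u; apply: cvgD; [exact: c3|exact: c2].
Qed.

End chain_sum_transform.

(** * The maximal operator *)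

Section maximal_L2.
Context {R : realType} (d : nat).
Local Notation mu := (@lebesgue_rV R d).
Local Notation r := (@chain_ratio R).
Implicit Types (a f F : 'rV[R]_d -> R[i]) (x xi : 'rV[R]_d).

Lemma chain_const_gt0 (K : R) : 0 < K -> 0 < chain_const K.
Proof.
move=> K0; have e1 : 0 < 1 + expR 1 :> R by rewrite addr_gt0 ?expR_gt0.
by rewrite /chain_const /root4 addr_gt0 ?mulr_gt0 ?sqrtr_gt0 ?mulr_gt0.
Qed.

(** The integral of a nonnegative function is a supremum over simple functions,
    hence monotone even when the smaller function is not measurable, as may
    happen for a supremum over uncountably many dilations. *)
Lemma le_integral_nonmeasurable dsp (T : measurableType dsp)
    (nu : {measure set T -> \bar R}) (g h : T -> \bar R) :
  (forall t, (0 <= g t)%E) -> (forall t, (g t <= h t)%E) ->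
  (\int[nu]_t g t <= \int[nu]_t h t)%E.
Proof.
move=> g0 gh; rewrite !ge0_integralTE//; last by move=> t; exact: le_trans (g0 t) (gh t).
apply: ereal_sup_le => _ [k kg <-]; exists k => // t.
exact: le_trans (kg t) (gh t).
Qed.

Lemma ereal_sup_sqr_le (S : set R) (B : \bar R) : S !=set0 ->
  (forall s, S s -> 0 <= s /\ ((s ^+ 2)%:E <= B)%E) ->
  (`|ereal_sup (EFin @` S)| `^ 2 <= B)%E.
Proof.
move=> [s0 Ss0] SB.
have y0 : (0 <= ereal_sup (EFin @` S))%E.
  apply: le_trans (ereal_sup_ubound _); last by exists s0.
  by rewrite lee_fin; exact: (SB _ Ss0).1.
have B0 : (0 <= B)%E by apply: le_trans (SB _ Ss0).2; rewrite lee_fin sqr_ge0.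
rewrite gee0_abs//; case: B B0 SB => [b||]// b0 SB; last by rewrite leey.
rewrite lee_fin in b0.
have ys : (ereal_sup (EFin @` S) <= (Num.sqrt b)%:E)%E.
  apply: ge_ereal_sup => _ [s Ss <-]; have [s0' sb] := SB s Ss.
  rewrite lee_fin -(ger0_norm s0') -sqrtr_sqr; apply: ler_wsqrtr.
  by rewrite -lee_fin.
apply: (@le_trans _ _ ((Num.sqrt b)%:E `^ 2)%E).
  by apply: gt0_ler_poweR => //; rewrite in_itv /= leey andbT// lee_fin sqrtr_ge0.
by rewrite poweR_EFin lee_fin powR_mulrn ?sqrtr_ge0// sqr_sqrtr.
Qed.

Section one_multiplier.
Variables (a : 'rV[R]_d -> R[i]) (M : R).
Hypothesis aM : forall xi, cmod (a xi) <= M.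
Hypothesis da : forall xi, cdifferentiable a xi.

Lemma continuous_multiplier :
  continuous (fun xi => complex.Re (a xi)) /\ continuous (fun xi => complex.Im (a xi)).
Proof.
by split=> xi; apply/differentiable_continuous; case: (da xi).
Qed.

Lemma continuous_log_dilation (s : R) xi : continuous (fun u : R => expR (s * u) *: xi).
Proof.
move=> u; apply: (@continuous_comp _ _ _ (fun u => expR (s * u)) ( *:%R^~ xi)).
  apply: continuous_comp; last exact: continuous_expR.
  by apply: cvgMr; exact: cvg_id.
exact: scalel_continuous.
Qed.

Lemma cmeasurable_dilation (t : R) : cmeasurable (fun xi => a (t *: xi)).
Proof.
have [c1 c2] := continuous_multiplier.
split; apply: continuous_measurable_rV => xi.
  apply: (@continuous_comp _ _ _ (fun y : 'rV[R]_d => t *: y)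
      (fun y => complex.Re (a y))).
    exact: scaler_continuous.
  exact: c1.
apply: (@continuous_comp _ _ _ (fun y : 'rV[R]_d => t *: y)
      (fun y => complex.Im (a y))).
  exact: scaler_continuous.
exact: c2.
Qed.

(** The dilations by [expR (s * u)] with [0 <= u]: [s = 1] and [s = -1] give all
    dilations by at least, respectively at most, 1. *)
Let fam F s u xi := a (expR (s * u) *: xi) * F xi.

Lemma cintegrable_dilated F s u : cintegrable F -> cintegrable (fam F s u).
Proof. by move=> iF; apply: cintegrableM iF => //; exact: cmeasurable_dilation. Qed.

Lemma continuous_dilated_ifourier F s x : cintegrable F ->
  continuous (fun u => complex.Re (ifourier (fam F s u) x)) /\
  continuous (fun u => complex.Im (ifourier (fam F s u) x)).
Proof.
move=> iF; have [i1 i2] := iF; have [c1 c2] := continuous_multiplier.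
have k1 xi : continuous (fun u => complex.Re (a (expR (s * u) *: xi))).
  move=> u; apply: (@continuous_comp _ _ _ (fun u => expR (s * u) *: xi)
    (fun y => complex.Re (a y))); first exact: continuous_log_dilation.
  exact: c1.
have k2 xi : continuous (fun u => complex.Im (a (expR (s * u) *: xi))).
  move=> u; apply: (@continuous_comp _ _ _ (fun u => expR (s * u) *: xi)
    (fun y => complex.Im (a y))); first exact: continuous_log_dilation.
  exact: c2.
apply: (@continuous_ifourier _ _ _
  (fun xi => M * (`|complex.Re (F xi)| + `|complex.Im (F xi)|))).
- by move=> u; exact: cintegrable_dilated.
- move=> xi; rewrite (_ : (fun u => _) = (fun u =>
      complex.Re (a (expR (s * u) *: xi)) * complex.Re (F xi) -
      complex.Im (a (expR (s * u) *: xi)) * complex.Im (F xi))); last first.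
    by apply/funext => u; exact: cReM.
  by move=> u; apply: cvgB; apply: cvgMl; [exact: k1|exact: k2].
- move=> xi; rewrite (_ : (fun u => _) = (fun u =>
      complex.Re (a (expR (s * u) *: xi)) * complex.Im (F xi) +
      complex.Im (a (expR (s * u) *: xi)) * complex.Re (F xi))); last first.
    by apply/funext => u; exact: cImM.
  by move=> u; apply: cvgD; apply: cvgMl; [exact: k1|exact: k2].
- by apply: integrableRZ; apply: integrableRD; exact: integrable_norm.
- move=> u xi; rewrite cmodM; apply: ler_pM; rewrite ?cmod_ge0//.
  exact: cmod_le_add.
Qed.

(** Dilations by t >= 1 are followed from 1 upwards and those by t < 1 downwards, each
    on its own half-line of logarithms. *)
Lemma maximal_op_chain f x : cintegrable (fourier f) ->
  (`|maximal_op a f x| `^ 2 <= (1 - r)^-1%:E *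
    (chain_sum (fun u => ifourier (fam (fourier f) 1 u) x) +
     chain_sum (fun u => ifourier (fam (fourier f) (-1) u) x)))%E.
Proof.
move=> iF.
have ri0 : (0 <= (1 - r)^-1%:E)%E by rewrite lee_fin invr_ge0 subr_ge0 ltW// chain_ratio_lt1.
have -> : maximal_op a f x = ereal_sup (EFin @`
    [set cmod (multiplier_op a t f x) | t in [set t : R | 0 < t]]).
  by rewrite /maximal_op image_comp.
apply: ereal_sup_sqr_le; first by exists (cmod (multiplier_op a 1 f x)); exists 1 => /=.
move=> _ [t t0 <-]; split; first exact: cmod_ge0.
have E s u : t = expR (s * u) -> multiplier_op a t f x = ifourier (fam (fourier f) s u) x.
  by move=> ->.
have [t1|t1] := leP 1 t.
  have [c1 c2] := continuous_dilated_ifourier 1 x iF.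
  rewrite (E 1 (ln t)); last by rewrite mul1r lnK.
  apply: le_trans (chaining_complex c1 c2 (ln_ge0 t1)) _.
  by apply: lee_wpmul2l => //; rewrite leeDl// chain_sum_ge0.
have [c1 c2] := continuous_dilated_ifourier (-1) x iF.
rewrite (E (-1) (- ln t)); last by rewrite mulrNN mul1r lnK.
apply: le_trans (chaining_complex c1 c2 _) _; first by rewrite oppr_ge0 ln_le0// ltW.
by apply: lee_wpmul2l => //; rewrite leeDr// chain_sum_ge0.
Qed.

Lemma integral_chain_sum_dilated (K A : R) f s : 0 < K -> 0 <= A -> cintegrable f ->
  cintegrable (fourier f) ->
  {ae mu, forall xi, ray_controlled K A (fun u => a (expR (s * u) *: xi))} ->
  (\int[mu]_x chain_sum (fun u => ifourier (fam (fourier f) s u) x) <=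
   (4 * (chain_const K * Num.sqrt A * (1 - r)^-1))%:E * \int[mu]_x (cmod (f x) ^+ 2)%:E)%E.
Proof.
move=> K0 A0 i_f iF ctrl.
set c := chain_const K * _ * _.
have im u := cintegrable_dilated s u iF.
have c0 : 0 <= c.
  rewrite mulr_ge0 ?mulr_ge0 ?sqrtr_ge0 ?invr_ge0 ?subr_ge0 ?(ltW (@chain_ratio_lt1 R))//.
  exact: ltW (chain_const_gt0 K0).
have mF : measurable_fun setT (fun xi => (cmod (fourier f xi) ^+ 2)%:E).
  by apply: measurable_cmod_sqr; exact: cmeasurable_fourier.
apply: le_trans (integral_chain_sum_ifourier im) _.
apply: le_trans (_ : _ <= 2%:E * (c%:E * (2%:E * \int[mu]_x (cmod (f x) ^+ 2)%:E)))%E _; last first.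
  by rewrite !muleA -!EFinM; apply: lee_wpmul2r; [apply: integral_ge0 => x _; rewrite lee_fin sqr_ge0|rewrite lee_fin; lra].
apply: lee_wpmul2l => //.
apply: le_trans (_ : _ <= c%:E * \int[mu]_xi (cmod (fourier f xi) ^+ 2)%:E)%E _; last first.
  by apply: lee_wpmul2l; [rewrite lee_fin|exact: fourier_L2].
rewrite -ge0_integralZl//; last by move=> xi _; rewrite lee_fin sqr_ge0.
apply: ae_ge0_le_integral => //.
- by move=> xi _; exact: chain_sum_ge0.
- apply: measurable_chain_sum => l p.
  by apply: cintegrable_measurable; exact: (cintegrable_dyadic_diff l p im).
- by move=> xi _; rewrite -EFinM lee_fin mulr_ge0 ?sqr_ge0.
- exact: measurable_funeM.
apply: filterS ctrl => xi ctrl _.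
by rewrite -EFinM; exact: chain_sum_controlled.
Qed.

End one_multiplier.

End maximal_L2.

(** * From square functions to operator norms *)

Section final.
Context {R : realType} (d : nat).
Local Notation mu := (@lebesgue_rV R d).
Local Notation r := (@chain_ratio R).
Implicit Types (a f : 'rV[R]_d -> R[i]) (x xi : 'rV[R]_d).

Definition maximal_const (K : R) : R := Num.sqrt (8 * chain_const K) * (1 - r)^-1.

Lemma maximal_const_gt0 K : 0 < K -> 0 < maximal_const K.
Proof.
move=> K0; rewrite mulr_gt0 ?invr_gt0 ?subr_gt0 ?chain_ratio_lt1//.
by rewrite sqrtr_gt0 mulr_gt0// chain_const_gt0.
Qed.

(** The constant 8 counts the two half-lines, and Bessel's inequality used with its
    factor 2 both for [f] and for the increments of the maximal operator. *)
Lemma integral_maximal_op_sqr a (K A M : R) f : 0 < K -> 0 <= A ->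
  (forall xi, cmod (a xi) <= M) -> (forall xi, cdifferentiable a xi) ->
  {ae mu, forall xi, ray_controlled K A (fun u => a (expR u *: xi))} ->
  schwartz f ->
  (\int[mu]_x `|maximal_op a f x| `^ 2 <=
   ((maximal_const K * root4 A) ^+ 2)%:E * \int[mu]_x (cmod (f x) ^+ 2)%:E)%E.
Proof.
move=> K0 A0 aM da ctrl sf.
have iF := cintegrable_fourier sf.
have i_f : cintegrable f.
  by have [s1 s2] := schwartz_rschwartz sf; split; exact: rschwartz_integrable.
have r1 : 0 < 1 - r by rewrite subr_gt0 chain_ratio_lt1.
have ri0 : (0 <= (1 - r)^-1%:E)%E by rewrite lee_fin invr_ge0 ltW.
have ctrlp : {ae mu, forall xi, ray_controlled K A (fun u => a (expR (1 * u) *: xi))}.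
  by apply: filterS ctrl => xi; under [X in _ -> ray_controlled _ _ X]eq_fun do rewrite mul1r.
have ctrln : {ae mu, forall xi, ray_controlled K A (fun u => a (expR (-1 * u) *: xi))}.
  apply: filterS ctrl => xi /ray_controlled_opp.
  by under [X in _ -> ray_controlled _ _ X]eq_fun do rewrite mulN1r.
have bp := integral_chain_sum_dilated aM da K0 A0 i_f iF ctrlp.
have bn := integral_chain_sum_dilated aM da K0 A0 i_f iF ctrln.
have ms s : measurable_fun setT (fun x =>
    chain_sum (fun u => ifourier (fun xi => a (expR (s * u) *: xi) * fourier f xi) x)).
  pose m u := fun xi => a (expR (s * u) *: xi) * fourier f xi.
  have im u : cintegrable (m u) := cintegrable_dilated aM da s u iF.
  apply: (@measurable_chain_sum _ _ (fun u => ifourier (m u))) => l p.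
  rewrite (_ : (fun x => _) = ifourier (fun xi => dyadic_diff (m^~ xi) l p)).
    by apply: cmeasurable_ifourier; exact: cintegrable_dyadic_diff.
  by apply/funext => x; exact: dyadic_diff_ifourier.
apply: le_trans (le_integral_nonmeasurable mu (fun x => poweR_ge0 _ _)
  (fun x => maximal_op_chain aM da x iF)) _.
rewrite ge0_integralZl//; last 2 first.
- by apply: emeasurable_funD; exact: ms.
- by move=> x _; rewrite adde_ge0// chain_sum_ge0.
rewrite ge0_integralD//; last 2 first.
- by move=> x _; rewrite chain_sum_ge0.
- by move=> x _; rewrite chain_sum_ge0.
apply: le_trans (lee_wpmul2l ri0 (leeD bp bn)) _.
have I0 : (0 <= \int[mu]_x (cmod (f x) ^+ 2)%:E)%E.
  by apply: integral_ge0 => x _; rewrite lee_fin sqr_ge0.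
have c0 := ltW (chain_const_gt0 K0).
rewrite -ge0_muleDl; last 2 first.
- by rewrite lee_fin !mulr_ge0 ?sqrtr_ge0 ?invr_ge0 ?(ltW r1).
- by rewrite lee_fin !mulr_ge0 ?sqrtr_ge0 ?invr_ge0 ?(ltW r1).
rewrite muleA -EFinD -EFinM; apply: lee_wpmul2r => //; rewrite lee_fin.
rewrite /maximal_const !exprMn !sqr_sqrtr ?sqrtr_ge0 ?mulr_ge0//.
by rewrite le_eqVlt; apply/orP; left; apply/eqP; ring.
Qed.

Lemma Lnorm2_maximal_op a (K A M : R) f : 0 < K -> 0 <= A ->
  (forall xi, cmod (a xi) <= M) -> (forall xi, cdifferentiable a xi) ->
  {ae mu, forall xi, ray_controlled K A (fun u => a (expR u *: xi))} ->
  schwartz f ->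
  ('N[mu]_2%:E[maximal_op a f] <=
   (maximal_const K * root4 A)%:E * 'N[mu]_2%:E[EFin \o cmod \o f])%E.
Proof.
move=> K0 A0 aM da ctrl sf.
have h := integral_maximal_op_sqr K0 A0 aM da ctrl sf.
have c0 : 0 <= maximal_const K * root4 A.
  by rewrite mulr_ge0 ?sqrtr_ge0// ltW// maximal_const_gt0.
rewrite unlock.
have E : (\int[mu]_x `|(EFin \o cmod \o f) x| `^ 2 = \int[mu]_x (cmod (f x) ^+ 2)%:E)%E.
  apply: eq_integral => x _ /=; rewrite powR_mulrn ?normr_ge0//.
  by rewrite ger0_norm// cmod_ge0.
rewrite E; set I := (\int[mu]_x (cmod _ ^+ 2)%:E)%E in h *.
have I0 : (0 <= I)%E by apply: integral_ge0 => x _; rewrite lee_fin sqr_ge0.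
have -> : (maximal_const K * root4 A)%:E = ((((maximal_const K * root4 A) ^+ 2)%:E) `^ 2^-1)%E.
  by rewrite poweR_EFin powR12_sqrt ?sqr_ge0// sqrtr_sqr ger0_norm.
rewrite -poweRM ?lee_fin ?sqr_ge0//.
apply: gt0_ler_poweR => //; rewrite in_itv /= leey andbT.
  by apply: integral_ge0 => x _; exact: poweR_ge0.
by rewrite mule_ge0// lee_fin sqr_ge0.
Qed.

Lemma Linfty_norm_bounded a (M : R) : (forall xi, cmod (a xi) <= M) ->
  exists2 A : R, 0 <= A & Linfty_norm a = A%:E /\ {ae mu, forall xi, cmod (a xi) <= A}.
Proof.
move=> aM; have M0 : 0 <= M by exact: le_trans (cmod_ge0 (a 0)) (aM 0).
have N0 : (0 <= Linfty_norm a)%E by exact: Lnorm_ge0.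
have NM : (Linfty_norm a <= M%:E)%E.
  rewrite /Linfty_norm unlock; case: ifPn => // _.
  by apply/ess_supP; apply: aeW => xi /=; rewrite lee_fin ger0_norm ?cmod_ge0.
have NE : Linfty_norm a = (fine (Linfty_norm a))%:E.
  by rewrite fineK// ge0_fin_numE// (le_lt_trans NM)// ltry.
exists (fine (Linfty_norm a)); first by rewrite fine_ge0.
split=> //; have [mu0|] := boolP (0 < mu setT)%E.
  apply: filterS (ess_sup_ge mu (abse \o (EFin \o cmod \o a))) => xi.
  have -> : ess_sup mu (abse \o (EFin \o cmod \o a)) = Linfty_norm a.
    by rewrite /Linfty_norm unlock mu0.
  by rewrite {1}NE /= lee_fin ger0_norm// cmod_ge0.
(* For a null measure the norm is 0 by definition, and the complement of any set
   is negligible. *)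
rewrite -leNgt => mu0; exists setT; split => //.
by apply/eqP; rewrite eq_le mu0 measure_ge0.
Qed.

End final.

Theorem theorem1p7 (R : realType) (K : R) (hK : 0 < K) :
  exists C : R, 0 < C /\
    forall (d : nat) (hd : (1 <= d)%N) (a : 'rV[R]_d -> R[i])
      (a_bounded : exists M : R, forall xi, cmod (a xi) <= M)
      (a_diff : forall xi, cdifferentiable a xi)
      (a_bounds : {ae @lebesgue_rV R d, forall xi : 'rV[R]_d,
         [/\ cmod (a xi) <= K * (enorm xi / Num.sqrt d%:R),
             cmod (a xi) <= K * (Num.sqrt d%:R / enorm xi) &
             cmod (euler_derivative a xi) <= K]}),
      (maximal_opnorm a <= C%:E * (Linfty_norm a) `^ (4%:R^-1))%E.
Proof.
exists (maximal_const K); split; first exact: maximal_const_gt0.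
move=> d _ a [M aM] da a_bounds.
have [A A0 [-> aA]] := Linfty_norm_bounded aM.
have ctrl := ray_bounds da aA a_bounds.
have -> : (A%:E `^ 4%:R^-1 = (root4 A)%:E)%E.
  rewrite poweR_EFin; congr (_%:E).
  have -> : 4%:R^-1 = 2^-1 * 2^-1 :> R by rewrite -invfM -natrM.
  by rewrite powRrM !powR12_sqrt ?powR_ge0// sqrtr_ge0.
rewrite -EFinM; apply: ereal_inf_lbound => /=.
exists (maximal_const K * root4 A) => //; split.
  by rewrite mulr_ge0 ?sqrtr_ge0// ltW// maximal_const_gt0.
by move=> f sf; exact: Lnorm2_maximal_op hK A0 aM da ctrl sf.
Qed.
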